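(* For every integer $n\ge 1$, the Links--Gould polynomial distinguishes the Allen--Swenberg link $\mathrm{AS}(n)$ from the connected sum $H\#H$ of two (positive) Hopf links: $$\mathrm{LG}_{\mathrm{AS}(n)}(s,q)\neq \mathrm{LG}_{H\#H}(s,q).$$
   Context: **The Links--Gould polynomial $\mathrm{LG}_L(s,q)$ of an oriented link $L\subset S^3$.** Let $\mathrm{U}_q=\mathrm{U}_q(\mathfrak{sl}(2|1))$ be the Hopf superalgebra over $\mathbb{Q}(q,s)$ ($q,s$ indeterminates) with generators $E_i,F_i,K_i^{\pm1}$ ($i=1,2$), where $E_2,F_2$ are odd and the other generators even, Cartan matrix $(a_{ij})=\begin{pmatrix}2&-1\\-1&0\end{pmatrix}$, and relations: the $K_i$ commute, $K_iE_j=q^{a_{ij}}E_jK_i$, $K_iF_j=q^{-a_{ij}}F_jK_i$, $E_iF_j-(-1)^{|E_i||F_j|}F_jE_i=\delta_{ij}\frac{K_i-K_i^{-1}}{q-q^{-1}}$, $E_2^2=F_2^2=0$, $E_1^2E_2-(q+q^{-1})E_1E_2E_1+E_2E_1^2=0$ and the same relation for $F$. The coproduct is $\Delta(E_i)=E_i\otimes K_i+1\otimes E_i$, $\Delta(F_i)=F_i\otimes1+K_i^{-1}\otimes F_i$, $\Delta(K_i)=K_i\otimes K_i$, with the usual sign rule $(a\otimes b)(v\otimes w)=(-1)^{|b||v|}av\otimes bw$. Let $V=V(0,\alpha)$ (where $s=q^\alpha$) be the irreducible $4$-dimensional module with basis $x_0,x_1=F_2x_0,x_2=F_1x_1,x_3=F_2x_2$,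 where $x_0$ is even, $E_ix_0=0$, $F_1x_0=0$, $K_1x_0=x_0$, $K_2x_0=s\,x_0$. Then $V\otimes V$ is a direct sum of three pairwise non-isomorphic irreducibles: one of dimension $4$ whose highest weight vector has $(K_1,K_2)$-eigenvalues $(1,s^2)$, one of dimension $8$ with highest weight $(q,s^2)$, and one of dimension $4$ with highest weight $(1,qs^2)$. Let $\sigma\in\mathrm{End}_{\mathrm{U}_q}(V\otimes V)$ act on these by the scalars $s^2$, $-1$, $q^{-2}s^{-2}$ respectively, and let $\mu=\mathrm{diag}(s^{-2},-s^{-2},-q^{-2}s^{-2},q^{-2}s^{-2})$ in the basis $x_0,\dots,x_3$. The operator $\sigma$ satisfies the braid relation. If $L$ is the closure of a braid $\beta\in B_m$, let $\psi(\beta)\in\mathrm{End}(V^{\otimes m})$ be the operator obtained by sending each positive generator $\sigma_i$ (positive crossing) to $\sigma$ acting on factors $i,i+1$; the partial trace over the factors $2,\dots,m$ of $(\mathrm{id}\otimes\mu^{\otimes(m-1)})\circ\psi(\beta)$ is a scalar multiple of $\mathrm{id}_V$, and $\mathrm{LG}_L(s,q)$ is that scalar. It is an invariant of oriented links, equal to $1$ on the unknot and to $s^2+q^{-2}s^{-2}-1-q^{-2}$ on the positive Hopf link. **The links $\mathrm{AS}(n)$.** All tangles below are drawn in a rectangle with four endpoints: bottom-left (BL), bottom-right (BR), top-left (TL), top-right (TR); the tangle is oriented inward at BL and TR and outward at TL and BR. *The tangles $TT^{+},TT^-$.* Let $D$ be the tangle made of two antiparallel strands following the long right-handed trefoil with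 framing $0$: one strand runs from BL to TL along a long right-handed trefoil, the other is its $0$-framed parallel copy, oriented oppositely (from TR to BR). Concretely, take the long-knot diagram obtained from the $2$-strand braid $\sigma_1^3$ (three positive crossings) by closing its right strand on the right, replace it by its two-strand blackboard-parallel, and insert on top three full twists (six crossings) between the two strands, all six crossings being positive for the antiparallel orientation. Let $C^{\varepsilon}$ ($\varepsilon=\pm$) be the clasp tangle: an unknotted arc from BL to BR (a cap) and an unknotted arc from TR to TL (a cup), whose projections overlap in exactly two crossings, both of sign $\varepsilon$. Then $TT^{\varepsilon}$ is $C^{\varepsilon}$ stacked on top of $D$. *Horizontal concatenation.* For two such tangles $f,g$, $f\boxtimes g$ is obtained by placing $g$ to the right of $f$, joining the TR endpoint of $f$ to the TL endpoint of $g$ by an arc above and the BR endpoint of $f$ to the BL endpoint of $g$ by an arc below; the remaining endpoints are BL, TL of $f$ and BR, TR of $g$. $f^{\boxtimes n}$ is the $n$-fold iterate. *Closure.* Put $f=(TT^+\boxtimes TT^-)^{\boxtimes n}$ in the rectangle $[0,2]\times[0,1]$ with endpoints BL $=(0.2,0)$, BR $=(1.8,0)$, TL $=(0.2,1)$, TR $=(1.8,1)$. Then $\mathrm{AS}(n)$ is the oriented $3$-component link consisting of $f$ together with: (i) an arc from BR straight down to $(1.8,-1)$, along the lower semicircle to $(0.2,-1)$, and straight up to BL; (ii) an arc from TL going up and to the right to $(1,2.6)$, then around the right-hand side and below everything else in the picture to $(-0.5,-2)$, then straight up to $(-0.5,-1)$, up to $(0.2,2)$, and then to the right and down into TR; this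 arc has exactly one self-crossing, located just above the rectangle, at which the portion leaving TL passes over the portion going into TR; (iii) a simple closed curve $C$, oriented counterclockwise, through $(-1.2,-1)$ and $(0.9,-1)$, encircling the points $(-0.5,-1)$ and $(0.2,-1)$; its lower half passes over the two upward strands it meets (the one at $x=-0.5$ and the one near $x=0.2$) and its upper half passes under both of them, and $C$ meets nothing else. **The link $H\#H$** is the connected sum of two positive Hopf links: a $3$-component link consisting of an unknot $C$ together with two parallel unlinked meridian circles of $C$, each with linking number $+1$ with $C$. It is the link of skies of two causally unrelated events when the Cauchy surface is $\mathbb{R}^2$. *)

(* Defs.v *)
From Stdlib Require Import Relation_Operators.
From mathcomp Require Import all_boot all_order all_algebra.
From mathcomp Require Import boolp classical_sets.
From mathcomp Require Import mxtens.
From mathcomp Require Import ring.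

Set Implicit Arguments.
Unset Strict Implicit.
Unset Printing Implicit Defensive.

Import GRing.Theory.

(******************************************************************************)
(* Oriented link diagrams.                                                    *)
(*                                                                            *)
(* A tangle diagram in Morse position is read from bottom to top as a         *)
(* sequence of elementary slices; (i, g) is the slice in which the elementary *)
(* piece g has exactly i strands on its left.  A level of a diagram is the    *)
(* sequence of the orientations of its strands, from left to right:           *)
(* true = upwards, false = downwards.                                         *)
(******************************************************************************)

(* Cup b creates two strands oriented b and ~~ b (a local minimum).           *)
(* In Cross o, the strand going from bottom left to top right is the upper    *)
(* one if o = true, and the lower one if o = false.  Hence, if both strands   *)
(* are oriented upwards (or both downwards), Cross true is positive; if they  *)
(* are oriented oppositely, Cross true is negative.                           *)
Inductive piece := Cup of bool | Cap | Cross of bool.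

Definition slice : Type := nat * piece.
Definition diagram := seq slice.

Definition arity_in (g : piece) : nat := if g is Cup _ then 0 else 2.
Definition arity_out (g : piece) : nat := if g is Cap then 0 else 2.

Definition apply_slice (st : seq bool) (x : slice) : option (seq bool) :=
  let: (i, g) := x in
  match g with
  | Cup b =>
      if i <= size st then Some (take i st ++ [:: b; ~~ b] ++ drop i st)
      else None
  | Cap =>
      if drop i st is a :: b :: r then
        if a != b then Some (take i st ++ r) else None
      else None
  | Cross _ =>
      if drop i st is a :: b :: r then Some (take i st ++ [:: b, a & r])
      else None
  end.

Fixpoint run (D : diagram) (st : seq bool) : option (seq bool) :=
  if D is x :: D' then obind (run D') (apply_slice st x) else Some st.

Definition link_diagram (D : diagram) : Prop := run D [::] = Some [::].

(* The moves generating isotopy of diagrams in Morse position (Freyd-Yetter,  *)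
(* Turaev): exchange of the heights of distant pieces, straightening of a     *)
(* zigzag, sliding a strand past a maximum or a minimum, and the three        *)
(* Reidemeister moves.  R3 with mixed crossings follows from the listed one   *)
(* by R2.                                                                     *)
Inductive move : diagram -> diagram -> Prop :=
| move_far i k g h :
    move [:: (i + arity_in g + k, h); (i, g)]
         [:: (i, g); (i + arity_out g + k, h)]
| move_zigzag_l i b : move [:: (i, Cup b); (i.+1, Cap)] [::]
| move_zigzag_r i b : move [:: (i.+1, Cup b); (i, Cap)] [::]
| move_slide_cap i o :
    move [:: (i, Cross o); (i.+1, Cap)] [:: (i.+1, Cross (~~ o)); (i, Cap)]
| move_slide_cup i b o :
    move [:: (i, Cup b); (i.+1, Cross o)] [:: (i.+1, Cup b); (i, Cross (~~ o))]
| move_R1_cap i o : move [:: (i, Cross o); (i, Cap)] [:: (i, Cap)]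
| move_R1_cup i b o : move [:: (i, Cup b); (i, Cross o)] [:: (i, Cup (~~ b))]
| move_R2 i o : move [:: (i, Cross o); (i, Cross (~~ o))] [::]
| move_R3 i o :
    move [:: (i, Cross o); (i.+1, Cross o); (i, Cross o)]
         [:: (i.+1, Cross o); (i, Cross o); (i.+1, Cross o)].

(* Moves preserve the orientations at the ends, so requiring both diagrams to *)
(* be well-formed is enough to make a move compatible with orientations.      *)
Inductive isotopy_step : diagram -> diagram -> Prop :=
| IsotopyStep (u v l r : diagram) :
    move l r -> link_diagram (u ++ l ++ v) -> link_diagram (u ++ r ++ v) ->
    isotopy_step (u ++ l ++ v) (u ++ r ++ v).

Definition isotopic : diagram -> diagram -> Prop :=
  clos_refl_sym_trans diagram isotopy_step.

(* Words in the generators of the braid group B_(m+1): (i, true) is the i-th  *)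
(* generator (positive crossing of the strands i and i+1, numbered from 0),   *)
(* (i, false) its inverse; the first letter is at the bottom.                 *)
Definition braid_word (m : nat) := seq ('I_m * bool).

Definition braid_diagram (m : nat) (b : braid_word m) : diagram :=
  [seq (val x.1, Cross x.2) | x <- b].

Definition braid_closure (m : nat) (b : braid_word m) : diagram :=
  [seq (i, Cup true) | i <- iota 0 m.+1] ++ braid_diagram b ++
  [seq (i, Cap) | i <- rev (iota 0 m.+1)].

(******************************************************************************)
(* The links AS(n) and H#H.                                                   *)
(******************************************************************************)

Definition shift (k : nat) (D : diagram) : diagram :=
  [seq (k + x.1, x.2) | x <- D].

(* The tangles below go from [:: true; false] to [:: true; false]:            *)
(* BL and TL are oriented upwards, BR and TR downwards.                       *)

(* The crossing of the strands i and i+1 of a braid after doubling.           *)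
Definition doubled_cross : diagram :=
  [:: (1, Cross true); (0, Cross true); (2, Cross true); (1, Cross true)].

(* The blackboard 2-parallel of the long trefoil, then three full twists,     *)
(* whose crossings are positive for the antiparallel orientation.             *)
Definition tangleD : diagram :=
  [:: (2, Cup true); (3, Cup false)] ++
  doubled_cross ++ doubled_cross ++ doubled_cross ++
  [:: (3, Cap); (2, Cap)] ++
  nseq 6 (0, Cross false).

(* The minimum of the arc from TR to TL lies below the maximum of the arc     *)
(* from BL to BR; eps = true for positive crossings.                          *)
Definition clasp (eps : bool) : diagram :=
  [:: (1, Cup true); (0, Cross eps); (2, Cross eps); (1, Cap)].

Definition TT (eps : bool) : diagram := tangleD ++ clasp eps.

Definition hbox (f g : diagram) : diagram :=
  [:: (1, Cup false)] ++ f ++ shift 2 g ++ [:: (1, Cap)].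

(* The unit of hbox up to isotopy. *)
Definition hbox_unit : diagram := [:: (0, Cap); (0, Cup true)].

Definition hpow (f : diagram) (n : nat) : diagram := iterop n hbox f hbox_unit.

(* The circle C around two upward strands, oriented counterclockwise: its     *)
(* lower half runs to the right over them, its upper half to the left under   *)
(* them.                                                                      *)
Definition encircle : diagram :=
  [:: (0, Cup false); (1, Cross true); (2, Cross true);
      (2, Cross true); (1, Cross true); (0, Cap)].

(* After the two cups, the strands are, from left to right: the arc (ii) at   *)
(* x = -0.5, the two ends BL and BR of the arc (i), and the arc (ii) on the   *)
(* far right.  Above f, the strand leaving TL crosses over the strand         *)
(* entering TR.                                                               *)
Definition AS (n : nat) : diagram :=
  [:: (0, Cup true); (1, Cup true)] ++
  encircle ++
  shift 1 (hpow (hbox (TT true) (TT false)) n) ++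
  [:: (1, Cross true); (0, Cap); (0, Cap)].

(* The connected sum of two copies of the closure of the square of the        *)
(* generator of B_2; C is the component of the middle strand.                 *)
Definition HH : diagram :=
  @braid_closure 2 [:: (ord0, true); (ord0, true);
                       (ord_max, true); (ord_max, true)].

Lemma run_cat D1 D2 st : run (D1 ++ D2) st = obind (run D2) (run D1 st).
Proof.
elim: D1 st => //= x D1 IH st; case: (apply_slice st x) => //= st'; exact: IH.
Qed.

Lemma apply_slice_frame u v st i g st' :
  apply_slice st (i, g) = Some st' ->
  apply_slice (u ++ st ++ v) (size u + i, g) = Some (u ++ st' ++ v).
Proof.
have E k : k <= size st -> take (size u + k) (u ++ st ++ v) = u ++ take k st.
  move=> le_k; rewrite take_cat ltnNge leq_addr /= addKn take_cat.
  by case: ltngtP le_k => // -> _; rewrite subnn take0 cats0 take_size.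
have E' k : k <= size st -> drop (size u + k) (u ++ st ++ v) = drop k st ++ v.
  move=> le_k; rewrite drop_cat ltnNge leq_addr /= addKn drop_cat.
  by case: ltngtP le_k => // -> _; rewrite subnn drop0 drop_size.
have lt_drop a (r : seq bool) : drop i st = a :: r -> i <= size st.
  by move=> e; rewrite ltnW // -subn_gt0 -size_drop e.
case: g => [b||o] /=.
- case: leqP => // le_i [<-]; rewrite E // E' // !size_cat leq_add2l.
  by rewrite (leq_trans le_i) ?leq_addr // -!catA.
- case e: (drop i st) => [//|a [//|b r]].
  rewrite E' ?(lt_drop _ _ e) // e /=; case: ifP => // _ [<-].
  by rewrite E ?(lt_drop _ _ e) // -!catA.
- case e: (drop i st) => [//|a [//|b r]].
  rewrite E' ?(lt_drop _ _ e) // e /= => -[<-].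
  by rewrite E ?(lt_drop _ _ e) // -!catA.
Qed.

Lemma run_frame u v D st st' :
  run D st = Some st' ->
  run (shift (size u) D) (u ++ st ++ v) = Some (u ++ st' ++ v).
Proof.
elim: D st => [|[i g] D IH] st; first by case=> <-.
change (obind (run D) (apply_slice st (i, g)) = Some st' ->
  obind (run (shift (size u) D)) (apply_slice (u ++ st ++ v) (size u + i, g))
  = Some (u ++ st' ++ v)).
case e: (apply_slice st (i, g)) => [st1|] // e1.
by rewrite (apply_slice_frame _ _ e); exact: IH.
Qed.

Lemma shift0 D : shift 0 D = D.
Proof. by rewrite /shift -[RHS]map_id; apply: eq_map => -[]. Qed.

Definition box_tangle (f : diagram) : Prop :=
  run f [:: true; false] = Some [:: true; false].

Lemma hbox_tangle f g : box_tangle f -> box_tangle g -> box_tangle (hbox f g).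
Proof.
move=> hf hg; rewrite /box_tangle /hbox run_cat /= run_cat.
have := run_frame [::] [:: true; false] hf; rewrite shift0 /= => -> /=.
rewrite run_cat.
by have := run_frame [:: true; false] [::] hg; rewrite /= => -> /=.
Qed.

Lemma TT_tangle eps : box_tangle (TT eps).
Proof. by []. Qed.

Lemma AS_link_diagram n : link_diagram (AS n).
Proof.
have h : box_tangle (hpow (hbox (TT true) (TT false)) n).
  case: n => // n; rewrite /hpow iteropS; elim: n => [|n IH] /=;
  by rewrite -?[iterop _ _ _ _]/(hpow _ _); do ?apply: hbox_tangle.
rewrite /link_diagram /AS !run_cat /= run_cat.
by have := run_frame [:: true] [:: false] h; rewrite /= => -> /=.
Qed.

Lemma HH_link_diagram : link_diagram HH.
Proof. by []. Qed.

(******************************************************************************)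
(* The Hopf superalgebra U_q(sl(2|1)) acting on finite-dimensional spaces of  *)
(* column vectors.                                                            *)
(******************************************************************************)

Local Open Scope ring_scope.

Inductive node := node1 | node2.

Definition cartan (i j : node) : int :=
  match i, j with
  | node1, node1 => 2
  | node2, node2 => 0
  | _, _ => -1
  end.

Definition odd_node (i : node) : bool := if i is node2 then true else false.

Section LinksGould.

Variables (F : fieldType) (q s : F).

(* The action of the generators, and the parity operator v |-> (-1)^|v| v.    *)
Record Uq_action (n : nat) := UqAction {
  actE : node -> 'M[F]_n;
  actF : node -> 'M[F]_n;
  actK : node -> 'M[F]_n;
  actKV : node -> 'M[F]_n;
  parity : 'M[F]_n
}.

Definition Serre n (X : node -> 'M[F]_n) : Prop :=
  X node1 *m X node1 *m X node2
  - (q + q^-1) *: (X node1 *m X node2 *m X node1)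
  + X node2 *m X node1 *m X node1 = 0.

Record Uq_module n (M : Uq_action n) : Prop := UqModule {
  _ : forall i, actK M i *m actKV M i = 1%:M;
  _ : forall i j, actK M i *m actK M j = actK M j *m actK M i;
  _ : forall i j, actK M i *m actE M j = q ^ cartan i j *: (actE M j *m actK M i);
  _ : forall i j,
      actK M i *m actF M j = q ^ (- cartan i j) *: (actF M j *m actK M i);
  _ : forall i j,
      actE M i *m actF M j
      - (-1) ^+ (odd_node i && odd_node j) *: (actF M j *m actE M i)
      = (odd_node i == odd_node j)%:R *: ((q - q^-1)^-1 *: (actK M i - actKV M i));
  _ : actE M node2 *m actE M node2 = 0;
  _ : actF M node2 *m actF M node2 = 0;
  _ : Serre (actE M);
  _ : Serre (actF M);
  _ : parity M *m parity M = 1%:M;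
  _ : forall i, parity M *m actE M i
                = (-1) ^+ odd_node i *: (actE M i *m parity M);
  _ : forall i, parity M *m actF M i
                = (-1) ^+ odd_node i *: (actF M i *m parity M);
  _ : forall i, parity M *m actK M i = actK M i *m parity M
}.


(* The coproduct, with (a (x) b) (v (x) w) = (-1)^(|b||v|) a v (x) b w.       *)
Definition Uq_tensor m n (M : Uq_action m) (N : Uq_action n) :
    Uq_action (m * n)%N :=
  let par i := if odd_node i then parity M else 1%:M in
  {| actE i := actE M i *t actK N i + par i *t actE N i;
     actF i := actF M i *t 1%:M + (actKV M i *m par i) *t actF N i;
     actK i := actK M i *t actK N i;
     actKV i := actKV M i *t actKV N i;
     parity := parity M *t parity N |}.

Definition Uq_endo n (M : Uq_action n) (S : 'M[F]_n) : Prop :=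
  forall i, [/\ S *m actE M i = actE M i *m S, S *m actF M i = actF M i *m S,
                S *m actK M i = actK M i *m S
              & S *m actKV M i = actKV M i *m S].

Definition highest_weight n (M : Uq_action n) (a b : F) (v : 'cV[F]_n) : Prop :=
  [/\ v != 0, forall i, actE M i *m v = 0,
      actK M node1 *m v = a *: v & actK M node2 *m v = b *: v].

(* The submodule generated by v. *)
Inductive Uq_span n (M : Uq_action n) (v : 'cV[F]_n) : 'cV[F]_n -> Prop :=
| span_gen : Uq_span M v v
| span_lin a x y : Uq_span M v x -> Uq_span M v y -> Uq_span M v (a *: x + y)
| span_E i x : Uq_span M v x -> Uq_span M v (actE M i *m x)
| span_F i x : Uq_span M v x -> Uq_span M v (actF M i *m x)
| span_K i x : Uq_span M v x -> Uq_span M v (actK M i *m x)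
| span_KV i x : Uq_span M v x -> Uq_span M v (actKV M i *m x).

Definition e_ (k l : nat) : 'M[F]_4 :=
  \matrix_(i, j) ((i == k :> nat) && (j == l :> nat))%:R.

Definition x_ (k : nat) : 'cV[F]_4 := \col_i (i == k :> nat)%:R.

(* V(0, alpha) in the basis x_0, ..., x_3; the action of the E_i follows from *)
(* the relations of U_q.                                                      *)
Definition V : Uq_action 4 :=
  {| actE i := match i with
       | node1 => e_ 1 2
       | node2 => ((s - s^-1) / (q - q^-1)) *: e_ 0 1
           + ((q * s - (q * s)^-1) / (q - q^-1)) *: e_ 2 3
       end;
     actF i := match i with
       | node1 => e_ 2 1
       | node2 => e_ 1 0 + e_ 3 2
       end;
     actK i := match i with
       | node1 => diag_mx (\row_j [:: 1; q; q^-1; 1]`_j)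
       | node2 => diag_mx (\row_j [:: s; s; q * s; q * s]`_j)
       end;
     actKV i := match i with
       | node1 => diag_mx (\row_j [:: 1; q^-1; q; 1]`_j)
       | node2 => diag_mx (\row_j [:: s^-1; s^-1; (q * s)^-1; (q * s)^-1]`_j)
       end;
     parity := diag_mx (\row_j [:: 1; -1; -1; 1]`_j) |}.

Definition VV : Uq_action (4 * 4)%N := Uq_tensor V V.

(* Each irreducible summand of V (x) V is generated by its highest weight     *)
(* vector, which is unique up to a scalar.                                    *)
Definition is_sigma (S : 'M[F]_(4 * 4)) : Prop :=
  let scalar_on a b c :=
    forall v w, highest_weight VV a b v -> Uq_span VV v w -> S *m w = c *: w in
  [/\ Uq_endo VV S,
      scalar_on 1 (s ^+ 2) (s ^+ 2),
      scalar_on q (s ^+ 2) (-1)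
    & scalar_on 1 (q * s ^+ 2) (q ^- 2 * s ^- 2)].

(* The unique S such that is_sigma S. *)
Definition sigma : 'M[F]_(4 * 4) := xget 0 is_sigma.

Definition mu (j : 'I_4) : F :=
  [:: s ^- 2; - s ^- 2; - (q ^- 2 * s ^- 2); q ^- 2 * s ^- 2]`_j.

(* Operators on the m-th tensor power of V, given by their entries in the     *)
(* basis of the x_(t_0) (x) ... (x) x_(t_(m-1)): A t u is the coefficient     *)
(* of the basis vector t in the image of the basis vector u.                  *)
Definition tens_op (m : nat) := m.-tuple 'I_4 -> m.-tuple 'I_4 -> F.

(* S acting on the factors i and i+1 (numbered from 0). *)
Definition act_at m (S : 'M[F]_(4 * 4)) (i : 'I_m) : tens_op m.+1 :=
  let i0 : 'I_m.+1 := widen_ord (leqnSn m) i in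
  let i1 : 'I_m.+1 := lift ord0 i in
  fun t u =>
    S (mxtens_index (tnth t i0, tnth t i1)) (mxtens_index (tnth u i0, tnth u i1))
    * [forall j, (j != i0) && (j != i1) ==> (tnth t j == tnth u j)]%:R.

Fixpoint psi m (b : braid_word m) : tens_op m.+1 :=
  match b with
  | [::] => fun t u => (t == u)%:R
  | x :: b' => fun t u =>
      \sum_v psi b' t v * act_at (if x.2 then sigma else invmx sigma) x.1 v u
  end.

(* The partial trace over all factors but the first one of                    *)
(* (id (x) mu (x) ... (x) mu) o psi(b).                                       *)
Definition partial_trace m (b : braid_word m) : 'M[F]_4 :=
  \matrix_(a, c) \sum_(t : m.-tuple 'I_4)
    (\prod_(j <- t) mu j) * psi b (cons_tuple a t) (cons_tuple c t).

(* By Alexander's theorem every link diagram is isotopic to the closure of a  *)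
(* braid; the scalar p does not depend on the choice of this braid.           *)
Definition LG_at (D : diagram) : F :=
  xget 0 (fun p => exists m (b : braid_word m),
    isotopic (braid_closure b) D /\ partial_trace b = p%:M).

Lemma e_mul k l k' l' :
  (l < 4)%N -> e_ k l *m e_ k' l' = (l == k')%:R *: e_ k l'.
Proof.
move=> l4; apply/matrixP => i j; rewrite !mxE (bigD1 (Ordinal l4)) //= big1.
  rewrite !mxE eqxx andbT addr0 /= -!natrM !mulnb; congr (_%:R).
  by case: (l == k'); case: (_ == k); case: (_ == l').
move=> m /negP ml; rewrite !mxE [m == l :> nat]negbTE ?andbF ?mul0r //.
by apply/negP => /eqP e; apply: ml; apply/eqP/val_inj.
Qed.

Lemma diag_e r k l : diag_mx (\row_j r`_j) *m e_ k l = r`_k *: e_ k l.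
Proof.
apply/matrixP => i j; rewrite mul_diag_mx !mxE.
by case: eqP => [->|] //=; rewrite !mulr0.
Qed.

Lemma e_diag r k l : e_ k l *m diag_mx (\row_j r`_j) = r`_l *: e_ k l.
Proof.
apply/matrixP => i j; rewrite mul_mx_diag !mxE mulrC.
by case: (_ == k); case: eqP => [->|] //=; rewrite !mulr0.
Qed.

Lemma V_Uq_module : q != 0 -> s != 0 -> q - q^-1 != 0 -> Uq_module V.
Proof.
move=> q0 s0 qq0.
have qq1 : q ^+ 2 - 1 != 0.
  apply: contraNneq qq0 => /eqP h; rewrite subr_eq0 -(inj_eq (mulfI q0)) divff //.
  by rewrite -subr_eq0.
have e2 : q ^ (2 : int) = q ^+ 2 by [].
have em1 : q ^ (-1 : int) = q^-1 by [].
have em2 : q ^ (-2 : int) = (q ^+ 2)^-1 by [].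
split => [i|i j|i j|i j|i j||||||i|i|i]; rewrite /Serre;
  try case: i; try case: j;
  rewrite /= ?oppr0 ?opprK ?e2 ?em1 ?em2 ?expr1z ?expr0z;
  do ?[rewrite mulmxDl | rewrite mulmxDr | rewrite -scalemxAl
      | rewrite -scalemxAr | rewrite e_mul // | rewrite diag_e | rewrite e_diag
      | rewrite mulmx_diag];
  apply/matrixP => a b; rewrite !mxE;
  case: a => -[|[|[|[|//]]]] ?; case: b => -[|[|[|[|//]]]] ? /=; try done; rewrite ?mulr0n ?mulr1n; try done;
  by field; rewrite ?q0 ?s0 ?qq1.
Qed.

Lemma V_basis :
  [/\ x_ 1 = actF V node2 *m x_ 0, x_ 2 = actF V node1 *m x_ 1,
      x_ 3 = actF V node2 *m x_ 2, actF V node1 *m x_ 0 = 0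
    & highest_weight V 1 s (x_ 0)] /\ parity V *m x_ 0 = x_ 0.
Proof.
have e_x k l m : (l < 4)%N -> e_ k l *m x_ m = (l == m)%:R *: x_ k.
  move=> l4; apply/matrixP => i j; rewrite !mxE (bigD1 (Ordinal l4)) //= big1.
    by rewrite !mxE eqxx andbT addr0 mulrC.
  move=> p /negP pl; rewrite !mxE [p == l :> nat]negbTE ?andbF ?mul0r //.
  by apply/negP => /eqP e; apply: pl; apply/eqP/val_inj.
have diag_x r k : diag_mx (\row_j r`_j) *m x_ k = r`_k *: x_ k.
  apply/matrixP => i j; rewrite mul_diag_mx !mxE.
  by case: eqP => [->|] //=; rewrite !mulr0.
split; last by rewrite diag_x scale1r.
split; rewrite /= ?mulmxDl ?e_x //= ?scale1r ?scale0r ?addr0 ?add0r //.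
split=> [|[]||]; rewrite /= ?mulmxDl -?scalemxAl ?e_x //= ?diag_x ?scale0r
  ?scaler0 ?addr0 //.
apply/eqP => /matrixP/(_ 0 0); rewrite !mxE /= => /eqP.
by rewrite oner_eq0.
Qed.

End LinksGould.

(******************************************************************************)
(* The field Q(q,s).                                                          *)
(******************************************************************************)

Definition Qqs : fieldType := {fraction {poly {poly rat}}}.
Definition q_ : Qqs := tofrac ('X%:P).
Definition s_ : Qqs := tofrac 'X.

Definition LG (D : diagram) : Qqs := LG_at q_ s_ D.

(* Main.v *)
(* LG is compared modulo 11 at q = 4, s = 5.  Every coefficient of sigma, its  *)
(* inverse and mu is a Laurent polynomial in q and s over Z, so any value of LG *)
(* has a well-defined reduction in F_11, once sigma is known to be unique.      *)
(*                                                                              *)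
(* Over F_11, the action of oriented Morse diagrams on tensor powers of V and   *)
(* its dual, with suitable weights on cups and caps, is invariant under the     *)
(* moves.  On a nonempty closed diagram it vanishes, so the strand at the left  *)
(* of some level is first cut open; the value obtained is an isotopy invariant  *)
(* provided that it does not depend on the strand.  For two adjacent strands,   *)
(* the difference of the two cutting operators is a sum of commutators with     *)
(* elements of U_q, up to grouplike factors, whose action commutes with all     *)
(* tangles and kills closed diagrams.  For a braid closure the cut value is the *)
(* reduction of the (0, 0) entry of the partial trace, so that all the braids   *)
(* representing a link give the same reduction.                                 *)
(*                                                                              *)
(* The operation hbox multiplies 16 x 16 transfer matrices.  Modulo 11, the     *)
(* matrix P of TT+ [x] TT- satisfies P^3 = P^2, hence AS(n) has the same        *)
(* reduction 8 for all n >= 2; AS(1) has reduction 4.  The partial trace of the *)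
(* braid defining H#H is the scalar h^2, where h = s^2 + q^-2 s^-2 - 1 - q^-2   *)
(* is the value of the Hopf link, and its reduction is 5.  The default value 0  *)
(* which LG would take in the absence of a braid representing AS(n) is not h^2  *)
(* either, so Alexander's theorem is not used.                                  *)

From HB Require Import structures.
Require Import Defs.
From Stdlib Require Import Relation_Operators.
From mathcomp Require Import all_boot all_order all_algebra.
From mathcomp Require Import boolp classical_sets.
From mathcomp Require Import mxtens.
From mathcomp Require Import ring zify.

Set Implicit Arguments.
Unset Strict Implicit.
Unset Printing Implicit Defensive.

Import GRing.Theory.

(** * The field with eleven elements and the specialized tables *)

(** The two invariants are separated by their reductions in the field with eleven elements.
    [spec x y] says that [x] is an integral Laurent polynomial in [q] and [s] with value [y] at
    [q = 4], [s = 5]; by [spec_inj] an element of [Qqs] has at most one such value, so different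
    values force different elements.

    The reduced invariant [LG11] is defined directly on Morse diagrams. [Zrun] lets a diagram act on
    tensor powers of V and its dual, and [move_Zrun] shows that the moves preserve this action, by
    finite checks except for the exchange of distant pieces. Since a nonempty closed diagram acts by
    0 ([Zrun_closed]), the diagram is cut open at one strand of one level. Generators of U_q commute
    with all tangles ([act_Xop]), and the cuts at two adjacent strands differ by commutators with
    such generators, which contribute nothing to a closed diagram ([cut_adjacent]). Hence neither
    the strand nor the level matters ([cut_eq]), and [LG11_isotopic] follows.

    The bridge to the definition of [LG] is [spec_LG]: whichever braid represents a link, its scalar
    reduces to [LG11]. This rests on [sigmaE], which identifies the abstractly characterised [sigma]
    with an explicit Laurent matrix, and on [LG11_closure], where the cut closure of a braid becomes
    an entry of the partial trace.

    It remains to compute. Horizontal concatenation multiplies transfer matrices ([hbox_mx]), and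
    the powers of the matrix of one box are constant from the second on ([hpow_mx]); this gives the
    values 4 for [n = 1] and 8 for [n >= 2]. For the connected sum, [partial_trace_HH] gives the
    square of the Hopf value, which reduces to 5. *)

Inductive F11 := R0 | R1 | R2 | R3 | R4 | R5 | R6 | R7 | R8 | R9 | R10.

Definition F11_all := [:: R0; R1; R2; R3; R4; R5; R6; R7; R8; R9; R10].

Definition F11_nat (x : F11) : nat :=
  match x with
  | R0 => 0 | R1 => 1 | R2 => 2 | R3 => 3 | R4 => 4 | R5 => 5 | R6 => 6
  | R7 => 7 | R8 => 8 | R9 => 9 | R10 => 10
  end.

Lemma F11_natK : cancel F11_nat (nth R0 F11_all).
Proof. by case. Qed.

Definition F11_add x y := nth R0 (F11_all ++ F11_all) (F11_nat x + F11_nat y).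
Definition F11_opp x := nth R0 (R0 :: rev F11_all) (F11_nat x).

(** A stored table keeps products cheap under [vm_compute], and an enumerated type lets the ring
    axioms be proved by exhausting the cases. *)
Definition F11_mul_table : seq (seq F11) := Eval vm_compute in
  [seq [seq iter (F11_nat x) (F11_add y) R0 | y <- F11_all] | x <- F11_all].

Definition F11_mul x y := nth R0 (nth [::] F11_mul_table (F11_nat x)) (F11_nat y).

HB.instance Definition _ := Equality.copy F11 (can_type F11_natK).
HB.instance Definition _ := Choice.copy F11 (can_type F11_natK).

Lemma F11_addA : associative F11_add. Proof. by do 3!case. Qed.
Lemma F11_addC : commutative F11_add. Proof. by do 2!case. Qed.
Lemma F11_add0 : left_id R0 F11_add. Proof. by case. Qed.
Lemma F11_addN : left_inverse R0 F11_opp F11_add. Proof. by case. Qed.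

HB.instance Definition _ :=
  GRing.isZmodule.Build F11 F11_addA F11_addC F11_add0 F11_addN.

Lemma F11_mulA : associative F11_mul. Proof. by do 3!case. Qed.
Lemma F11_mulC : commutative F11_mul. Proof. by do 2!case. Qed.
Lemma F11_mul1 : left_id R1 F11_mul. Proof. by case. Qed.
Lemma F11_mulDl : left_distributive F11_mul F11_add.
Proof. by do 3!case. Qed.

HB.instance Definition _ := GRing.Zmodule_isComNzRing.Build F11
  F11_mulA F11_mulC F11_mul1 F11_mulDl isT.

Local Open Scope ring_scope.

(** * Laurent tables of sigma and mu, and their values at q = 4, s = 5 *)

Inductive idx := X0 | X1 | X2 | X3.

Definition idx_all := [:: X0; X1; X2; X3].

Definition idx_nat (x : idx) : nat :=
  match x with X0 => 0 | X1 => 1 | X2 => 2 | X3 => 3 end.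

Lemma idx_natK : cancel idx_nat (nth X0 idx_all). Proof. by case. Qed.

HB.instance Definition _ := Equality.copy idx (can_type idx_natK).

Lemma mem_idx_all x : x \in idx_all. Proof. by case: x. Qed.

(* Coefficients in Z[q,1/q,s,1/s], as lists of signed monomials; the pairs    *)
(* (q, q') and (s, s') are meant to be mutually inverse.                      *)
Definition zpow (R : comNzRingType) (x x' : R) (a : int) : R :=
  match a with Posz n => x ^+ n | Negz n => x' ^+ n.+1 end.

Definition laurent (R : comNzRingType) (q q' s s' : R)
    (l : seq (bool * int * int)) : R :=
  foldr (fun m r => (-1) ^+ (m.1.1 : bool) * zpow q q' m.1.2 * zpow s s' m.2 + r) 0 l.

Definition mu_code (x : idx) : seq (bool * int * int) :=
  match x with
  | X0 => [:: (false, 0, -2)]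
  | X1 => [:: (true, 0, -2)]
  | X2 => [:: (true, -2, -2)]
  | X3 => [:: (false, -2, -2)]
  end.

Definition entries (C : Type) : Type := seq ((idx * idx) * (idx * idx) * C).

(* The entries ((row, column), coefficient) of sigma and of its inverse. *)
Definition sigma_code (o : bool) : entries (seq (bool * int * int)) :=
  if o then
  [:: ((X0, X0), (X0, X0), [:: (false, 0, 2)]);
      ((X0, X1), (X1, X0), [:: (false, 0, 1)]);
      ((X0, X2), (X2, X0), [:: (false, 0, 1)]);
      ((X0, X3), (X3, X0), [:: (false, 0, 0)]);
      ((X1, X0), (X0, X1), [:: (false, 0, 1)]);
      ((X1, X0), (X1, X0), [:: (true, 0, 0); (false, 0, 2)]);
      ((X1, X1), (X1, X1), [:: (true, 0, 0)]);
      ((X1, X2), (X2, X1), [:: (true, -1, 0)]);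
      ((X1, X2), (X3, X0), [:: (true, -2, -1); (false, 0, 1)]);
      ((X1, X3), (X3, X1), [:: (false, -1, -1)]);
      ((X2, X0), (X0, X2), [:: (false, 0, 1)]);
      ((X2, X0), (X2, X0), [:: (true, 0, 0); (false, 0, 2)]);
      ((X2, X1), (X1, X2), [:: (true, -1, 0)]);
      ((X2, X1), (X2, X1), [:: (false, -2, 0); (true, 0, 0)]);
      ((X2, X1), (X3, X0), [:: (false, -3, -1); (true, -1, 1)]);
      ((X2, X2), (X2, X2), [:: (true, 0, 0)]);
      ((X2, X3), (X3, X2), [:: (false, -1, -1)]);
      ((X3, X0), (X0, X3), [:: (false, 0, 0)]);
      ((X3, X0), (X1, X2), [:: (true, 0, -1); (false, 0, 1)]);
      ((X3, X0), (X2, X1), [:: (false, -1, -1); (true, -1, 1)]);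
      ((X3, X0), (X3, X0),
         [:: (false, -2, -2); (true, -2, 0); (true, 0, 0); (false, 0, 2)]);
      ((X3, X1), (X1, X3), [:: (false, -1, -1)]);
      ((X3, X1), (X3, X1), [:: (false, -2, -2); (true, 0, 0)]);
      ((X3, X2), (X2, X3), [:: (false, -1, -1)]);
      ((X3, X2), (X3, X2), [:: (false, -2, -2); (true, 0, 0)]);
      ((X3, X3), (X3, X3), [:: (false, -2, -2)])]
  else
  [:: ((X0, X0), (X0, X0), [:: (false, 0, -2)]);
      ((X0, X1), (X0, X1), [:: (false, 0, -2); (true, 0, 0)]);
      ((X0, X1), (X1, X0), [:: (false, 0, -1)]);
      ((X0, X2), (X0, X2), [:: (false, 0, -2); (true, 0, 0)]);
      ((X0, X2), (X2, X0), [:: (false, 0, -1)]);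
      ((X0, X3), (X0, X3),
         [:: (false, 0, -2); (true, 0, 0); (true, 2, 0); (false, 2, 2)]);
      ((X0, X3), (X1, X2), [:: (false, 2, -1); (true, 2, 1)]);
      ((X0, X3), (X2, X1), [:: (true, 1, -1); (false, 1, 1)]);
      ((X0, X3), (X3, X0), [:: (false, 0, 0)]);
      ((X1, X0), (X0, X1), [:: (false, 0, -1)]);
      ((X1, X1), (X1, X1), [:: (true, 0, 0)]);
      ((X1, X2), (X0, X3), [:: (false, 0, -1); (true, 2, 1)]);
      ((X1, X2), (X1, X2), [:: (true, 0, 0); (false, 2, 0)]);
      ((X1, X2), (X2, X1), [:: (true, 1, 0)]);
      ((X1, X3), (X1, X3), [:: (true, 0, 0); (false, 2, 2)]);
      ((X1, X3), (X3, X1), [:: (false, 1, 1)]);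
      ((X2, X0), (X0, X2), [:: (false, 0, -1)]);
      ((X2, X1), (X0, X3), [:: (true, -1, -1); (false, 1, 1)]);
      ((X2, X1), (X1, X2), [:: (true, 1, 0)]);
      ((X2, X2), (X2, X2), [:: (true, 0, 0)]);
      ((X2, X3), (X2, X3), [:: (true, 0, 0); (false, 2, 2)]);
      ((X2, X3), (X3, X2), [:: (false, 1, 1)]);
      ((X3, X0), (X0, X3), [:: (false, 0, 0)]);
      ((X3, X1), (X1, X3), [:: (false, 1, 1)]);
      ((X3, X2), (X2, X3), [:: (false, 1, 1)]);
      ((X3, X3), (X3, X3), [:: (false, 2, 2)])].

(* The specialization q = 4, s = 5; in F_11, 1/q = 3 and 1/s = 9. *)
Definition spec11 : seq (bool * int * int) -> F11 := laurent R4 R3 R5 R9.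

Definition mu11 (x : idx) : F11 := Eval vm_compute in
  match x with
  | X0 => spec11 (mu_code X0) | X1 => spec11 (mu_code X1)
  | X2 => spec11 (mu_code X2) | X3 => spec11 (mu_code X3)
  end.

Definition muV11 (x : idx) : F11 := Eval vm_compute in
  match x with
  | X0 => nth R0 F11_all (find (fun y => F11_mul y (mu11 X0) == R1) F11_all)
  | X1 => nth R0 F11_all (find (fun y => F11_mul y (mu11 X1) == R1) F11_all)
  | X2 => nth R0 F11_all (find (fun y => F11_mul y (mu11 X2) == R1) F11_all)
  | X3 => nth R0 F11_all (find (fun y => F11_mul y (mu11 X3) == R1) F11_all)
  end.

Lemma mu11K x : muV11 x * mu11 x = 1. Proof. by case: x. Qed.

(* The coefficients of the cup creating strands b, ~~ b, and of the cap       *)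
(* closing strands b, ~~ b.                                                   *)
Definition cupw (b : bool) (x : idx) : F11 := if b then 1 else muV11 x.
Definition capw (b : bool) (x : idx) : F11 := if b then mu11 x else 1.

(* A crossing of strands (a, b) determines, by sliding it past a cap, the     *)
(* opposite crossing of strands (b, ~~ a).                                    *)
Definition rotate (a : bool) (E : entries F11) : entries F11 :=
  [seq let: (w, z, (x, y), c) := e in
       ((x, w), (y, z), c * capw a z * cupw (~~ a) x) | e <- E].

Definition cross_pos (o : bool) : entries F11 :=
  Eval vm_compute in
  if o then [seq (e.1, spec11 e.2) | e <- sigma_code true]
       else [seq (e.1, spec11 e.2) | e <- sigma_code false].

Definition cross_ent (a b o : bool) : entries F11 := Eval vm_compute in
  match a, b, o with
  | true, true, true => cross_pos true
  | true, true, false => cross_pos false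
  | true, false, true => rotate true (cross_pos false)
  | true, false, false => rotate true (cross_pos true)
  | false, true, true =>
      rotate false (rotate true (rotate true (cross_pos false)))
  | false, true, false =>
      rotate false (rotate true (rotate true (cross_pos true)))
  | false, false, true => rotate true (rotate true (cross_pos true))
  | false, false, false => rotate true (rotate true (cross_pos false))
  end.

(** * The action of tangles over F_11 *)

Definition vec : Type := seq idx -> F11.

(* A formal linear combination of evaluations of a vector. *)
Definition lform : Type := seq (seq idx * F11).

Definition evalf (l : lform) (u : vec) : F11 := \sum_(e <- l) e.2 * u e.1.

(** Row [t] of the matrix of the piece [g]: the input words contributing to the output word [t].
    Rows are the convenient side, since evaluations at a word are pulled back along a diagram. *)
Definition src (g : piece) (st : seq bool) (t : seq idx) : lform :=
  match g with
  | Cup b => if t is [:: x; y] then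
               if x == y then [:: ([::], cupw b x)] else [::]
             else [::]
  | Cap => if t is [::] then
             [seq ([:: x; x], capw (head true st) x) | x <- idx_all]
           else [::]
  | Cross o => if t is [:: x; y] then
                 [seq ([:: e.1.2.1; e.1.2.2], e.2)
                    | e <- cross_ent (nth true st 0) (nth true st 1) o
                    & e.1.1 == (x, y)]
               else [::]
  end.

Definition act (x : slice) (st : seq bool) (u : vec) : vec := fun t =>
  evalf (src x.2 (drop x.1 st) (take (arity_out x.2) (drop x.1 t)))
    (fun s => u (take x.1 t ++ s ++ drop (x.1 + arity_out x.2) t)).

Fixpoint Zrun (D : diagram) (st : seq bool) (u : vec) : vec :=
  if D is x :: D' then Zrun D' (odflt [::] (apply_slice st x)) (act x st u)
  else u.

Definition vec0 : vec := fun t => (t == [::])%:R.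

Lemma evalf_cons e l u : evalf (e :: l) u = e.2 * u e.1 + evalf l u.
Proof. by rewrite /evalf big_cons. Qed.

Lemma evalf_nil u : evalf [::] u = 0.
Proof. by rewrite /evalf big_nil. Qed.

Lemma evalf_cat l1 l2 u : evalf (l1 ++ l2) u = evalf l1 u + evalf l2 u.
Proof. by rewrite /evalf big_cat. Qed.

Lemma eq_evalf l u u' :
  (forall s c, (s, c) \in l -> u s = u' s) -> evalf l u = evalf l u'.
Proof.
move=> h; rewrite /evalf; apply: eq_big_seq => -[s c] /h /= -> //.
Qed.

Lemma evalf_lin l (r : lform) (f : seq idx -> vec) :
  evalf l (fun s => evalf r (fun s' => f s' s)) =
  evalf r (fun s' => evalf l (f s')).
Proof.
rewrite /evalf; under eq_bigr do rewrite mulr_sumr.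
rewrite exchange_big /=; apply: eq_bigr => e _; rewrite mulr_sumr.
by apply: eq_bigr => e' _; rewrite mulrCA.
Qed.

Lemma evalf_mul l c (u : vec) : evalf l (fun s => c * u s) = c * evalf l u.
Proof. by rewrite /evalf mulr_sumr; apply: eq_bigr => e _; rewrite mulrCA. Qed.

Lemma src_frame g sm sc t :
  (arity_in g <= size sm)%N -> src g (sm ++ sc) t = src g sm t.
Proof. by case: g sm => [b||o] [|a [|b' sm]]. Qed.

Lemma src_size g st t s c : (s, c) \in src g st t -> size s = arity_in g.
Proof.
case: g t => [b||o] [|x [|y [|z t]]] //=.
- by case: eqP => // _; rewrite inE => /eqP[-> _].
- by rewrite !inE => /or4P[] /eqP[-> _].
- by move=> /mapP[e _ [-> _]].
Qed.

Lemma act_split g sa sm sc u ta tm tc :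
  size ta = size sa -> size sm = arity_in g -> size tm = arity_out g ->
  act (size sa, g) (sa ++ sm ++ sc) u (ta ++ tm ++ tc) =
  evalf (src g sm tm) (fun s => u (ta ++ s ++ tc)).
Proof.
move=> eta em etm; rewrite /act /=.
have -> : drop (size sa) (sa ++ sm ++ sc) = sm ++ sc by rewrite drop_size_cat.
have -> : drop (size sa) (ta ++ tm ++ tc) = tm ++ tc by rewrite drop_size_cat.
have -> : take (size sa) (ta ++ tm ++ tc) = ta by rewrite take_size_cat.
have -> : drop (size sa + arity_out g) (ta ++ tm ++ tc) = tc.
  by rewrite catA drop_size_cat // size_cat eta etm.
by rewrite -etm take_size_cat // src_frame ?em.
Qed.

Lemma split2 (T : Type) (t : seq T) a c : size t = (a + c)%N ->
  exists ta tc, [/\ t = ta ++ tc, size ta = a & size tc = c].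
Proof.
move=> e; exists (take a t), (drop a t); rewrite cat_take_drop size_drop e.
by rewrite size_takel ?e ?leq_addr // addKn.
Qed.

Lemma split3 (T : Type) (t : seq T) a b c : size t = (a + (b + c))%N ->
  exists ta tb tc,
    [/\ t = ta ++ tb ++ tc, size ta = a, size tb = b & size tc = c].
Proof.
move=> /split2[ta [t' [-> ea /split2[tb [tc [-> eb ec]]]]]].
by exists ta, tb, tc.
Qed.

Lemma slice_size st i g st' : apply_slice st (i, g) = Some st' ->
  (i + arity_in g <= size st)%N.
Proof.
case: g => [b||o] /=; first by case: leqP => // le _; rewrite addn0.
- case e: (drop i st) => [//|a [//|b r]] _.
  by have := size_drop i st; rewrite e /=; lia.
- case e: (drop i st) => [//|a [//|b r]] _.
  by have := size_drop i st; rewrite e /=; lia.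
Qed.

Lemma slice_frame sa sm sc j g : (j + arity_in g <= size sm)%N ->
  apply_slice (sa ++ sm ++ sc) (size sa + j, g)%N =
  omap (fun s => sa ++ s ++ sc) (apply_slice sm (j, g)).
Proof.
case e: (apply_slice sm (j, g)) => [s|] le.
  by rewrite (apply_slice_frame sa sc e).
have E : drop (size sa + j) (sa ++ sm ++ sc) = drop j sm ++ sc.
  rewrite addnC -drop_drop drop_size_cat // drop_cat.
  by case: ltngtP => // [|->]; [lia | rewrite subnn drop0 drop_size].
have sz := size_drop j sm.
case: g e le => [b||o] /=; first by rewrite addn0 => + le; rewrite le.
- rewrite E; case: (drop j sm) sz => [|a [|b r]] //= sz; try lia.
  by case: (a != b).
- by rewrite E; case: (drop j sm) sz => [|a [|b r]] //= sz; lia.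
Qed.

Lemma slice_decomp st i g st' : apply_slice st (i, g) = Some st' ->
  exists sa sm sm' sc,
    [/\ size sa = i, size sm = arity_in g, size sm' = arity_out g &
    [/\ st = sa ++ sm ++ sc, st' = sa ++ sm' ++ sc
      & apply_slice sm (0%N, g) = Some sm']].
Proof.
move=> e; have le := slice_size e.
have [|sa [sm [sc [est ea em _]]]] :=
  @split3 _ st i (arity_in g) (size st - (i + arity_in g)); first by lia.
move: e; rewrite est -ea -[size sa]addn0 slice_frame ?em //.
case e: (apply_slice sm _) => [sm'|//] [<-].
exists sa, sm, sm', sc; split=> //; first by rewrite addn0.
case: g em e {le} => [b||o] /=; case: sm {est} => [|a [|b' [|]]] //= _.
- by case=> <-.
- by case: ifP => // _ [<-].
- by case=> <-.
Qed.

(** A [vec] is defined on words of every length, but at a given level only the words with one letter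
    per strand have a meaning. *)
Definition veq (n : nat) (u u' : vec) := forall t, size t = n -> u t = u' t.

Lemma act_ext st x st' u u' : apply_slice st x = Some st' ->
  veq (size st) u u' -> veq (size st') (act x st u) (act x st u').
Proof.
case: x => i g e eu t.
have [sa [sm [sm' [sc [ea em em' [est est' _]]]]]] := slice_decomp e.
rewrite est' !size_cat => /split3[ta [tm [tc [-> eta etm etc]]]].
rewrite est -ea !act_split ?etm //; apply: eq_evalf => s c /src_size es.
by apply: eu; rewrite est !size_cat eta etc es em.
Qed.

Lemma Zrun_ext D st st' u u' : run D st = Some st' ->
  veq (size st) u u' -> veq (size st') (Zrun D st u) (Zrun D st u').
Proof.
elim: D st u u' => [|x D IH] st u u' /=; first by case=> <-.
by case e: (apply_slice st x) => [st1|] //= e' /(act_ext e) /(IH _ _ _ e').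
Qed.

Lemma act_lin x st (r : lform) (f : seq idx -> vec) t :
  act x st (fun s => evalf r (fun s' => f s' s)) t =
  evalf r (fun s' => act x st (f s') t).
Proof. by rewrite /act -evalf_lin. Qed.

Lemma Zrun_lin D st (r : lform) (f : seq idx -> vec) st' :
  run D st = Some st' ->
  veq (size st') (Zrun D st (fun s => evalf r (fun s' => f s' s)))
    (fun t => evalf r (fun s' => Zrun D st (f s') t)).
Proof.
elim: D st f => [|x D IH] st f /=; first by [].
case e: (apply_slice st x) => [st1|] //= e' t et.
rewrite -(IH st1 (fun s' => act x st (f s')) e' t et).
by apply: (Zrun_ext e') et => t' _; exact: act_lin.
Qed.

Lemma Zrun_mul D st c u st' : run D st = Some st' ->
  veq (size st') (Zrun D st (fun s => c * u s)) (fun t => c * Zrun D st u t).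
Proof.
move=> e t et; pose r : lform := [:: ([::], c)].
have := @Zrun_lin D st r (fun _ => u) st' e t et.
rewrite /r evalf_cons evalf_nil addr0 /= => <-.
by congr (Zrun D st _ t); apply: funext => s; rewrite evalf_cons evalf_nil addr0.
Qed.

Lemma Zrun_sub D st u1 u2 st' : run D st = Some st' ->
  veq (size st') (Zrun D st (fun s => u1 s - u2 s))
    (fun t => Zrun D st u1 t - Zrun D st u2 t).
Proof.
(* The two words serve only as labels telling [u1] from [u2]. *)
move=> e t et; pose r : lform := [:: ([:: X0], 1); ([::], -1)].
have := @Zrun_lin D st r (fun s' => if s' is [::] then u2 else u1) st' e t et.
rewrite /r !evalf_cons evalf_nil addr0 /= mul1r mulN1r => <-.
congr (Zrun D st _ t); apply: funext => s.
by rewrite !evalf_cons evalf_nil addr0 mul1r mulN1r.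
Qed.

Lemma Zrun_cat D1 D2 st st' u : run D1 st = Some st' ->
  Zrun (D1 ++ D2) st u = Zrun D2 st' (Zrun D1 st u).
Proof.
elim: D1 st u => [|x D1 IH] st u /=; first by case=> ->.
by case e: (apply_slice st x) => [st1|] //= e'; rewrite (IH _ _ e').
Qed.

(** The transpose of [Zrun]: a formal combination that can be computed while the vector is still
    unknown, so that equalities of operators become decidable. *)
Fixpoint pull (D : diagram) (st : seq bool) (t : seq idx) : lform :=
  if D is x :: D' then
    flatten [seq [seq (take x.1 e.1 ++ e'.1 ++ drop (x.1 + arity_out x.2) e.1,
                       e.2 * e'.2)
                 | e' <- src x.2 (drop x.1 st)
                           (take (arity_out x.2) (drop x.1 e.1))]
            | e <- pull D' (odflt [::] (apply_slice st x)) t]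
  else [:: (t, 1)].

Lemma evalf_flatten (T : Type) (F : T -> lform) r u :
  evalf (flatten [seq F e | e <- r]) u = \sum_(e <- r) evalf (F e) u.
Proof.
elim: r => [|e r IH] /=; first by rewrite evalf_nil big_nil.
by rewrite evalf_cat IH big_cons.
Qed.

Lemma evalf_scale (T : seq idx -> seq idx) c l u :
  evalf [seq (T e.1, c * e.2) | e <- l] u = c * evalf l (fun s => u (T s)).
Proof.
rewrite /evalf big_map mulr_sumr; apply: eq_bigr => e _; exact/esym/mulrA.
Qed.

Lemma pullE D st t u : Zrun D st u t = evalf (pull D st t) u.
Proof.
elim: D st u => [|x D IH] st u /=.
  by rewrite evalf_cons evalf_nil addr0 mul1r.
rewrite IH evalf_flatten; apply: eq_bigr => e _.
by rewrite (@evalf_scale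
  (fun s => take x.1 e.1 ++ s ++ drop (x.1 + arity_out x.2) e.1)).
Qed.

(** The strands on both sides of [D] are spectators: their letters are parameters of the vector on
    which [D] acts. *)
Lemma Zrun_frame sa st sc D st' u ta t tc : run D st = Some st' ->
  size ta = size sa -> size t = size st' ->
  Zrun (shift (size sa) D) (sa ++ st ++ sc) u (ta ++ t ++ tc) =
  Zrun D st (fun s => u (ta ++ s ++ tc)) t.
Proof.
move=> + eta; elim: D st u t => [|[i g] D IH] st u t //.
case e: (apply_slice st (i, g)) => [st1|]; last first.
  by rewrite /= -/(apply_slice st (i, g)) e.
move=> /= ; rewrite -/(apply_slice st (i, g)) e /= => e' et.
have e1 := apply_slice_frame sa sc e.
rewrite -/(apply_slice (sa ++ st ++ sc) (size sa + i, g)%N) e1 /=.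
rewrite IH //; apply: (Zrun_ext e') et => t'.
have [sb [sm [sm' [sd [eb em em' [est est' _]]]]]] := slice_decomp e.
rewrite est' !size_cat => /split3[tb [tm [td [-> etb etm etd]]]].
rewrite est -eb [in RHS]act_split // ?etm //.
have -> : sa ++ (sb ++ sm ++ sd) ++ sc = (sa ++ sb) ++ sm ++ (sd ++ sc).
  by rewrite !catA.
have -> : ta ++ (tb ++ tm ++ td) ++ tc = (ta ++ tb) ++ tm ++ (td ++ tc).
  by rewrite !catA.
rewrite -size_cat act_split ?size_cat ?eta ?etb ?etm //.
by apply: eq_evalf => s c _; rewrite -!catA.
Qed.

Arguments apply_slice st x : simpl never.

(** * Invariance under the moves *)

Definition coef (l : lform) (t : seq idx) : F11 :=
  foldr (fun e r => if e.1 == t then e.2 + r else r) 0 l.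

Definition lform_eq (l1 l2 : lform) : bool :=
  all (fun t => coef l1 t == coef l2 t) (undup (unzip1 (l1 ++ l2))).

Lemma evalf_coef l ks u : uniq ks -> {subset unzip1 l <= ks} ->
  evalf l u = \sum_(t <- ks) coef l t * u t.
Proof.
move=> uks; elim: l => [|e l IH] /= sub.
  by rewrite evalf_nil big1 // => t _; rewrite mul0r.
rewrite evalf_cons IH; last by move=> t tl; apply: sub; rewrite inE tl orbT.
have e1 : e.1 \in ks by apply: sub; rewrite inE eqxx.
rewrite !(bigD1_seq e.1) //= eqxx mulrDl addrA; congr (_ + _).
by apply: eq_bigr => t /negbTE; rewrite eq_sym => ->.
Qed.

Lemma lform_eqP l1 l2 u : lform_eq l1 l2 -> evalf l1 u = evalf l2 u.
Proof.
move=> /allP h; rewrite !(@evalf_coef _ (undup (unzip1 (l1 ++ l2)))) ?undup_uniq //.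
- by apply: eq_big_seq => t /h /eqP ->.
- by move=> t; rewrite mem_undup /unzip1 map_cat mem_cat => ->; rewrite orbT.
- by move=> t; rewrite mem_undup /unzip1 map_cat mem_cat => ->.
Qed.

Fixpoint words (T : Type) (l : seq T) n : seq (seq T) :=
  if n is m.+1 then flatten [seq [seq x :: t | t <- words l m] | x <- l]
  else [:: [::]].

Lemma mem_words (T : eqType) (l : seq T) t :
  {subset t <= l} -> t \in words l (size t).
Proof.
elim: t => // x t IH sub /=; apply/flatten_mapP; exists x.
  by apply: sub; rewrite inE eqxx.
by rewrite map_f // IH // => y yt; apply: sub; rewrite inE yt orbT.
Qed.

Lemma mem_iwords t n : size t = n -> t \in words idx_all n.
Proof. by move=> <-; apply: mem_words => x _; exact: mem_idx_all. Qed.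

Lemma mem_bwords t n : size t = n -> t \in words [:: true; false] n.
Proof. by move=> <-; apply: mem_words => -[]; rewrite !inE. Qed.

Fixpoint fits (D : diagram) (n : nat) : bool :=
  if D is (i, g) :: D' then
    (i + arity_in g <= n)%N && fits D' (n - arity_in g + arity_out g)
  else true.

Lemma slice_size_out st i g st' : apply_slice st (i, g) = Some st' ->
  size st' = (size st - arity_in g + arity_out g)%N.
Proof.
move=> /slice_decomp[sa [sm [sm' [sc [_ em em' [-> -> _]]]]]].
by rewrite !size_cat em em'; lia.
Qed.

Lemma run_fits D st st' : run D st = Some st' -> fits D (size st).
Proof.
elim: D st => //= -[i g] D IH st.
case e: (apply_slice st (i, g)) => [st1|] //= /IH.
by rewrite (slice_size_out e) (slice_size e).
Qed.

Lemma run_shift sa sm sc D : fits D (size sm) ->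
  run (shift (size sa) D) (sa ++ sm ++ sc) =
  omap (fun s => sa ++ s ++ sc) (run D sm).
Proof.
elim: D sm => //= -[i g] D IH sm /andP[le f].
rewrite slice_frame // /=.
by case e: (apply_slice sm (i, g)) => [s|] //=; rewrite IH // (slice_size_out e).
Qed.

Definition check_move (l r : diagram) (sm : seq bool) : bool :=
  match run l sm, run r sm with
  | Some o, Some o' => (o == o') &&
      all (fun t => lform_eq (pull l sm t) (pull r sm t))
        (words idx_all (size o))
  | _, _ => true
  end.

(** Reduces a move at any position to a finite check on [n] strands: all orientations for which both
    sides are defined, and all output words. *)
Lemma local_move n l r l' r' i st st1 st1' u :
  l' = shift i l -> r' = shift i r -> fits l n -> fits r n ->
  all (check_move l r) (words [:: true; false] n) ->
  (i + n <= size st)%N ->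
  run l' st = Some st1 -> run r' st = Some st1' ->
  st1 = st1' /\ veq (size st1) (Zrun l' st u) (Zrun r' st u).
Proof.
move=> -> -> fl fr /allP chk le.
have [|sa [sm [sc [-> ea em _]]]] := @split3 _ st i n (size st - (i + n)).
  by lia.
have := chk _ (mem_bwords em); rewrite /check_move -ea !run_shift ?em //.
case el: (run l sm) => [o|] //; case er: (run r sm) => [o'|] //=.
move=> /andP[/eqP eo /allP c] [<-] [<-]; subst o'; split=> // t.
rewrite !size_cat => /split3[ta [tm [tc [-> eta etm etc]]]].
rewrite (Zrun_frame _ _ _ el) // (Zrun_frame _ _ _ er) // !pullE.
exact/lform_eqP/c/mem_iwords.
Qed.

Lemma slice_frame0 sa sm sc g : size sm = arity_in g ->
  apply_slice (sa ++ sm ++ sc) (size sa, g) =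
  omap (fun s => sa ++ s ++ sc) (apply_slice sm (0%N, g)).
Proof. by move=> e; rewrite -{1}[size sa]addn0 slice_frame // e. Qed.

Lemma slice_out_size sm g sm' : size sm = arity_in g ->
  apply_slice sm (0%N, g) = Some sm' -> size sm' = arity_out g.
Proof. by move=> e /slice_size_out ->; rewrite e subnn. Qed.

(** The gap [k] is unbounded, so this move escapes the finite checks. The two pieces act on disjoint
    letters, and the claim is the exchange of two finite sums. *)
Lemma far_Zrun i k g h st st1 st1' u :
  let l := [:: (i + arity_in g + k, h); (i, g)]%N in
  let r := [:: (i, g); (i + arity_out g + k, h)]%N in
  run l st = Some st1 -> run r st = Some st1' ->
  st1 = st1' /\ veq (size st1) (Zrun l st u) (Zrun r st u).
Proof.
move=> /=; case e1: (apply_slice st (_, h)) => [s1|] //=.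
have [sa [sm [sm' [sc [ea em em' [est es1 em0]]]]]] := slice_decomp e1.
have [|sb [sg [sk [esa eb eg ek]]]] := @split3 _ sa i (arity_in g) k.
  by rewrite ea addnA.
have ->: s1 = sb ++ sg ++ (sk ++ sm' ++ sc) by rewrite es1 esa !catA.
have ->: st = sb ++ sg ++ (sk ++ sm ++ sc) by rewrite est esa !catA.
rewrite -eb !slice_frame0 //; case eg0: (apply_slice sg _) => [sg'|] //= [<-].
have eg' := slice_out_size eg eg0.
have E w : sb ++ sg' ++ sk ++ w ++ sc = (sb ++ sg' ++ sk) ++ w ++ sc.
  by rewrite !catA.
have E' w : sb ++ sg ++ sk ++ w ++ sc = (sb ++ sg ++ sk) ++ w ++ sc.
  by rewrite !catA.
have ek' : (size sb + arity_out g + k)%N = size (sb ++ sg' ++ sk).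
  by rewrite !size_cat eg' ek addnA.
have ek'' : (size sb + arity_in g + k)%N = size (sb ++ sg ++ sk).
  by rewrite !size_cat eg ek addnA.
rewrite [sb ++ sg' ++ sk ++ sm ++ sc]E ek' slice_frame0 // em0 /= => -[<-].
rewrite -!E; split=> // t.
rewrite 2!size_cat => /split3[tb [tg [t' [-> etb etg]]]].
rewrite !size_cat => /split3[tk [tm [tc [-> etk etm etc]]]].
have T w : tb ++ tg ++ tk ++ w ++ tc = (tb ++ tg ++ tk) ++ w ++ tc.
  by rewrite !catA.
rewrite act_split ?etg // [in RHS]T -!size_cat.
rewrite (E sm) act_split; first last.
- by rewrite etm.
- by [].
- by rewrite !size_cat etb etg etk.
under [RHS]eq_evalf => s c sc' do (rewrite -T act_split ?etg //).
rewrite evalf_lin; apply: eq_evalf => s c /src_size es.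
have T' w : tb ++ s ++ tk ++ w ++ tc = (tb ++ s ++ tk) ++ w ++ tc.
  by rewrite !catA.
rewrite T' E' ek'' act_split ?etm //; first by apply: eq_evalf => s' c' _; rewrite -T'.
by rewrite !size_cat etb es etk eg.
Qed.

Lemma check_zigzag_l b :
  all (check_move [:: (0, Cup b); (1, Cap)]%N [::]) (words [:: true; false] 1).
Proof. by case: b; vm_compute. Qed.

Lemma check_zigzag_r b :
  all (check_move [:: (1, Cup b); (0, Cap)]%N [::]) (words [:: true; false] 1).
Proof. by case: b; vm_compute. Qed.

Lemma check_slide_cap o :
  all (check_move [:: (0, Cross o); (1, Cap)]%N
         [:: (1, Cross (~~ o)); (0, Cap)]%N) (words [:: true; false] 3).
Proof. by case: o; vm_compute. Qed.

Lemma check_slide_cup b o :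
  all (check_move [:: (0, Cup b); (1, Cross o)]%N
         [:: (1, Cup b); (0, Cross (~~ o))]%N) (words [:: true; false] 1).
Proof. by case: b; case: o; vm_compute. Qed.

Lemma check_R1_cap o :
  all (check_move [:: (0, Cross o); (0, Cap)]%N [:: (0, Cap)]%N)
    (words [:: true; false] 2).
Proof. by case: o; vm_compute. Qed.

Lemma check_R1_cup b o :
  all (check_move [:: (0, Cup b); (0, Cross o)]%N [:: (0, Cup (~~ b))]%N)
    (words [:: true; false] 0).
Proof. by case: b; case: o; vm_compute. Qed.

Lemma check_R2 o :
  all (check_move [:: (0, Cross o); (0, Cross (~~ o))]%N [::])
    (words [:: true; false] 2).
Proof. by case: o; vm_compute. Qed.

Lemma check_R3 o :
  all (check_move [:: (0, Cross o); (1, Cross o); (0, Cross o)]%N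
         [:: (1, Cross o); (0, Cross o); (1, Cross o)]%N)
    (words [:: true; false] 3).
Proof. by case: o; vm_compute. Qed.

Lemma move_Zrun l r st st1 st1' u : move l r ->
  run l st = Some st1 -> run r st = Some st1' ->
  st1 = st1' /\ veq (size st1) (Zrun l st u) (Zrun r st u).
Proof.
have s2 i g h : [:: (i, g); (i.+1, h)] = shift i [:: (0, g); (1, h)]%N.
  by rewrite /shift /= addn0 addn1.
have s2' i g h : [:: (i.+1, g); (i, h)] = shift i [:: (1, g); (0, h)]%N.
  by rewrite /shift /= addn0 addn1.
have s0 i g h : [:: (i, g); (i, h)] = shift i [:: (0, g); (0, h)]%N.
  by rewrite /shift /= addn0.
have s1 i g : [:: (i, g)] = shift i [:: (0, g)]%N by rewrite /shift /= addn0.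
case=> {l r} => [i k g h|i b|i b|i o|i b o|i o|i b o|i o|i o] e1 e2.
- exact: far_Zrun.
- apply: (local_move _ (s2 _ _ _) (erefl (shift i [::])) _ _
    (check_zigzag_l b) _ e1 e2) => //.
  by move: (run_fits e1) => /=; lia.
- apply: (local_move _ (s2' _ _ _) (erefl (shift i [::])) _ _
    (check_zigzag_r b) _ e1 e2) => //.
  by move: (run_fits e1) => /=; lia.
- apply: (local_move _ (s2 _ _ _) (s2' _ _ _) _ _
    (check_slide_cap o) _ e1 e2) => //.
  by move: (run_fits e1) => /=; lia.
- apply: (local_move _ (s2 _ _ _) (s2' _ _ _) _ _
    (check_slide_cup b o) _ e1 e2) => //.
  by move: (run_fits e1) => /=; lia.
- apply: (local_move _ (s0 _ _ _) (s1 _ _) _ _ (check_R1_cap o) _ e1 e2) => //.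
  by move: (run_fits e1) => /=; lia.
- apply: (local_move _ (s0 _ _ _) (s1 _ _) _ _ (check_R1_cup b o) _ e1 e2) => //.
  by move: (run_fits e1) => /=; lia.
- apply: (local_move _ (s0 _ _ _) (erefl (shift i [::])) _ _
    (check_R2 o) _ e1 e2) => //.
  by move: (run_fits e1) => /=; lia.
- apply: (local_move _ _ _ _ _ (check_R3 o) _ e1 e2) => //.
  + by rewrite /shift /= addn0 addn1.
  + by rewrite /shift /= addn0 addn1.
  + by move: (run_fits e1) => /=; lia.
Qed.

(** * The action of U_q commutes with tangles *)

Fixpoint hprod (ws : seq (idx -> F11)) (t : seq idx) : F11 :=
  match ws, t with
  | w :: ws', x :: t' => w x * hprod ws' t'
  | _, _ => 1
  end.

Lemma hprod_cat wa wb ta tb : size wa = size ta ->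
  hprod (wa ++ wb) (ta ++ tb) = hprod wa ta * hprod wb tb.
Proof.
elim: wa ta => [|w wa IH] [|x ta] //=; first by rewrite mul1r.
by case=> /IH ->; rewrite mulrA.
Qed.

Definition all_pieces := [:: Cup true; Cup false; Cap; Cross true; Cross false].

Lemma piece_ind' (P : piece -> bool) : all P all_pieces -> forall g, P g.
Proof. by case/and5P=> ? ? ? ? /andP[? _] [[]||[]]. Qed.

Definition words_in g := words [:: true; false] (arity_in g).

(* The operators w (x) ... (x) w commute with all the elementary tangles. *)
Definition grouplike (w : bool -> idx -> F11) : bool :=
  all (fun g => all (fun sm =>
    if apply_slice sm (0%N, g) is Some sm' then
      all (fun t => all (fun e =>
          hprod (map w sm) e.1 == hprod (map w sm') t) (src g sm t))
        (words idx_all (arity_out g))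
    else true) (words_in g)) all_pieces.

Lemma grouplikeP w g sm sm' t s c : grouplike w -> size sm = arity_in g ->
  apply_slice sm (0%N, g) = Some sm' -> size t = arity_out g ->
  (s, c) \in src g sm t -> hprod (map w sm) s = hprod (map w sm') t.
Proof.
move=> /piece_ind'/(_ g)/allP h em e et sin.
have := h sm (mem_bwords em); rewrite e => /allP/(_ _ (mem_iwords et))/allP.
by move=> /(_ _ sin)/eqP.
Qed.

Lemma act_weight g sa sm sc (wa wm wm' wc : seq (idx -> F11)) u ta tm tc :
  size ta = size sa -> size sm = arity_in g -> size tm = arity_out g ->
  size wa = size sa -> size wm = size sm -> size wm' = size tm ->
  (forall s c, (s, c) \in src g sm tm -> hprod wm s = hprod wm' tm) ->
  act (size sa, g) (sa ++ sm ++ sc)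
    (fun t => hprod (wa ++ wm ++ wc) t * u t) (ta ++ tm ++ tc) =
  hprod (wa ++ wm' ++ wc) (ta ++ tm ++ tc) *
  act (size sa, g) (sa ++ sm ++ sc) u (ta ++ tm ++ tc).
Proof.
move=> eta em etm ewa ewm ewm' h; rewrite !act_split // -evalf_mul.
apply: eq_evalf => s c sin; have es := src_size sin.
rewrite hprod_cat ?ewa // hprod_cat ?ewm ?em // [in RHS]hprod_cat ?ewa //.
by rewrite hprod_cat // (h _ _ sin).
Qed.

Inductive gen := GE2 | GF2 | GF1.

(* For a generator x of U_q, Xg describes a primitive element X, with         *)
(* coproduct X (x) B + 1 (x) X, proportional to x up to a grouplike factor,   *)
(* acting on V (b = true) and on its dual.                                    *)
Definition Xg (k : gen) (b : bool) : seq (idx * idx * F11) :=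
  match k, b with
  | GE2, true => [:: (X0, X1, R7); (X2, X3, R7)]
  | GE2, false => [:: (X1, X0, R8); (X3, X2, R9)]
  | GF2, true => [:: (X1, X0, R6); (X3, X2, R9)]
  | GF2, false => [:: (X0, X1, R1); (X2, X3, R1)]
  | GF1, true => [:: (X2, X1, R3)]
  | GF1, false => [:: (X1, X2, R2)]
  end.

Definition Bg (k : gen) (b : bool) (x : idx) : F11 :=
  match k, b, x with
  | GF1, true, X1 => R4 | GF1, true, X2 => R3
  | GF1, false, X1 => R3 | GF1, false, X2 => R4
  | GF1, _, _ => R1
  | _, true, X0 => R5 | _, true, X1 => R6 | _, true, X2 => R2 | _, true, X3 => R9
  | _, false, X0 => R9 | _, false, X1 => R2 | _, false, X2 => R6
  | _, false, X3 => R5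
  end.

Definition Bp k (st : seq bool) := hprod (map (Bg k) st).

(** The iterated coproduct: [X] acts on one letter, [B] on every letter to its right, the identity
    on those to its left. *)
Fixpoint Xsrc k (st : seq bool) (t : seq idx) : lform :=
  match st, t with
  | b :: st', x :: t' =>
      [seq (e.1.2 :: t', e.2 * Bp k st' t') | e <- Xg k b & e.1.1 == x] ++
      [seq (x :: e.1, e.2) | e <- Xsrc k st' t']
  | _, _ => [::]
  end.

Definition Xop k st (u : vec) : vec := fun t => evalf (Xsrc k st t) u.

Lemma evalf_map (f : seq idx -> seq idx) l u :
  evalf [seq (f e.1, e.2) | e <- l] u = evalf l (fun s => u (f s)).
Proof. by rewrite /evalf big_map. Qed.

Lemma evalf_mulr l c (u : vec) : evalf l (fun s => u s * c) = evalf l u * c.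
Proof. by rewrite /evalf mulr_suml; apply: eq_bigr => e _; rewrite mulrA. Qed.

Lemma Xop_cat k sa sb u ta tb : size ta = size sa ->
  Xop k (sa ++ sb) u (ta ++ tb) =
  Xop k sa (fun s => u (s ++ tb)) ta * Bp k sb tb +
  Xop k sb (fun s => u (ta ++ s)) tb.
Proof.
elim: sa ta u => [|b sa IH] [|x ta] u //=.
  by move=> _; rewrite /Xop evalf_nil mul0r add0r.
case=> e; rewrite /Xop /= !evalf_cat !evalf_map mulrDl -addrA; congr (_ + _).
  rewrite /evalf !big_map mulr_suml; apply: eq_bigr => i _ /=.
  by rewrite /Bp map_cat hprod_cat ?size_map // mulrA mulrAC.
exact: IH.
Qed.

Lemma Xop_lin k st (r : lform) (f : seq idx -> vec) t :
  Xop k st (fun s => evalf r (fun s' => f s' s)) t =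
  evalf r (fun s' => Xop k st (f s') t).
Proof. exact: evalf_lin. Qed.

Lemma Xsrc_size k st t s c : (s, c) \in Xsrc k st t -> size s = size t.
Proof.
elim: st t s c => [|b st IH] [|x t] s c //=; rewrite mem_cat.
case/orP=> /mapP[[e e']].
  by move=> _ [-> _].
by move=> /IH /= <- [-> _].
Qed.

Definition lbind (l : lform) (F : seq idx -> lform) : lform :=
  flatten [seq [seq (e'.1, e.2 * e'.2) | e' <- F e.1] | e <- l].

Lemma lbindE l F u : evalf (lbind l F) u = evalf l (fun s => evalf (F s) u).
Proof.
rewrite /lbind evalf_flatten; apply: eq_bigr => e _.
by rewrite (@evalf_scale id).
Qed.

Definition all_gens := [:: GE2; GF2; GF1].

Lemma gen_ind' (P : gen -> bool) : all P all_gens -> forall k, P k.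
Proof. by case/and4P=> ? ? ? _ []. Qed.

Lemma Bg_grouplike k : grouplike (Bg k).
Proof. by case: k; vm_compute. Qed.

Lemma check_Xop : all (fun k => all (fun g => all (fun sm =>
    if apply_slice sm (0%N, g) is Some sm' then
      all (fun t => lform_eq (lbind (Xsrc k sm' t) (src g sm))
                             (lbind (src g sm t) (Xsrc k sm)))
        (words idx_all (arity_out g))
    else true) (words_in g)) all_pieces) all_gens.
Proof. by vm_compute. Qed.

Lemma Xop_local k g sm sm' t u : size sm = arity_in g ->
  apply_slice sm (0%N, g) = Some sm' -> size t = arity_out g ->
  Xop k sm' (fun t => evalf (src g sm t) u) t = evalf (src g sm t) (Xop k sm u).
Proof.
move=> em e et; have /gen_ind'/(_ k)/piece_ind'/(_ g)/allP := check_Xop.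
move=> /(_ _ (mem_bwords em)); rewrite e => /allP/(_ _ (mem_iwords et)).
by move=> /(lform_eqP u); rewrite !lbindE.
Qed.

(** The coproduct splits [X] into terms acting to the left of the piece, on its strands and to its
    right. The middle term commutes with the piece by [check_Xop]; the left one carries [B] on the
    strands of the piece, which passes through because [B] is grouplike. *)
Lemma act_Xop k st x st' u : apply_slice st x = Some st' ->
  veq (size st') (Xop k st' (act x st u)) (act x st (Xop k st u)).
Proof.
case: x => i g e t.
have [sa [sm [sm' [sc [ea em em' [est est' em0]]]]]] := slice_decomp e.
rewrite est' !size_cat => /split3[ta [tm [tc [-> eta etm etc]]]].
have es : size sm = arity_in g by [].
rewrite est -ea act_split ?etm //.
have X w' s : size w' = size s ->
    forall v, Xop k (sa ++ w' ++ sc) v (ta ++ s ++ tc) =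
    Xop k sa (fun r => v (r ++ s ++ tc)) ta * Bp k w' s * Bp k sc tc +
    Xop k w' (fun r => v (ta ++ r ++ tc)) s * Bp k sc tc +
    Xop k sc (fun r => v (ta ++ s ++ r)) tc.
  move=> e' v; rewrite Xop_cat // Xop_cat // addrA; congr (_ + _ + _).
  by rewrite /Bp map_cat hprod_cat ?size_map // mulrA.
rewrite X //.
have -> : evalf (src g sm tm)
    (fun s => Xop k (sa ++ sm ++ sc) u (ta ++ s ++ tc)) =
  evalf (src g sm tm) (fun s =>
    Xop k sa (fun r => u (r ++ s ++ tc)) ta * (Bp k sm' tm * Bp k sc tc)) +
  evalf (src g sm tm) (fun s =>
    Xop k sm (fun r => u (ta ++ r ++ tc)) s * Bp k sc tc) +
  evalf (src g sm tm) (fun s => Xop k sc (fun r => u (ta ++ s ++ r)) tc).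
  rewrite /evalf -!big_split; apply: eq_big_seq => -[s c] /= sin.
  rewrite X ?(src_size sin) //.
  rewrite /Bp (grouplikeP (Bg_grouplike k) em em0 _ sin) ?etm //.
  by rewrite !mulrDr -!mulrA.
congr (_ + _ + _).
- rewrite evalf_mulr -mulrA; congr (_ * _).
  rewrite -Xop_lin; apply: eq_evalf => s c /Xsrc_size e'.
  by rewrite act_split ?e' ?etm.
- rewrite evalf_mulr; congr (_ * _).
  rewrite -(Xop_local k _ em em0) ?etm //; apply: eq_evalf => s c /Xsrc_size e'.
  by rewrite act_split ?e' ?etm.
- rewrite -Xop_lin; apply: eq_evalf => s c _.
  by rewrite act_split ?etm.
Qed.

Lemma Zrun_Xop k D st st' u : run D st = Some st' ->
  veq (size st') (Xop k st' (Zrun D st u)) (Zrun D st (Xop k st u)).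
Proof.
elim: D st u => [|x D IH] st u /=; first by case=> <-.
case e: (apply_slice st x) => [st1|] //= e' t et; rewrite (IH _ _ e') //.
by apply: (Zrun_ext e') et; exact: act_Xop.
Qed.

(** * Cutting a closed diagram open *)

Definition gw (b : bool) (x : idx) : F11 := if b then muV11 x else mu11 x.

Definition delta0 (x : idx) : F11 := if x is X0 then 1 else 0.

(* The weights which cut a closed diagram open at the i-th strand of a level, *)
(* the strands on its left being closed on the left, those on its right being *)
(* closed on the right.                                                       *)
Definition cut_weights (st : seq bool) (i : nat) : seq (idx -> F11) :=
  map gw (take i st) ++ delta0 :: map (gw \o negb) (drop i.+1 st).

(* Found by solving the linear system which is verified in check_Y, among the *)
(* weight-homogeneous solutions (check_Y_weight).                             *)
Definition Ycert (a b : bool) (k : gen) : entries F11 :=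
  match a, b, k with
  | true, true, GE2 =>
    [:: ((X1, X0), (X0, X0), R4); ((X2, X1), (X0, X2), R4); ((X3, X0), (X2, X0), R2)]
  | true, true, GF2 =>
    [:: ((X0, X0), (X0, X1), R3); ((X0, X2), (X0, X3), R4); ((X2, X0), (X1, X2), R2)]
  | true, true, GF1 =>
    [:: ((X1, X0), (X0, X2), R6); ((X1, X1), (X0, X3), R6); ((X3, X0), (X2, X2), R10)]
  | true, false, GE2 =>
    [:: ((X1, X1), (X0, X1), R10); ((X2, X2), (X0, X1), R9); ((X3, X0), (X2, X0), R6)]
  | true, false, GF2 =>
    [:: ((X0, X3), (X0, X2), R7); ((X1, X1), (X1, X0), R3); ((X2, X2), (X1, X0), R6)]
  | true, false, GF1 =>
    [:: ((X1, X3), (X0, X1), R6); ((X3, X2), (X2, X0), R9)]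
  | false, true, GE2 =>
    [:: ((X0, X0), (X3, X2), R9); ((X0, X1), (X1, X1), R1); ((X2, X0), (X3, X0), R8)]
  | false, true, GF2 =>
    [:: ((X0, X0), (X2, X3), R4); ((X0, X2), (X0, X3), R4); ((X1, X0), (X1, X1), R3)]
  | false, true, GF1 =>
    [:: ((X0, X1), (X1, X3), R1); ((X2, X0), (X3, X2), R7)]
  | false, false, GE2 =>
    [:: ((X0, X0), (X0, X1), R1); ((X0, X2), (X0, X3), R9); ((X2, X0), (X0, X3), R8)]
  | false, false, GF2 =>
    [:: ((X1, X0), (X0, X0), R2); ((X3, X0), (X0, X2), R10); ((X3, X0), (X2, X0), R4)]
  | false, false, GF1 =>
    [:: ((X2, X0), (X0, X1), R9); ((X2, X2), (X0, X3), R1); ((X3, X0), (X1, X1), R3)]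
  end.

Definition Ysrc a b k (t : seq idx) : lform :=
  [seq ([:: e.1.2.1; e.1.2.2], e.2)
     | e <- Ycert a b k & t == [:: e.1.1.1; e.1.1.2]].

Definition lneg (l : lform) : lform := [seq (e.1, - e.2) | e <- l].

Definition cut_diff a b (t : seq idx) : F11 :=
  hprod [:: delta0; gw (~~ b)] t - hprod [:: gw a; delta0] t.

(* The difference of the two ways of cutting the second tensor power of V or  *)
(* its dual is a sum of commutators.                                          *)
Lemma check_Y : all (fun a => all (fun b =>
    all (fun t => lform_eq [:: (t, cut_diff a b t)]
      (flatten [seq lbind (Xsrc k [:: a; b] t) (Ysrc a b k) ++
                 lneg (lbind (Ysrc a b k t) (Xsrc k [:: a; b]))
               | k <- all_gens]))
    (words idx_all 2)) [:: true; false]) [:: true; false].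
Proof. by vm_compute. Qed.

(** The factor by which [X] rescales the weight [gw] ([check_gw]) and by which the certificate [Y]
    rescales [B] ([check_Y_weight]). That the two factors agree makes the terms on the left strands
    match in [Xop_commutator]. *)
Definition gamV (k : gen) : F11 := if k is GF1 then R9 else R10.

Lemma check_Y_weight : all (fun k => all (fun a => all (fun b =>
    all (fun t => all (fun e => gamV k * Bp k [:: a; b] t == Bp k [:: a; b] e.1)
      (Ysrc a b k t)) (words idx_all 2)) [:: true; false]) [:: true; false])
  all_gens.
Proof. by vm_compute. Qed.

Lemma Xop_weight (w : bool -> idx -> F11) c k st f t :
  all (fun b => all (fun e => w b e.1.2 == c * w b e.1.1) (Xg k b))
    [:: true; false] ->
  Xop k st (fun s => hprod (map w st) s * f s) t =
  c * hprod (map w st) t * Xop k st f t.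
Proof.
move=> h; elim: st t f => [|b st IH] [|x t] f;
  rewrite /Xop /= ?evalf_nil ?mulr0 //.
rewrite !evalf_cat !evalf_map /= mulrDr; congr (_ + _).
  rewrite /evalf !big_map !big_filter mulr_sumr.
  rewrite big_seq_cond [RHS]big_seq_cond.
  apply: eq_bigr => e /andP[ein /eqP <-] /=.
  have bin : forall b, b \in [:: true; false] by case.
  have /allP/(_ _ (bin b))/allP/(_ _ ein) := h.
  by move=> /eqP ->; ring.
transitivity (w b x *
    evalf (Xsrc k st t) (fun s => hprod (map w st) s * f (x :: s))).
  by rewrite -evalf_mul; apply: eq_evalf => s c' _; rewrite mulrA.
have := IH t (fun s => f (x :: s)); rewrite /Xop => ->; ring.
Qed.

(** Chosen so that [X] leaves it unchanged ([check_hw]), while its product with [B] is the closing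
    weight [gw \o negb] ([hprod_hw]). *)
Definition hw k (b : bool) (x : idx) : F11 := Bg k (~~ b) x * gw (~~ b) x.

Lemma check_gw k : all (fun b => all (fun e => gw b e.1.2 == gamV k * gw b e.1.1)
  (Xg k b)) [:: true; false].
Proof. by case: k; vm_compute. Qed.

Lemma check_hw k : all (fun b => all (fun e => hw k b e.1.2 == 1 * hw k b e.1.1)
  (Xg k b)) [:: true; false].
Proof. by case: k; vm_compute. Qed.

Lemma hprod_hw k st t : size t = size st ->
  hprod (map (hw k) st) t * Bp k st t = hprod (map (gw \o negb) st) t.
Proof.
elim: st t => [|b st IH] [|x t] //=.
rewrite /Bp /= => -[/IH <-]; rewrite /Bp.
have -> : gw (~~ b) x = hw k b x * Bg k b x by case: (k) => //; case: (b); case: (x).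
ring.
Qed.

(* The vector w below is X-homogeneous enough for the terms of X which act on *)
(* the other strands to cancel: only a commutator on two strands is left.     *)
Lemma Xop_commutator k sa a b sc (u : vec) ta t tc :
  size ta = size sa -> size t = 2 -> size tc = size sc ->
  let Y (v : vec) (r r' : seq idx) (s : seq idx) :=
    evalf (Ysrc a b k s) (fun s => v (r ++ s ++ r')) in
  let st := sa ++ [:: a; b] ++ sc in
  let w (t : seq idx) :=
    let ta := take (size sa) t in
    let s := take 2 (drop (size sa) t) in
    let tc := drop (size sa + 2) t in
    hprod (map gw sa) ta * hprod (map (hw k) sc) tc * Y u ta tc s in
  Xop k st w (ta ++ t ++ tc) =
  hprod (map gw sa) ta * hprod (map (hw k) sc) tc * Y (Xop k st u) ta tc t +
  hprod (map gw sa) ta * hprod (map (gw \o negb) sc) tc *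
   (evalf (lbind (Xsrc k [:: a; b] t) (Ysrc a b k)) (fun s => u (ta ++ s ++ tc)) -
    evalf (lbind (Ysrc a b k t) (Xsrc k [:: a; b])) (fun s => u (ta ++ s ++ tc))).
Proof.
move=> eta et etc Y st w.
have wE r s r' : size r = size sa -> size s = 2 ->
  w (r ++ s ++ r') = hprod (map gw sa) r * hprod (map (hw k) sc) r' * Y u r r' s.
  move=> er es; rewrite /w.
  have -> : take (size sa) (r ++ s ++ r') = r by rewrite take_size_cat.
  have -> : drop (size sa) (r ++ s ++ r') = s ++ r' by rewrite drop_size_cat.
  have -> : drop (size sa + 2) (r ++ s ++ r') = r'.
    by rewrite catA drop_size_cat // size_cat er es.
  by rewrite take_size_cat.
have X s : size s = 2 -> forall v, Xop k st v (ta ++ s ++ tc) =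
    Xop k sa (fun r => v (r ++ s ++ tc)) ta *
      Bp k [:: a; b] s * Bp k sc tc +
    Xop k [:: a; b] (fun r => v (ta ++ r ++ tc)) s * Bp k sc tc +
    Xop k sc (fun r => v (ta ++ s ++ r)) tc.
  move=> es v; rewrite Xop_cat // Xop_cat // addrA; congr (_ + _ + _).
  by rewrite /Bp map_cat hprod_cat ?size_map // mulrA.
have Ysz s c : (s, c) \in Ysrc a b k t -> size s = 2 by move=> /mapP[e _ [-> _]].
have cY s c : (s, c) \in Ysrc a b k t ->
    Bp k [:: a; b] s = gamV k * Bp k [:: a; b] t.
  move=> sin; have bin : forall b, b \in [:: true; false] by case.
  have /gen_ind'/(_ k)/allP/(_ _ (bin a))/allP/(_ _ (bin b)) := check_Y_weight.
  by move=> /allP/(_ _ (mem_iwords et))/allP/(_ _ sin)/eqP.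
have -> : Y (Xop k st u) ta tc t =
  evalf (Ysrc a b k t) (fun s => Xop k sa (fun r => u (r ++ s ++ tc)) ta *
      (gamV k * Bp k [:: a; b] t * Bp k sc tc)) +
  evalf (Ysrc a b k t) (fun s =>
     Xop k [:: a; b] (fun r => u (ta ++ r ++ tc)) s * Bp k sc tc) +
  evalf (Ysrc a b k t) (fun s => Xop k sc (fun r => u (ta ++ s ++ r)) tc).
  rewrite /Y /evalf -!big_split; apply: eq_big_seq => -[s c] /= sin.
  by rewrite X ?(Ysz _ _ sin) // (cY _ _ sin) !mulrDr -!mulrA.
rewrite !evalf_mulr.
have -> : evalf (Ysrc a b k t)
    (fun s => Xop k [:: a; b] (fun r => u (ta ++ r ++ tc)) s) =
  evalf (lbind (Ysrc a b k t) (Xsrc k [:: a; b])) (fun s => u (ta ++ s ++ tc)).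
  by rewrite lbindE.
rewrite X // -(hprod_hw k) //.
have -> : Xop k sa (fun r => w (r ++ t ++ tc)) ta =
    gamV k * hprod (map gw sa) ta * hprod (map (hw k) sc) tc *
    evalf (Ysrc a b k t) (fun s => Xop k sa (fun r => u (r ++ s ++ tc)) ta).
  transitivity (Xop k sa (fun r => hprod (map gw sa) r *
     evalf (Ysrc a b k t) (fun s => hprod (map (hw k) sc) tc * u (r ++ s ++ tc))) ta).
    apply: eq_evalf => r c /Xsrc_size er; rewrite wE ?er // -mulrA; congr (_ * _).
    by rewrite evalf_mul.
  rewrite (Xop_weight _ _ _ (check_gw k)) Xop_lin -!mulrA; do 2!congr (_ * _).
  by rewrite -evalf_mul; apply: eq_evalf => s c _; rewrite /Xop evalf_mul.
have -> : Xop k [:: a; b] (fun r => w (ta ++ r ++ tc)) t =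
   hprod (map gw sa) ta * hprod (map (hw k) sc) tc *
   evalf (lbind (Xsrc k [:: a; b] t) (Ysrc a b k)) (fun s => u (ta ++ s ++ tc)).
  rewrite lbindE -evalf_mul; apply: eq_evalf => s c /Xsrc_size es.
  by rewrite wE // es.
have -> : Xop k sc (fun r => w (ta ++ t ++ r)) tc =
    hprod (map gw sa) ta * hprod (map (hw k) sc) tc *
    evalf (Ysrc a b k t) (fun s => Xop k sc (fun r => u (ta ++ s ++ r)) tc).
  transitivity (Xop k sc (fun r => hprod (map (hw k) sc) r *
     evalf (Ysrc a b k t) (fun s => hprod (map gw sa) ta * u (ta ++ s ++ r))) tc).
    apply: eq_evalf => r c _; rewrite wE // /Y evalf_mul; ring.
  rewrite (Xop_weight _ _ _ (check_hw k)) Xop_lin mul1r [_ * hprod _ tc]mulrC -!mulrA.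
  congr (_ * _).
  by rewrite -evalf_mul; apply: eq_evalf => s c _; rewrite /Xop evalf_mul.
ring.
Qed.

Lemma Zrun_add D st u1 u2 st' : run D st = Some st' ->
  veq (size st') (Zrun D st (fun s => u1 s + u2 s))
    (fun t => Zrun D st u1 t + Zrun D st u2 t).
Proof.
move=> e t et; pose r : lform := [:: ([:: X0], 1); ([::], 1)].
have := @Zrun_lin D st r (fun s' => if s' is [::] then u2 else u1) st' e t et.
rewrite /r !evalf_cons evalf_nil addr0 /= !mul1r => <-.
congr (Zrun D st _ t); apply: funext => s.
by rewrite !evalf_cons evalf_nil addr0 !mul1r.
Qed.

Lemma Zrun_sum (T : Type) (r : seq T) (f : T -> vec) D st st' :
  run D st = Some st' ->
  veq (size st') (Zrun D st (fun s => \sum_(k <- r) f k s))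
    (fun t => \sum_(k <- r) Zrun D st (f k) t).
Proof.
move=> e; elim: r => [|k r IH] t et.
  transitivity (Zrun D st (fun s => 0 * vec0 s) t).
    by congr (Zrun D st _ t); apply: funext => s; rewrite big_nil mul0r.
  by rewrite (Zrun_mul _ _ e) // big_nil mul0r.
rewrite big_cons -IH // -(Zrun_add _ _ e) //.
by congr (Zrun D st _ t); apply: funext => s; rewrite big_cons.
Qed.

Definition invariant st (u : vec) :=
  forall k, veq (size st) (Xop k st u) (fun => 0).

Lemma Zrun_invariant D st : run D [::] = Some st ->
  invariant st (Zrun D [::] vec0).
Proof.
move=> e k t et; rewrite (Zrun_Xop _ _ e) //.
have -> : Xop k [::] vec0 = fun t => 0 * Zrun [::] [::] vec0 t.
  by apply: funext => s; rewrite mul0r /Xop /= evalf_nil.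
by rewrite (Zrun_mul _ _ e) // mul0r.
Qed.

Lemma Zrun_closed_Xop k D st u : run D st = Some [::] ->
  Zrun D st (Xop k st u) [::] = 0.
Proof. by move=> e; rewrite -(Zrun_Xop _ _ e) // /Xop evalf_nil. Qed.

Lemma cut_weights_cat sa a sc : cut_weights (sa ++ a :: sc) (size sa) =
  map gw sa ++ delta0 :: map (gw \o negb) sc.
Proof.
have e : (size sa).+1 = size (sa ++ [:: a]) by rewrite size_cat addn1.
rewrite /cut_weights take_size_cat // -[a :: sc]cat1s catA e.
by rewrite (@drop_size_cat _ _ (sa ++ [:: a])).
Qed.

Definition cut D st i (u : vec) : F11 :=
  Zrun D st (fun t => hprod (cut_weights st i) t * u t) [::].

(** Since [X] kills [u], each commutator applied to [u] reduces to an image of [X]; and images of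
    [X] die in a closed diagram, because [X] commutes with the diagram and is 0 at the empty
    level. *)
Lemma cut_adjacent D sa a b sc u (st := sa ++ [:: a; b] ++ sc) :
  run D st = Some [::] -> invariant st u ->
  cut D st (size sa) u = cut D st (size sa).+1 u.
Proof.
move=> e inv; apply/eqP; rewrite -subr_eq0 /cut -(Zrun_sub _ _ e) //; apply/eqP.
pose w k (t : seq idx) :=
  let ta := take (size sa) t in
  let s := take 2 (drop (size sa) t) in
  let tc := drop (size sa + 2) t in
  hprod (map gw sa) ta * hprod (map (hw k) sc) tc *
  evalf (Ysrc a b k s) (fun s => u (ta ++ s ++ tc)).
have wE : veq (size st) (fun t => hprod (cut_weights st (size sa)) t * u t -
      hprod (cut_weights st (size sa).+1) t * u t)
    (fun t => \sum_(k <- all_gens) Xop k st (w k) t).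
  move=> t'; rewrite !size_cat => /split3[ta [t [tc [-> eta et etc]]]].
  rewrite [cut_weights st (size sa)]cut_weights_cat.
  have -> : cut_weights st (size sa).+1 =
      map gw (sa ++ [:: a]) ++ delta0 :: map (gw \o negb) sc.
    have -> : (size sa).+1 = size (sa ++ [:: a]) by rewrite size_cat addn1.
    by rewrite -(cut_weights_cat _ b) /st -catA.
  have -> : map gw (sa ++ [:: a]) ++ delta0 :: map (gw \o negb) sc =
      map gw sa ++ [:: gw a; delta0] ++ map (gw \o negb) sc.
    by rewrite map_cat -catA.
  have -> : map gw sa ++ delta0 :: map (gw \o negb) ([:: b] ++ sc) =
      map gw sa ++ [:: delta0; gw (~~ b)] ++ map (gw \o negb) sc by [].
  rewrite !hprod_cat ?size_map ?et // -mulrBl.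
  transitivity (hprod (map gw sa) ta * hprod (map (gw \o negb) sc) tc *
      evalf [:: (t, cut_diff a b t)] (fun s => u (ta ++ s ++ tc))).
    rewrite evalf_cons evalf_nil addr0 /cut_diff /=; ring.
  have bin : forall b, b \in [:: true; false] by case.
  have /allP/(_ _ (bin a))/allP/(_ _ (bin b))/allP/(_ _ (mem_iwords et)) := check_Y.
  move=> /lform_eqP ->; rewrite evalf_flatten mulr_sumr; apply: eq_bigr => k _.
  rewrite (@Xop_commutator k sa a b sc u) // evalf_cat.
  have -> : evalf (lneg (lbind (Ysrc a b k t) (Xsrc k [:: a; b])))
      (fun s => u (ta ++ s ++ tc)) =
      - evalf (lbind (Ysrc a b k t) (Xsrc k [:: a; b])) (fun s => u (ta ++ s ++ tc)).
    by rewrite /evalf big_map -sumrN; apply: eq_bigr => i _; rewrite mulNr.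
  suff -> : evalf (Ysrc a b k t)
      (fun s => Xop k (sa ++ [:: a; b] ++ sc) u (ta ++ s ++ tc)) = 0.
    by rewrite mulr0 add0r.
  rewrite /evalf big_seq big1 // => -[s c] /mapP[f _ [-> ->]].
  by rewrite inv ?mulr0 // !size_cat eta etc.
rewrite (Zrun_ext e wE) // (Zrun_sum _ _ e) // big1 // => k _.
exact: Zrun_closed_Xop.
Qed.

Lemma cut_level D st u i j : run D st = Some [::] -> invariant st u ->
  (i < size st)%N -> (j < size st)%N -> cut D st i u = cut D st j u.
Proof.
move=> e inv; have step l : (l.+1 < size st)%N -> cut D st l u = cut D st l.+1 u.
  move=> lt; have [|sa [sm [sc [est el em _]]]] :=
    @split3 _ st l 2 (size st - (l + 2)); first by lia.
  case: sm em est => [|a [|b [|]]] //= _ est.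
  by move: e inv; rewrite est -el; exact: cut_adjacent.
have to0 l : (l < size st)%N -> cut D st l u = cut D st 0 u.
  by elim: l => // l IH lt; rewrite -step // IH // ltnW.
by move=> /to0 -> /to0 ->.
Qed.

Lemma Zrun_cons x D st st' u : apply_slice st x = Some st' ->
  Zrun (x :: D) st u = Zrun D st' (act x st u).
Proof. by move=> /= ->. Qed.

Lemma gw_grouplike : grouplike gw. Proof. by vm_compute. Qed.

Lemma gwN_grouplike : grouplike (gw \o negb). Proof. by vm_compute. Qed.

Lemma cut_ext D st i u u' : run D st = Some [::] -> veq (size st) u u' ->
  cut D st i u = cut D st i u'.
Proof. by move=> e h; apply: (Zrun_ext e) => // t et; rewrite h. Qed.

Lemma invariant_act st x st' u : apply_slice st x = Some st' ->
  invariant st u -> invariant st' (act x st u).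
Proof.
move=> e inv k t et; rewrite (act_Xop _ _ e) //.
rewrite (act_ext e (inv k)) //.
transitivity (act x st (fun s => evalf [::] (fun s' => vec0 s)) t).
  by congr (act x st _ t); apply: funext => s; rewrite evalf_nil.
by rewrite (act_lin x st [::] (fun _ => vec0)) evalf_nil.
Qed.

(** The slice avoids the cut strand and the closing weights on the other strands are grouplike, so
    the cut can be pushed up past the slice. *)
Lemma cut_left D b sa sm sm' sc g u :
  size sm = arity_in g -> apply_slice sm (0%N, g) = Some sm' ->
  run D (b :: sa ++ sm' ++ sc) = Some [::] ->
  let st := b :: sa ++ sm ++ sc in let x := ((size sa).+1, g) in
  cut (x :: D) st 0 u = cut D (b :: sa ++ sm' ++ sc) 0 (act x st u).
Proof.
move=> em e er st x.
have ex : apply_slice st x = Some (b :: sa ++ sm' ++ sc).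
  by rewrite /x /st -[(size sa).+1]/(size (b :: sa)) (@slice_frame0 (b :: sa)) // e.
rewrite /cut (Zrun_cons _ _ ex); apply: (Zrun_ext er) => // t et.
have [|ta [tm [tc [-> eta etm etc]]]] :=
    @split3 _ t (size (b :: sa)) (size sm') (size sc).
  by rewrite et /= !size_cat.
have cw w : cut_weights (b :: sa ++ w ++ sc) 0 =
    (delta0 :: map (gw \o negb) sa) ++ map (gw \o negb) w ++ map (gw \o negb) sc.
  by rewrite /cut_weights /= drop0 !map_cat.
rewrite /st !cw /x -[(size sa).+1]/(size (b :: sa)).
apply: (@act_weight g (b :: sa)) => //; rewrite ?size_map ?etm //.
- exact: slice_out_size e.
- by rewrite /= size_map.
- move=> s c sin; apply: (grouplikeP gwN_grouplike em e _ sin).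
  by rewrite etm (slice_out_size em e).
Qed.

Lemma cut_right D b sm sm' sc g u :
  size sm = arity_in g -> apply_slice sm (0%N, g) = Some sm' ->
  run D (sm' ++ b :: sc) = Some [::] ->
  let st := sm ++ b :: sc in let x := (0%N, g) in
  cut (x :: D) st (size sm) u =
  cut D (sm' ++ b :: sc) (size sm') (act x st u).
Proof.
move=> em e er st x.
have ex : apply_slice st x = Some (sm' ++ b :: sc).
  by rewrite /x /st (@slice_frame0 [::]) // e.
rewrite /cut (Zrun_cons _ _ ex); apply: (Zrun_ext er) => // t.
rewrite size_cat => /split2[tm [tc [-> etm etc]]].
rewrite /st !cut_weights_cat.
apply: (@act_weight g [::] _ _ [::] _ _ _ _ [::]); rewrite ?size_map ?etm //.
- exact: slice_out_size e.
- move=> s c sin; apply: (grouplikeP gw_grouplike em e _ sin).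
  by rewrite etm (slice_out_size em e).
Qed.

Lemma check_detour a b o :
  all (fun t => lform_eq (pull [:: (0, Cross o)]%N [:: a; b] t)
    (pull [:: (2, Cup (~~ a)); (0, Cross o); (1, Cap)]%N [:: a; b] t))
  (words idx_all 2).
Proof. by case: a; case: b; case: o; vm_compute. Qed.

(* A crossing of the only two strands is carried out on the left of an        *)
(* additional zigzag, away from the strand which is cut.                      *)
Lemma cut_detour D a b o u (st := [:: a; b]) (st' := [:: b; a]) :
  run D st' = Some [::] -> invariant st u ->
  cut ((0%N, Cross o) :: D) st 0 u = cut D st' 0 (act (0%N, Cross o) st u).
Proof.
move=> er inv; pose r := [:: (2, Cup (~~ a)); (0, Cross o); (1, Cap)]%N.
have er' : run r st = Some st' by rewrite /r /st /st'; case: (a); case: (b).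
have detour v : veq 2 (act (0%N, Cross o) st v) (Zrun r st v).
  move=> t et; rewrite -[LHS]/(Zrun [:: (0, Cross o)]%N st v t) !pullE.
  exact/lform_eqP/(allP (check_detour a b o))/mem_iwords.
rewrite (cut_ext _ er (detour u)).
transitivity (cut (r ++ D) st 0 u).
  by rewrite /cut (Zrun_cat _ _ er') -(Zrun_ext er (detour _)).
pose st1 := [:: a; b; ~~ a; a]; pose st2 := [:: b; a; ~~ a; a].
have e1 : apply_slice st (2, Cup (~~ a))%N = Some st1.
  by rewrite /st1 /apply_slice /= negbK.
have e2 : apply_slice st1 (0, Cross o)%N = Some st2 by [].
have e3 : apply_slice st2 (1, Cap)%N = Some st'.
  by rewrite /st2 /st' /apply_slice /=; case: (a).
pose u1 := act (2, Cup (~~ a))%N st u; pose u2 := act (0, Cross o)%N st1 u1.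
have i1 : invariant st1 u1 by exact: invariant_act e1 inv.
have i2 : invariant st2 u2 by exact: invariant_act e2 i1.
have er3 : run ((1, Cap)%N :: D) st2 = Some [::] by rewrite /= e3.
have er2 : run [:: (0, Cross o), (1, Cap) & D]%N st1 = Some [::] by exact: er3.
transitivity (cut [:: (0, Cross o), (1, Cap) & D]%N st1 0 u1).
  apply: (@cut_left _ a [:: b] [::] [:: ~~ a; a] [::] (Cup (~~ a))) => //.
  by rewrite /apply_slice /= negbK.
(* The cut moves to the third strand, passes the crossing from its right, and then returns to the
   first strand. *)
rewrite (cut_level (j := 2) er2 i1) //.
transitivity (cut ((1, Cap)%N :: D) st2 2 u2).
  exact: (@cut_right _ (~~ a) [:: a; b] [:: b; a] [:: a]).
rewrite (cut_level (j := 0) er3 i2) //.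
transitivity (cut D st' 0 (act (1, Cap)%N st2 u2)).
  apply: (@cut_left _ b [::] [:: a; ~~ a] [::] [:: a] Cap) => //.
  by rewrite /st2 /st' /apply_slice /=; case: (a).
by rewrite /r (Zrun_cons _ _ e1).
Qed.

(** The cut only has to avoid the slice: it stays on the first strand if the slice lies to the right
    of it, passes through a strand to the right of the slice if there is one, and otherwise the
    slice is a crossing of the only two strands, handled by [cut_detour]. *)
Lemma cut_step D st x st' u : apply_slice st x = Some st' ->
  run D st' = Some [::] -> invariant st u -> (0 < size st)%N -> (0 < size st')%N ->
  cut (x :: D) st 0 u = cut D st' 0 (act x st u).
Proof.
case: x => i g e er inv lt lt'.
have [sa [sm [sm' [sc [ea em em' [est est' em0]]]]]] := slice_decomp e.
subst i st st'; case: sa e er inv lt lt' => [|b sa] e er inv lt lt'; last first.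
  exact: cut_left.
have erx : run ((0, g)%N :: D) ([::] ++ sm ++ sc) = Some [::] by rewrite /= e.
case: sc e er inv lt lt' erx => [|b sc] e er inv lt lt' erx.
  rewrite !cats0 /= in e er inv lt lt' erx *.
  case: g em em' em0 e erx => [b||o] em em' em0 e erx.
  - by rewrite em in lt.
  - by rewrite em' in lt'.
  - case: sm em em0 e erx inv lt => [|a [|b [|]]] //= _ [<-] {}e erx inv lt in er *.
    exact: cut_detour.
have lt2 w : (size w < size (w ++ b :: sc))%N.
  by rewrite size_cat /= addnS ltnS leq_addr.
rewrite (cut_level (j := size sm) erx inv) ?lt2 // (cut_right u em em0 er).
rewrite (cut_level (j := 0%N) er) ?lt2 //.
exact: invariant_act e inv.
Qed.

(* A cap is a combination of the forms u |-> (Xop k u) t, so it kills the      *)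
(* invariant vectors; hence a closed diagram ending with a cap evaluates to 0. *)
Lemma check_cap : all (fun a =>
  let st := [:: a; ~~ a] in
  lform_eq (src Cap st [::])
   (if a then lbind [:: ([:: X0; X1], R6)] (Xsrc GE2 st) ++
              lbind [:: ([:: X3; X2], R3)] (Xsrc GF2 st)
    else lbind [:: ([:: X2; X3], R5)] (Xsrc GF2 st) ++
         lbind [:: ([:: X1; X0], R8)] (Xsrc GE2 st))) [:: true; false].
Proof. by vm_compute. Qed.

Lemma cap_invariant a u : invariant [:: a; ~~ a] u ->
  evalf (src Cap [:: a; ~~ a] [::]) u = 0.
Proof.
move=> inv; have z k t c : size t = 2 ->
    evalf (lbind [:: (t, c)] (Xsrc k [:: a; ~~ a])) u = 0.
  move=> et; rewrite lbindE evalf_cons evalf_nil addr0 /=.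
  by rewrite -/(Xop k [:: a; ~~ a] u t) inv // mulr0.
have bin : forall b, b \in [:: true; false] by case.
have /allP/(_ _ (bin a)) /lform_eqP -> := check_cap.
by case: (a) in z *; rewrite evalf_cat !z ?addr0.
Qed.

(** The last slice is a cap, applied to the invariant vector produced by the rest. This vanishing is
    the reason for cutting diagrams open. *)
Lemma Zrun_closed D : run D [::] = Some [::] -> D <> [::] ->
  Zrun D [::] vec0 [::] = 0.
Proof.
elim/last_ind: D => [_ []|D [i g] _] //; rewrite -cats1 run_cat.
case e: (run D [::]) => [st|] //= e1 _; rewrite (Zrun_cat _ _ e).
move: e1; case e1: (apply_slice st (i, g)) => [st'|] //= [] ?; subst st'.
have [sa [sm [sm' [sc [ea em em' [est est' em0]]]]]] := slice_decomp e1.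
case: sa ea est est' => // <- est; case: sm' em' em0 => // em' em0.
case: sc est => // est _; subst st; rewrite cats0 /= in e e1 *.
case: g em em' em0 e1 => // em _ + _.
case: sm em e => [|a [|b [|]]] //= _ e; rewrite /apply_slice /= => h.
have eb : b = ~~ a by case: (a) h; case: (b).
rewrite -[LHS]/(evalf (src Cap [:: a; b] [::]) (fun s => Zrun D [::] vec0 (s ++ [::]))).
rewrite eb in e *; under eq_evalf => s c _ do rewrite cats0.
exact/cap_invariant/Zrun_invariant.
Qed.

(** * The cut value and its isotopy invariance *)

Definition LG11 (D : diagram) : F11 :=
  if D is x :: D' then
    cut D' (odflt [::] (apply_slice [::] x)) 0 (act x [::] vec0)
  else 0.

Lemma Zrun_scalar D u : run D [::] = Some [::] ->
  Zrun D [::] u [::] = u [::] * Zrun D [::] vec0 [::].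
Proof.
move=> e; rewrite -(Zrun_mul _ _ e) //; apply: (Zrun_ext e) => // t /size0nil ->.
by rewrite mulr1.
Qed.

(** Cuts at consecutive nonempty levels agree by [cut_step]. An empty level in between separates the
    diagram into two closed ones; then both sides are 0, since in each of them the part without the
    cut evaluates to 0. *)
Lemma cut_eq D1 D2 st i : run D1 [::] = Some st -> run D2 st = Some [::] ->
  (i < size st)%N -> cut D2 st i (Zrun D1 [::] vec0) = LG11 (D1 ++ D2).
Proof.
elim/last_ind: D1 D2 st i => [|D1 x IH] D2 st i; first by case=> <-.
rewrite -cats1 run_cat; case e: (run D1 [::]) => [st1|] //=.
case e1: (apply_slice st1 x) => [st2|] //= [] ? er lt; subst st2.
rewrite (Zrun_cat _ _ e) /= -catA /=.
have inv := Zrun_invariant e; have inv' := invariant_act e1 inv.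
have er1 : run (x :: D2) st1 = Some [::] by rewrite /= e1.
rewrite (cut_level (j := 0%N) er inv') ?(leq_ltn_trans _ lt) //.
case est1: (size st1) => [|m]; last first.
  rewrite -(IH (x :: D2) st1 0%N) ?est1 // (cut_step e1 er inv) ?est1 //.
  by rewrite (leq_ltn_trans _ lt).
case: D1 IH e inv inv' => [|y D1] IH e inv inv'.
  by case: e e1 => <- /= ->.
move/size0nil: est1 => est1; subst st1.
have z : Zrun (y :: D1) [::] vec0 [::] = 0 by exact: Zrun_closed.
have zv : veq 0 (Zrun (y :: D1) [::] vec0) (fun t => 0 * vec0 t).
  by move=> t /size0nil ->; rewrite mul0r.
transitivity (0 : F11); last first.
  move: e => /=; case ey: (apply_slice [::] y) => [sy|] //= e; rewrite /LG11 /=.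
  by rewrite /cut (Zrun_cat _ _ e) Zrun_scalar // Zrun_closed // mulr0.
have e2 : run [:: x] [::] = Some st by rewrite /= e1.
have zx : veq (size st) (act x [::] (Zrun (y :: D1) [::] vec0))
    (fun t => 0 * act x [::] vec0 t).
  move=> t et; rewrite (act_ext e1 zv) //.
  exact: (Zrun_mul 0 vec0 e2).
rewrite (cut_ext _ er zx) /cut.
transitivity (Zrun D2 st (fun t => 0 * (hprod (cut_weights st 0) t *
    act x [::] vec0 t)) [::]).
  by congr (Zrun _ _ _ _); apply: funext => t; rewrite !mul0r mulr0.
by rewrite (Zrun_mul _ _ er) // mul0r.
Qed.

(** Ensures that the level just below or just above the place of a move has a strand, where the
    diagram can be cut without disturbing the move. *)
Lemma move_not_closed l r : move l r -> run l [::] <> Some [::].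
Proof.
move=> mlr e; have := run_fits e.
case: mlr e => {l r} [i k g h|i b|i b|i o|i b o|i o|i b o|i o|i o] e /=; try lia.
- move: e => /=; case e1: (apply_slice [::] _) => [s|] //= e.
  have := slice_size_out e1; case e2: (apply_slice s _) e => [s'|] //= [es].
  have := slice_size_out e2; rewrite es /=.
  by case: g e1 e2 => [b||o]; case: h => [b'||o'] //=; lia.
- move: e => /=; case e1: (apply_slice [::] _) => [s|] //= e.
  have := slice_size_out e1; case e2: (apply_slice s _) e => [s'|] //= [es].
  by have := slice_size_out e2; rewrite es /=; lia.
Qed.

Lemma LG11_move u v l r : move l r ->
  link_diagram (u ++ l ++ v) -> link_diagram (u ++ r ++ v) ->
  LG11 (u ++ l ++ v) = LG11 (u ++ r ++ v).
Proof.
rewrite /link_diagram !run_cat => mlr.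
case eu: (run u [::]) => [st|] //=; rewrite !run_cat.
case el: (run l st) => [st1|] //=; case er: (run r st) => [st2|] //= ev ev'.
have [e _] := move_Zrun vec0 mlr el er; subst st2.
have Z w : veq (size st1) (Zrun l st w) (Zrun r st w).
  by have [] := move_Zrun w mlr el er.
case: (posnP (size st)) => [/size0nil|] est; last first.
  rewrite -!(cut_eq eu _ est) ?run_cat ?el ?er //.
  by rewrite /cut (Zrun_cat _ _ el) (Zrun_cat _ _ er) (Zrun_ext ev (Z _)).
case: (posnP (size st1)) => [/size0nil|] est1; last first.
  have eul : run (u ++ l) [::] = Some st1 by rewrite run_cat eu.
  have eur : run (u ++ r) [::] = Some st1 by rewrite run_cat eu.
  rewrite !catA -(cut_eq eul ev est1) -(cut_eq eur ev est1).
  by apply: cut_ext => //; rewrite (Zrun_cat _ _ eu) (Zrun_cat _ _ eu).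
by subst st st1; case: (move_not_closed mlr el).
Qed.

Lemma LG11_isotopic D D' : isotopic D D' -> LG11 D = LG11 D'.
Proof.
elim=> {D D'} [D D' []|D|D D' _ ->|D1 D2 D3 _ -> _ ->] //.
by move=> u v l r mlr hl hr; exact: LG11_move.
Qed.

(** * The reductions of AS(n) *)

(* A linear form on a tensor power, as the tree of its values on basis vectors. *)
Inductive trie := TZ | TL of F11 | TN of trie & trie & trie & trie.

Fixpoint evalT (T : trie) (u : vec) : F11 :=
  match T with
  | TZ => 0
  | TL c => c * u [::]
  | TN a b c d => evalT a (fun s => u (X0 :: s)) + evalT b (fun s => u (X1 :: s))
                + evalT c (fun s => u (X2 :: s)) + evalT d (fun s => u (X3 :: s))
  end.

Fixpoint depthT (n : nat) (T : trie) {struct T} : bool :=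
  match T, n with
  | TZ, _ => true
  | TL _, 0 => true
  | TN a b c d, m.+1 => [&& depthT m a, depthT m b, depthT m c & depthT m d]
  | _, _ => false
  end.

(** Zero subtrees are pruned, which keeps the trees sparse. *)
Definition nodeT a b c d :=
  if (a, b, c, d) is (TZ, TZ, TZ, TZ) then TZ else TN a b c d.

Fixpoint addT (T T' : trie) : trie :=
  match T, T' with
  | TZ, _ => T'
  | _, TZ => T
  | TL c, TL c' => let e := c + c' in if e is R0 then TZ else TL e
  | TN a b c d, TN a' b' c' d' =>
      nodeT (addT a a') (addT b b') (addT c c') (addT d d')
  | _, _ => T
  end.

Fixpoint scaleT (k : F11) (T : trie) : trie :=
  match T with
  | TZ => TZ
  | TL c => TL (k * c)
  | TN a b c d => TN (scaleT k a) (scaleT k b) (scaleT k c) (scaleT k d)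
  end.

Definition childT (T : trie) (x : idx) : trie :=
  match T, x with
  | TN a _ _ _, X0 => a | TN _ b _ _, X1 => b | TN _ _ c _, X2 => c
  | TN _ _ _ d, X3 => d | _, _ => TZ
  end.

Definition singleT (x : idx) (T : trie) : trie :=
  match x with
  | X0 => TN T TZ TZ TZ | X1 => TN TZ T TZ TZ
  | X2 => TN TZ TZ T TZ | X3 => TN TZ TZ TZ T
  end.

Definition pull0T (g : piece) (st : seq bool) (T : trie) : trie :=
  match g with
  | Cup b =>
      foldr (fun x => addT (scaleT (cupw b x) (childT (childT T x) x))) TZ idx_all
  | Cap =>
      foldr (fun x => addT (singleT x (singleT x (scaleT (capw (head true st) x) T))))
        TZ idx_all
  | Cross o =>
      foldr (fun e => addT (singleT e.1.2.1 (singleT e.1.2.2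
          (scaleT e.2 (childT (childT T e.1.1.1) e.1.1.2)))))
        TZ (cross_ent (nth true st 0) (nth true st 1) o)
  end.

Fixpoint pullT (i : nat) (g : piece) (st : seq bool) (T : trie) : trie :=
  if i is j.+1 then
    let f := pullT j g (behead st) in
    if T is TN a b c d then nodeT (f a) (f b) (f c) (f d) else TZ
  else pull0T g st T.

Fixpoint pullrunT (D : diagram) (st : seq bool) (T : trie) : trie :=
  if D is x :: D' then
    pullT x.1 x.2 st (pullrunT D' (odflt [::] (apply_slice st x)) T)
  else T.

Lemma evalT_node a b c d u : evalT (nodeT a b c d) u = evalT (TN a b c d) u.
Proof.
by case: a b c d => [|?|? ? ? ?] [|?|? ? ? ?] [|?|? ? ? ?] [|?|? ? ? ?] //=;
  rewrite !addr0.
Qed.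

Lemma depthT_node n a b c d : depthT n.+1 (nodeT a b c d) =
  [&& depthT n a, depthT n b, depthT n c & depthT n d].
Proof. by case: a b c d => [|?|? ? ? ?] [|?|? ? ? ?] [|?|? ? ? ?] [|?|? ? ? ?]. Qed.

Lemma addTP n T T' u : depthT n T -> depthT n T' ->
  evalT (addT T T') u = evalT T u + evalT T' u /\ depthT n (addT T T').
Proof.
elim: T T' n u => [|k|a IHa b IHb c IHc d IHd] [|k'|a' b' c' d'] n u;
  try by rewrite /= ?add0r ?addr0.
- case: n => // _ _ /=.
  have -> : k * u [::] + k' * u [::] = (k + k') * u [::] by rewrite mulrDl.
  by case: (k + k') => //=; split=> //; exact/esym/mul0r.
- by case: n.
- by case: n.
- case: n => // n /and4P[da db dc dd] /and4P[da' db' dc' dd'].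
  rewrite [addT _ _]/= evalT_node depthT_node /=.
  have [-> ->] := IHa _ _ (fun s => u (X0 :: s)) da da'.
  have [-> ->] := IHb _ _ (fun s => u (X1 :: s)) db db'.
  have [-> ->] := IHc _ _ (fun s => u (X2 :: s)) dc dc'.
  have [-> ->] := IHd _ _ (fun s => u (X3 :: s)) dd dd'.
  by split=> //; ring.
Qed.

Lemma scaleTP n k T u : depthT n T ->
  evalT (scaleT k T) u = k * evalT T u /\ depthT n (scaleT k T).
Proof.
elim: T n u => [|c|a IHa b IHb c IHc d IHd] [|n] u //=; rewrite ?mulr0 ?mulrA //.
case/and4P=> da db dc dd.
have [-> ->] := IHa _ (fun s => u (X0 :: s)) da.
have [-> ->] := IHb _ (fun s => u (X1 :: s)) db.
have [-> ->] := IHc _ (fun s => u (X2 :: s)) dc.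
have [-> ->] := IHd _ (fun s => u (X3 :: s)) dd.
by rewrite !mulrDr.
Qed.

Lemma depthT_child n T x : depthT n.+1 T -> depthT n (childT T x).
Proof. by case: T => // a b c d /= /and4P[]; case: x. Qed.

Lemma singleTP n x T u : depthT n T ->
  evalT (singleT x T) u = evalT T (fun s => u (x :: s)) /\
  depthT n.+1 (singleT x T).
Proof. by case: x => /= ->; rewrite ?add0r ?addr0. Qed.

Lemma evalT_child n T u : depthT n.+1 T ->
  evalT T u = \sum_(x <- idx_all) evalT (childT T x) (fun s => u (x :: s)).
Proof.
by case: T => //= *; rewrite !big_cons big_nil /= ?addr0 ?addrA.
Qed.

Lemma evalT_sum n (I : Type) (r : seq I) (F : I -> trie) u :
  (forall i, depthT n (F i)) ->
  evalT (foldr (fun i => addT (F i)) TZ r) u = \sum_(i <- r) evalT (F i) u /\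
  depthT n (foldr (fun i => addT (F i)) TZ r).
Proof.
move=> h; elim: r => [|i r [IH d]] /=; first by rewrite big_nil.
by rewrite big_cons -IH; exact: addTP.
Qed.

Lemma evalT_ext n T u u' : depthT n T -> veq n u u' -> evalT T u = evalT T u'.
Proof.
elim: T n u u' => [|c|a IHa b IHb c IHc d IHd] [|n] u u' //=.
  by move=> _ ->.
case/and4P=> da db dc dd h; congr (_ + _ + _ + _).
- by apply: (IHa _ _ _ da) => t et; apply: h; rewrite /= et.
- by apply: (IHb _ _ _ db) => t et; apply: h; rewrite /= et.
- by apply: (IHc _ _ _ dc) => t et; apply: h; rewrite /= et.
- by apply: (IHd _ _ _ dd) => t et; apply: h; rewrite /= et.
Qed.

Lemma evalT_lin T l (f : seq idx -> vec) :
  evalT T (fun s => evalf l (fun s' => f s' s)) = evalf l (fun s' => evalT T (f s')).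
Proof.
elim: T f => [|c|a IHa b IHb c IHc d IHd] f /=.
- by rewrite /evalf big1 // => i _; rewrite mulr0.
- by rewrite evalf_mul.
- by rewrite IHa IHb IHc IHd /evalf -!big_split; apply: eq_bigr => i _ /=; ring.
Qed.

Lemma sum_idx_delta (x : idx) (F : idx -> F11) :
  \sum_(y <- idx_all) (if x == y then F y else 0) = F x.
Proof. by case: x; rewrite !big_cons big_nil /= ?add0r ?addr0. Qed.

Lemma evalT_child2 n T u : depthT n.+2 T ->
  evalT T u = \sum_(x <- idx_all) \sum_(y <- idx_all)
    evalT (childT (childT T x) y) (fun s => u [:: x, y & s]).
Proof.
move=> d; rewrite (evalT_child _ d); apply: eq_bigr => x _.
exact/(@evalT_child n)/depthT_child.
Qed.

Lemma act0E g st u tm tc : size tm = arity_out g ->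
  act (0%N, g) st u (tm ++ tc) = evalf (src g st tm) (fun s => u (s ++ tc)).
Proof.
by move=> e; rewrite /act /= add0n take0 !drop0 -e take_size_cat // drop_size_cat.
Qed.

Lemma pull0TP n g st T u : depthT (arity_out g + n) T ->
  evalT (pull0T g st T) u = evalT T (act (0%N, g) st u) /\
  depthT (arity_in g + n) (pull0T g st T).
Proof.
case: g => [b||o] d.
- have dx x y : depthT n (childT (childT T x) y) by do 2!apply: depthT_child.
  have [-> ->] := @evalT_sum n _ idx_all
    (fun x => scaleT (cupw b x) (childT (childT T x) x)) u
    (fun x => (scaleTP _ u (dx x x)).2).
  split=> //; rewrite (evalT_child2 _ d); apply: eq_bigr => x _.
  rewrite (scaleTP _ _ (dx x x)).1.
  pose F y := cupw b y * evalT (childT (childT T x) y) u.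
  rewrite -[LHS]/(F x) -(sum_idx_delta x F); apply: eq_bigr => y _.
  transitivity (evalT (childT (childT T x) y)
      (fun s => evalf (src (Cup b) st [:: x; y]) (fun s' => u s))).
    rewrite evalT_lin /F /=; case: eqP => [->|_]; last by rewrite evalf_nil.
    by rewrite evalf_cons evalf_nil addr0.
  apply: (evalT_ext (dx x y)) => s _.
  rewrite -[[:: x, y & s]]/([:: x; y] ++ s) act0E //=.
  by case: eqP => _; rewrite ?evalf_cons ?evalf_nil.
- have dx x : depthT n (scaleT (capw (head true st) x) T).
    exact: (scaleTP _ u d).2.
  have sP x : evalT (singleT x (singleT x (scaleT (capw (head true st) x) T))) u =
      capw (head true st) x * evalT T (fun s => u [:: x, x & s]) /\
      depthT n.+2 (singleT x (singleT x (scaleT (capw (head true st) x) T))).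
    have d1 := (singleTP x vec0 (dx x)).2.
    have [-> ->] := singleTP x u d1; split=> //.
    by rewrite (singleTP x _ (dx x)).1 (scaleTP _ _ d).1.
  have [-> ->] := @evalT_sum n.+2 _ idx_all
    (fun x => singleT x (singleT x (scaleT (capw (head true st) x) T))) u
    (fun x => (sP x).2).
  split=> //; under eq_bigr do rewrite (sP _).1.
  transitivity (evalT T (fun t => evalf (src Cap st [::]) (fun s => u (s ++ t)))).
    by rewrite evalT_lin /evalf /src big_map.
  by apply: (evalT_ext d) => t _; rewrite -[t in RHS]cat0s act0E.
- have dx x y : depthT n (childT (childT T x) y) by do 2!apply: depthT_child.
  have sP (e : (idx * idx) * (idx * idx) * F11) :
    let T' := singleT e.1.2.1 (singleT e.1.2.2
          (scaleT e.2 (childT (childT T e.1.1.1) e.1.1.2))) in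
    evalT T' u = e.2 * evalT (childT (childT T e.1.1.1) e.1.1.2)
       (fun s => u [:: e.1.2.1, e.1.2.2 & s]) /\ depthT n.+2 T'.
    move=> T'; have d0 := (scaleTP e.2 vec0 (dx e.1.1.1 e.1.1.2)).2.
    have d1 := (singleTP e.1.2.2 vec0 d0).2.
    have [-> ->] := singleTP e.1.2.1 u d1; split=> //.
    by rewrite (singleTP _ _ d0).1 (scaleTP _ _ (dx _ _)).1.
  have [-> ->] := @evalT_sum n.+2 _
    (cross_ent (nth true st 0) (nth true st 1) o) (fun e => singleT e.1.2.1
       (singleT e.1.2.2 (scaleT e.2 (childT (childT T e.1.1.1) e.1.1.2)))) u
    (fun e => (sP e).2).
  split=> //; under eq_bigr do rewrite (sP _).1.
  transitivity (\sum_(x <- idx_all) \sum_(y <- idx_all)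
     evalf (src (Cross o) st [:: x; y])
       (fun s' => evalT (childT (childT T x) y) (fun s => u (s' ++ s)))).
    rewrite /evalf /=.
    under [RHS]eq_bigr => x _ do under eq_bigr => y _ do
      rewrite big_map big_filter big_mkcond /=.
    under [RHS]eq_bigr => x _ do rewrite exchange_big /=.
    rewrite exchange_big /=; apply: eq_bigr => e _.
    pose G x y := e.2 * evalT (childT (childT T x) y)
       (fun s => u [:: e.1.2.1, e.1.2.2 & s]).
    rewrite -[LHS]/(G e.1.1.1 e.1.1.2).
    rewrite -(sum_idx_delta e.1.1.2 (G e.1.1.1)).
    rewrite -(sum_idx_delta e.1.1.1 (fun x => \sum_(y <- idx_all) _)).
    apply: eq_bigr => x _; case: eqP => [<-|ne].
      by apply: eq_bigr => y _; rewrite [e.1.1]surjective_pairing xpair_eqE eqxx.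
    rewrite big1 // => y _; rewrite [e.1.1]surjective_pairing xpair_eqE.
    by case: eqP.
  rewrite (evalT_child2 _ d); apply: eq_bigr => x _; apply: eq_bigr => y _.
  rewrite -evalT_lin; apply: (evalT_ext (dx x y)) => s _.
  by rewrite -[[:: x, y & s]]/([:: x; y] ++ s) act0E.
Qed.

Lemma pullTP i n g st T u : depthT (i + (arity_out g + n)) T ->
  evalT (pullT i g st T) u = evalT T (act (i, g) st u) /\
  depthT (i + (arity_in g + n)) (pullT i g st T).
Proof.
elim: i st T u => [|i IH] st T u; first exact: pull0TP.
have actS x s : act (i.+1, g) st u (x :: s) =
    act (i, g) (behead st) (fun s => u (x :: s)) s.
  by rewrite /act /=; case: st => //=; rewrite !drop_oversize.
case: T => // a b c d; rewrite !addSn => /and4P[da db dc dd] /=.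
rewrite evalT_node depthT_node /=.
have [-> ->] := IH (behead st) _ (fun s => u (X0 :: s)) da.
have [-> ->] := IH (behead st) _ (fun s => u (X1 :: s)) db.
have [-> ->] := IH (behead st) _ (fun s => u (X2 :: s)) dc.
have [-> ->] := IH (behead st) _ (fun s => u (X3 :: s)) dd.
split=> //; congr (_ + _ + _ + _).
- by apply: (evalT_ext da) => s _; rewrite actS.
- by apply: (evalT_ext db) => s _; rewrite actS.
- by apply: (evalT_ext dc) => s _; rewrite actS.
- by apply: (evalT_ext dd) => s _; rewrite actS.
Qed.

(** Correctness of the efficient form of [pull]: like terms are merged at every slice, so the size
    is governed by the number of words and not by the number of paths through the diagram. *)
Lemma pullrunTP D st st' T u : run D st = Some st' -> depthT (size st') T ->
  evalT (pullrunT D st T) u = evalT T (Zrun D st u) /\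
  depthT (size st) (pullrunT D st T).
Proof.
elim: D st u => [|[i g] D IH] st u /=; first by case=> ->.
case e: (apply_slice st (i, g)) => [st1|] //= er d.
have [<- d1] := IH st1 (act (i, g) st u) er d.
have le := slice_size e; have eo := slice_size_out e.
have := @pullTP i (size st - (i + arity_in g)) g st _ u.
have -> : (i + (arity_out g + (size st - (i + arity_in g))) = size st1)%N by lia.
have -> : (i + (arity_in g + (size st - (i + arity_in g))) = size st)%N by lia.
exact.
Qed.

(** * Transfer matrices of box tangles *)

Definition deltav (s : seq idx) : vec := fun t => if t == s then 1 else 0.

Definition op2 : Type := idx -> idx -> idx -> idx -> F11.

(* The matrix of a tangle from [:: true; false] to itself: M a b c d is the   *)
(* coefficient of the basis vector (c, d) in the image of (a, b).             *)
Definition box_mx (f : diagram) : op2 := fun a b c d =>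
  Zrun f [:: true; false] (deltav [:: a; b]) [:: c; d].

Definition op2_table (M : op2) : seq (seq (seq (seq F11))) :=
  [seq [seq [seq [seq M a b c d | d <- idx_all] | c <- idx_all]
       | b <- idx_all] | a <- idx_all].

Definition op2_of (t : seq (seq (seq (seq F11)))) : op2 := fun a b c d =>
  nth 0 (nth [::] (nth [::] (nth [::] t (idx_nat a)) (idx_nat b)) (idx_nat c))
    (idx_nat d).

Lemma op2_tableK M a b c d : op2_of (op2_table M) a b c d = M a b c d.
Proof. by case: a; case: b; case: c; case: d. Qed.

Definition box_tries (f : diagram) : seq (seq trie) :=
  [seq [seq pullrunT f [:: true; false] (singleT c (singleT d (TL 1)))
       | d <- idx_all] | c <- idx_all].

Definition leafT (T : trie) : F11 := if T is TL x then x else 0.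

Definition tries_mx (l : seq (seq trie)) : op2 := fun a b c d =>
  leafT (childT (childT (nth TZ (nth [::] l (idx_nat c)) (idx_nat d)) a) b).

Definition TT_tries (eps : bool) : seq (seq trie) := Eval vm_compute in
  if eps then box_tries (TT true) else box_tries (TT false).

Lemma TT_triesE eps : TT_tries eps = box_tries (TT eps).
Proof. by case: eps; vm_compute. Qed.

Lemma leafTP T a b : depthT 2 T ->
  evalT T (deltav [:: a; b]) = leafT (childT (childT T a) b).
Proof.
have z T' (u : vec) : (forall s, u s = 0) -> evalT T' u = 0.
  elim: T' u => [|c|? IHa ? IHb ? IHc ? IHd] u h //=; first by rewrite h mulr0.
  by rewrite IHa ?IHb ?IHc ?IHd ?addr0 // => s; apply: h.
move=> d; rewrite (evalT_child2 _ d).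
have d2 x y : depthT 0 (childT (childT T x) y) by do 2!apply: depthT_child.
rewrite -(sum_idx_delta a (fun x => leafT (childT (childT T x) b))).
apply: eq_bigr => x _; case: (eqVneq a x) => [<-|/negbTE ne]; last first.
  rewrite big1 // => y _; apply: z => s; rewrite /deltav.
  by case: ifP => // /eqP[e _]; rewrite e eqxx in ne.
rewrite -(sum_idx_delta b (fun y => leafT (childT (childT T a) y))).
apply: eq_bigr => y _; case: (eqVneq b y) => [<-|/negbTE ne]; last first.
  apply: z => s; rewrite /deltav.
  by case: ifP => // /eqP[e _]; rewrite e eqxx in ne.
case: (childT (childT T a) b) (d2 a b) => //= c _.
by rewrite /deltav eqxx mulr1.
Qed.

Lemma box_mxE f a b c d : box_tangle f ->
  box_mx f a b c d = tries_mx (box_tries f) a b c d.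
Proof.
move=> bf; pose T := singleT c (singleT d (TL 1)).
have dT : depthT 2 T by rewrite /T; case: (c); case: (d).
have [e1 e2] := pullrunTP (deltav [:: a; b]) bf dT.
transitivity (evalT T (Zrun f [:: true; false] (deltav [:: a; b]))).
  by rewrite /T /box_mx; case: (c); case: (d); rewrite /= ?addr0 ?add0r mul1r.
rewrite -e1 (leafTP _ _ e2) /T /tries_mx /box_tries.
by case: (c); case: (d).
Qed.

(** A product of 16 by 16 matrices, with [(a, c)] as row and [(b, d)] as column index. The letters
    [m] and [t] sit on the lower and upper connecting arcs, and [muV11 m] is the weight of the lower
    one. The test for [R0] only saves evaluations of [N]. *)
Definition hmul (M N : op2) : op2 := fun a b c d =>
  foldr (fun m r => foldr (fun t r' =>
     (if M a m c t is R0 then 0 else muV11 m * M a m c t * N m b t d) + r')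
    0 idx_all + r) 0 idx_all.

Lemma hmulE M N a b c d : hmul M N a b c d =
  \sum_(m <- idx_all) \sum_(t <- idx_all) muV11 m * M a m c t * N m b t d.
Proof.
rewrite /hmul !big_cons !big_nil /=.
have h x y z : (if x is R0 then 0 else y * x * z) = y * x * z :> F11.
  by case: x => //; rewrite -[R0]/(0 : F11) mulr0 mul0r.
by rewrite !h.
Qed.

Lemma sum_words2 (F : seq idx -> F11) : \sum_(s <- words idx_all 2) F s =
  \sum_(a <- idx_all) \sum_(b <- idx_all) F [:: a; b].
Proof. by rewrite /= !big_cons !big_nil !addr0 !addrA. Qed.

Lemma Zrun_box f u c d : box_tangle f ->
  Zrun f [:: true; false] u [:: c; d] =
  \sum_(a <- idx_all) \sum_(b <- idx_all) u [:: a; b] * box_mx f a b c d.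
Proof.
move=> bf; pose r : lform := [seq (s, u s) | s <- words idx_all 2].
transitivity (Zrun f [:: true; false]
    (fun t => evalf r (fun s => deltav s t)) [:: c; d]).
  apply: (Zrun_ext bf) => // -[|x [|y [|]]] // _.
  rewrite /evalf big_map /= sum_words2.
  rewrite -(sum_idx_delta x (fun a => u [:: a; y])); apply: eq_bigr => a _.
  case: (eqVneq x a) => [<-|/negbTE ne]; last first.
    by rewrite big1 // => b _; rewrite /deltav eqseq_cons ne /= mulr0.
  rewrite -(sum_idx_delta y (fun b => u [:: x; b])); apply: eq_bigr => b _.
  rewrite /deltav !eqseq_cons eqxx andbT /=.
  by case: eqP => _; rewrite ?mulr1 ?mulr0.
by rewrite (Zrun_lin _ _ bf) // /evalf big_map sum_words2.
Qed.

Lemma hbox_mx f g a b c d : box_tangle f -> box_tangle g ->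
  box_mx (hbox f g) a b c d = hmul (box_mx f) (box_mx g) a b c d.
Proof.
move=> bf bg; pose st4 := [:: true; false; true; false].
have ef : run f st4 = Some st4.
  by have := run_frame [::] [:: true; false] bf; rewrite shift0.
have eg : run (shift 2 g) st4 = Some st4.
  exact: (run_frame [:: true; false] [::] bg).
rewrite /box_mx /hbox (@Zrun_cat _ _ _ st4) // (Zrun_cat _ _ ef) (Zrun_cat _ _ eg).
set w := Zrun [:: (1, Cup false)]%N _ _.
have wE x y z t : w [:: x; y; z; t] =
    if z == y then (if b == t then (if a == x then muV11 z else 0) else 0) else 0.
  rewrite /w /= /act /= [y == z]eq_sym; case: eqP => [->|_]; last by rewrite evalf_nil.
  rewrite evalf_cons evalf_nil addr0 /deltav /= !eqseq_cons andbT.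
  rewrite [x == a]eq_sym [t == b]eq_sym andbC.
  by case: (b == t); case: (a == x); rewrite /= ?mulr1 ?mulr0.
have capE v : Zrun [:: (1, Cap)]%N st4 v [:: c; d] =
    \sum_(t <- idx_all) v [:: c; t; t; d].
  by rewrite /= /act /= !evalf_cons evalf_nil !big_cons big_nil /= !mul1r.
have fE x y t : Zrun f st4 w [:: c; t; x; y] =
    if b == y then muV11 x * box_mx f a x c t else 0.
  have := @Zrun_frame [::] [:: true; false] [:: true; false] f _ w
    [::] [:: c; t] [:: x; y] bf.
  rewrite shift0 => -> //; rewrite (Zrun_box _ _ _ bf).
  rewrite -(sum_idx_delta a
    (fun p => if b == y then muV11 x * box_mx f p x c t else 0)).
  apply: eq_bigr => p _ /=; case: (eqVneq a p) => [<-|/negbTE ne]; last first.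
    by rewrite big1 // => q _; rewrite wE ne; do 2?[case: ifP => _]; rewrite mul0r.
  rewrite -(sum_idx_delta x
    (fun q => if b == y then muV11 x * box_mx f a q c t else 0)).
  apply: eq_bigr => q _; rewrite wE eqxx.
  by case: eqP => _; rewrite ?mul0r //; case: eqP => _; rewrite ?mul0r.
rewrite capE hmulE [RHS]exchange_big /=; apply: eq_bigr => t _.
have := @Zrun_frame [:: true; false] [:: true; false] [::] g _ (Zrun f st4 w)
  [:: c; t] [:: t; d] [::] bg.
move=> /(_ erefl erefl) /= ->; rewrite (Zrun_box _ _ _ bg); apply: eq_bigr => x _.
rewrite -(sum_idx_delta b (fun y => muV11 x * box_mx f a x c t * box_mx g x y t d)).
apply: eq_bigr => y _; rewrite /= fE.
by case: eqP => _; rewrite ?mul0r.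
Qed.

Definition B1 := Eval vm_compute in
  op2_table (hmul (tries_mx (TT_tries true)) (tries_mx (TT_tries false))).

Definition B2 := Eval vm_compute in op2_table (hmul (op2_of B1) (op2_of B1)).

Lemma B1E : B1 =
  op2_table (hmul (tries_mx (TT_tries true)) (tries_mx (TT_tries false))).
Proof. by vm_compute. Qed.

Lemma B2E : B2 = op2_table (hmul (op2_of B1) (op2_of B1)).
Proof. by vm_compute. Qed.

(* The reason why the values of AS(n) are constant from n = 2 on. *)
Lemma B3E : B2 = op2_table (hmul (op2_of B1) (op2_of B2)).
Proof. by vm_compute. Qed.

Lemma eq_hmul M M' N N' a b c d :
  (forall a b c d, M a b c d = M' a b c d) ->
  (forall a b c d, N a b c d = N' a b c d) -> hmul M N a b c d = hmul M' N' a b c d.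
Proof.
move=> eM eN; rewrite !hmulE; apply: eq_bigr => m _; apply: eq_bigr => t _.
by rewrite eM eN.
Qed.

Notation TTbox := (hbox (TT true) (TT false)).

Lemma TTbox_tangle : box_tangle TTbox.
Proof. exact: (hbox_tangle (TT_tangle _) (TT_tangle _)). Qed.

Lemma TTbox_mx a b c d : box_mx TTbox a b c d = op2_of B1 a b c d.
Proof.
rewrite hbox_mx; [|exact: TT_tangle..].
rewrite B1E op2_tableK; apply: eq_hmul => *;
  by rewrite TT_triesE box_mxE //; exact: TT_tangle.
Qed.

Lemma hpow_tangle n : box_tangle (hpow TTbox n).
Proof.
case: n => // n; rewrite /hpow iteropS; elim: n => [|n IH] /=;
  [exact: TTbox_tangle | exact: (hbox_tangle TTbox_tangle IH)].
Qed.

Lemma hpow_mx n a b c d : box_mx (hpow TTbox n.+2) a b c d = op2_of B2 a b c d.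
Proof.
elim: n a b c d => [|n IH] a b c d.
  rewrite [hpow _ _]/(hbox TTbox TTbox) hbox_mx; [|exact: TTbox_tangle..].
  by rewrite B2E op2_tableK; apply: eq_hmul => *; exact: TTbox_mx.
rewrite [hpow _ _]/(hbox TTbox (hpow TTbox n.+2)) hbox_mx; last first.
- exact: hpow_tangle.
- exact: TTbox_tangle.
by rewrite B3E op2_tableK; apply: eq_hmul => *; [exact: TTbox_mx | exact: IH].
Qed.

Lemma evalfE l u : evalf l u = foldr (fun e r => e.2 * u e.1 + r) 0 l.
Proof. by elim: l => [|e l IH]; rewrite ?evalf_nil // evalf_cons IH. Qed.

(** * Closing the box up to AS(n) *)

Definition AS_levels := [:: true; true; false; false].

Definition AS_bottom : diagram := [:: (0, Cup true); (1, Cup true)]%N ++ encircle.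

Definition AS_top : diagram := [:: (1, Cross true); (0, Cap); (0, Cap)]%N.

Definition AS_weight (t : seq idx) : F11 :=
  hprod (cut_weights AS_levels 0) t *
  foldr (fun e r => e.2 * (if e.1 is [::] then 1 else 0) + r) 0
    (pull AS_bottom [::] t).

(** The value of the link as a linear function of the matrix of the box: the vector made by the part
    below, weighted by the cut, paired with the form given by the part above. *)
Definition AS_closure (M : op2) : F11 :=
  foldr (fun e r => e.2 * (if e.1 is [:: x; c; d; y] then
    foldr (fun a r => foldr (fun b r =>
      AS_weight [:: x; a; b; y] * M a b c d + r) 0 idx_all + r) 0 idx_all
    else 0) + r) 0 (pull AS_top AS_levels [::]).

Arguments AS_weight t : simpl never.

Lemma AS_weightE t :
  hprod (cut_weights AS_levels 0) t * Zrun AS_bottom [::] vec0 t = AS_weight t.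
Proof.
rewrite pullE evalfE /AS_weight; congr (_ * _).
by elim: (pull _ _ _) => [|[[|x s] c] l IH] //; rewrite [LHS]/= IH.
Qed.

Lemma AS_pull_size :
  all (fun e => size e.1 == 4) (pull AS_top AS_levels [::]).
Proof. by vm_compute. Qed.

Lemma run_AS_bottom : run AS_bottom [::] = Some AS_levels.
Proof. by vm_compute. Qed.

Lemma run_AS_top : run AS_top AS_levels = Some [::].
Proof. by vm_compute. Qed.

Lemma AS_closureP n : LG11 (AS n) = AS_closure (box_mx (hpow TTbox n)).
Proof.
set f := hpow _ n; have bf : box_tangle f := hpow_tangle n.
have ef : run (shift 1 f) AS_levels = Some AS_levels.
  exact: (run_frame [:: true] [:: false] bf).
have -> : AS n = AS_bottom ++ (shift 1 f ++ AS_top) by rewrite /AS catA.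
have er : run (shift 1 f ++ AS_top) AS_levels = Some [::].
  by rewrite run_cat ef; exact: run_AS_top.
rewrite -(@cut_eq _ _ AS_levels 0%N run_AS_bottom er) // /cut (Zrun_cat _ _ ef).
rewrite (funext AS_weightE) pullE evalfE /AS_closure.
elim: (pull _ _ _) AS_pull_size => // -[t k] l IH; rewrite [all _ _]/=.
move=> /andP[/eqP et /IH {}IH]; rewrite [LHS]/= [RHS]/= {}IH.
congr (_ * _ + _).
case: t et => [|x [|c [|d [|y [|]]]]] // _.
have := @Zrun_frame [:: true] [:: true; false] [:: false] f _ AS_weight
  [:: x] [:: c; d] [:: y] bf.
move=> /(_ erefl erefl) e; rewrite [LHS]e (Zrun_box _ _ _ bf).
by rewrite !big_cons !big_nil.
Qed.

Lemma eq_AS_closure M M' : (forall a b c d, M a b c d = M' a b c d) ->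
  AS_closure M = AS_closure M'.
Proof. by move=> e; congr AS_closure; do 4![apply: funext => ?]. Qed.

Lemma LG11_AS1 : LG11 (AS 1) = R4.
Proof.
rewrite AS_closureP (eq_AS_closure (M' := op2_of B1)); first by vm_compute.
exact: TTbox_mx.
Qed.

Lemma LG11_AS n : LG11 (AS n.+2) = R8.
Proof.
rewrite AS_closureP (eq_AS_closure (M' := op2_of B2)); first by vm_compute.
exact: hpow_mx.
Qed.

(** * Reduction of Laurent polynomials *)

(** In [{poly {poly int}}] the outer variable is [s] and the inner one is [q]. This embedding and
    the evaluation [Zqs_ev] are the two sides of the reduction. *)
Definition Zqs_num : {rmorphism {poly {poly int}} -> {fraction {poly {poly rat}}}} :=
  @tofrac {poly {poly rat}} \o map_poly (map_poly (intr : int -> rat)).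

Definition Zqs_ev : {rmorphism {poly {poly int}} -> F11} :=
  horner_eval (R5 : F11) \o
  map_poly (horner_eval (R4 : F11) \o map_poly (intr : int -> F11)).

Lemma Zqs_num_inj : injective Zqs_num.
Proof.
have inj0 : injective (intr : int -> rat) by exact: intr_inj.
have inj1 : injective (map_poly (intr : int -> rat)).
  exact: (map_inj_poly inj0 (rmorph0 _)).
move=> a b /eqP; rewrite /= tofrac_eq => /eqP.
exact: (map_inj_poly inj1 (rmorph0 _)).
Qed.

Lemma Zqs_numX : Zqs_num 'X = s_.
Proof. by rewrite /= map_polyX. Qed.

Lemma Zqs_numC : Zqs_num ('X%:P) = q_.
Proof. by rewrite /= map_polyC /= map_polyX. Qed.

Lemma Zqs_evX : Zqs_ev 'X = R5.
Proof. by rewrite /= map_polyX /horner_eval hornerX. Qed.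

Lemma Zqs_evC : Zqs_ev ('X%:P) = R4.
Proof. by rewrite /= map_polyC /= map_polyX /horner_eval hornerC hornerX. Qed.

Lemma q_neq0 : q_ != 0.
Proof. by rewrite /q_ tofrac_eq0 polyC_eq0 polyX_eq0. Qed.

Lemma s_neq0 : s_ != 0.
Proof. by rewrite /s_ tofrac_eq0 polyX_eq0. Qed.

(* x lies in Z[q, 1/q, s, 1/s] and takes the value y for q = 4, s = 5, where  *)
(* qs = 9.                                                                    *)
Definition spec (x : Qqs) (y : F11) : Prop :=
  exists (a : {poly {poly int}}) (n : nat),
    Zqs_num a = x * (q_ * s_) ^+ n /\ Zqs_ev a = y * R9 ^+ n.

Lemma F11_R9K n : (R9 : F11) ^+ n * R5 ^+ n = 1.
Proof. by rewrite -exprMn -[R9 * R5]/(1 : F11) expr1n. Qed.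

Lemma Zqs_num_qs n : Zqs_num (('X%:P * 'X) ^+ n) = (q_ * s_) ^+ n.
Proof. by rewrite rmorphXn rmorphM Zqs_numC Zqs_numX. Qed.

Lemma Zqs_ev_qs n : Zqs_ev (('X%:P * 'X) ^+ n) = R9 ^+ n.
Proof. by rewrite rmorphXn rmorphM Zqs_evC Zqs_evX. Qed.

(** Clearing the powers of [q s] gives an identity between integral polynomials, as [Zqs_num] is
    injective; it is then evaluated, and the powers of 9 are cancelled by those of its inverse 5. *)
Lemma spec_inj x y y' : spec x y -> spec x y' -> y = y'.
Proof.
move=> [a [n [an ae]]] [a' [n' [an' ae']]].
have e : a * ('X%:P * 'X) ^+ n' = a' * ('X%:P * 'X) ^+ n.
  by apply: Zqs_num_inj; rewrite !(rmorphM Zqs_num) !Zqs_num_qs an an' mulrAC.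
have := congr1 Zqs_ev e; rewrite !(rmorphM Zqs_ev) !Zqs_ev_qs ae ae'.
rewrite [RHS]mulrAC => /(congr1 (fun z => z * R5 ^+ n' * R5 ^+ n)).
rewrite -!(mulrA _ (R9 ^+ n')) -!(mulrA _ (R9 ^+ n)).
have h (z : F11) k l : z * R9 ^+ k * R9 ^+ l * R5 ^+ l * R5 ^+ k = z.
  by rewrite -(mulrA _ (R9 ^+ l)) F11_R9K mulr1 -mulrA F11_R9K mulr1.
by rewrite !mulrA !h.
Qed.

Lemma spec_neq0 x y : spec x y -> y != 0 -> x != 0.
Proof.
move=> h; apply: contraNneq => x0; apply/eqP/(spec_inj h).
by exists 0, 0%N; rewrite x0 !rmorph0 !mul0r.
Qed.

Lemma spec0 : spec 0 0.
Proof. by exists 0, 0%N; rewrite !rmorph0 !mul0r. Qed.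

Lemma spec1 : spec 1 1.
Proof. by exists 1, 0%N; rewrite !rmorph1 !mul1r !expr0. Qed.

Lemma specN x y : spec x y -> spec (- x) (- y).
Proof.
by move=> [a [n [an ae]]]; exists (- a), n; rewrite !rmorphN an ae !mulNr.
Qed.

Lemma specM x y x' y' : spec x y -> spec x' y' -> spec (x * x') (y * y').
Proof.
move=> [a [n [an ae]]] [a' [n' [an' ae']]]; exists (a * a'), (n + n')%N.
rewrite (rmorphM Zqs_num) (rmorphM Zqs_ev) an ae an' ae' !exprD.
by split; rewrite mulrACA.
Qed.

Lemma specD x y x' y' : spec x y -> spec x' y' -> spec (x + x') (y + y').
Proof.
move=> [a [n [an ae]]] [a' [n' [an' ae']]].
exists (a * ('X%:P * 'X) ^+ n' + a' * ('X%:P * 'X) ^+ n), (n + n')%N.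
rewrite (rmorphD Zqs_num) (rmorphD Zqs_ev) !(rmorphM Zqs_num) !(rmorphM Zqs_ev).
rewrite !Zqs_num_qs !Zqs_ev_qs an ae an' ae' !exprD !mulrDl -!mulrA.
by split; congr (_ + _ * _); rewrite mulrC.
Qed.

Lemma specB x y x' y' : spec x y -> spec x' y' -> spec (x - x') (y - y').
Proof. by move=> h /specN; exact: specD. Qed.

Lemma specX x y n : spec x y -> spec (x ^+ n) (y ^+ n).
Proof.
move=> h; elim: n => [|n IH]; first by rewrite !expr0; exact: spec1.
by rewrite !exprS; exact: specM.
Qed.

Lemma spec_q : spec q_ R4.
Proof. by exists 'X%:P, 0%N; rewrite Zqs_numC Zqs_evC !mulr1. Qed.

Lemma spec_s : spec s_ R5.
Proof. by exists 'X, 0%N; rewrite Zqs_numX Zqs_evX !mulr1. Qed.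

Lemma spec_qV : spec q_^-1 R3.
(* The inverse of [q] is [s / (q s)]. *)
Proof. by exists 'X, 1%N; rewrite Zqs_numX Zqs_evX mulKf ?q_neq0. Qed.

Lemma spec_sV : spec s_^-1 R9.
Proof.
by exists 'X%:P, 1%N; rewrite Zqs_numC Zqs_evC [q_ * s_]mulrC mulKf ?s_neq0.
Qed.

Lemma spec_sum (I : Type) (r : seq I) (P : pred I) F G :
  (forall i, P i -> spec (F i) (G i)) ->
  spec (\sum_(i <- r | P i) F i) (\sum_(i <- r | P i) G i).
Proof. by move=> h; apply: big_rec2 => [|i y x /h]; [exact: spec0|exact: specD]. Qed.

Lemma spec_prod (I : Type) (r : seq I) (P : pred I) F G :
  (forall i, P i -> spec (F i) (G i)) ->
  spec (\prod_(i <- r | P i) F i) (\prod_(i <- r | P i) G i).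
Proof. by move=> h; apply: big_rec2 => [|i y x /h]; [exact: spec1|exact: specM]. Qed.

Lemma spec_zpow x x' y y' a : spec x y -> spec x' y' ->
  spec (zpow x x' a) (zpow y y' a).
Proof. by move=> h h'; case: a => n; exact: specX. Qed.

Definition laurent_qs : seq (bool * int * int) -> Qqs :=
  laurent q_ q_^-1 s_ s_^-1.

Lemma spec_laurent l : spec (laurent_qs l) (spec11 l).
Proof.
elim: l => [|m l IH] /=; first exact: spec0.
apply: (specD _ IH); apply: specM; first apply: specM.
- exact/specX/specN/spec1.
- exact: spec_zpow spec_q spec_qV.
- exact: spec_zpow spec_s spec_sV.
Qed.

(** * The matrix of sigma *)

Definition code : Type := seq (bool * int * int).

Definition mon_mul (m m' : bool * int * int) : bool * int * int :=
  (m.1.1 (+) m'.1.1, m.1.2 + m'.1.2, m.2 + m'.2).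

Definition code_mul (l l' : code) : code := [seq mon_mul m m' | m <- l, m' <- l'].

Definition code_opp (l : code) : code := [seq (~~ m.1.1, m.1.2, m.2) | m <- l].

(** Vanishing is tested by counting: every pair of exponents must occur equally often with either
    sign. The lists are never brought to a normal form. *)
Definition code_zero (l : code) : bool :=
  all (fun m => count_mem (false, m.1.2, m.2) l == count_mem (true, m.1.2, m.2) l) l.

Section Laurent.

Variables (F : fieldType) (q s : F).
Hypotheses (q0 : q != 0) (s0 : s != 0).

Definition lau : code -> F := laurent q q^-1 s s^-1.

Definition mon (m : bool * int * int) : F :=
  (-1) ^+ (m.1.1 : bool) * (q ^ m.1.2 * s ^ m.2).

Lemma zpowE (x : F) a : zpow x x^-1 a = x ^ a.
Proof. by case: a => n //=; rewrite exprVn. Qed.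

Lemma lauE l : lau l = \sum_(m <- l) mon m.
Proof.
elim: l => [|m l IH]; first by rewrite big_nil.
by rewrite big_cons -IH /lau /= !zpowE /mon mulrA.
Qed.

Lemma lau_cat l l' : lau (l ++ l') = lau l + lau l'.
Proof. by rewrite !lauE big_cat. Qed.

Lemma monM m m' : mon (mon_mul m m') = mon m * mon m'.
Proof.
rewrite /mon /= signr_addb !expfzDr //.
by rewrite [RHS]mulrACA; congr (_ * _); rewrite mulrACA.
Qed.

Lemma lau_mul l l' : lau (code_mul l l') = lau l * lau l'.
Proof.
rewrite !lauE /code_mul big_allpairs_dep mulr_suml; apply: eq_bigr => m _.
by rewrite mulr_sumr; apply: eq_bigr => m' _; exact: monM.
Qed.

Lemma lau_opp l : lau (code_opp l) = - lau l.
Proof.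
rewrite !lauE big_map -sumrN; apply: eq_bigr => m _.
by rewrite /mon /= signrN mulNr.
Qed.

Lemma code_zeroP l : code_zero l -> lau l = 0.
Proof.
pose cf (l : code) (k : int * int) : F :=
  (count_mem (false, k.1, k.2) l)%:R - (count_mem (true, k.1, k.2) l)%:R.
have E ks l' : uniq ks -> {subset [seq (m.1.2, m.2) | m <- l'] <= ks} ->
    lau l' = \sum_(k <- ks) cf l' k * (q ^ k.1 * s ^ k.2).
  move=> uks; elim: l' => [|m l' IH] sub.
    by rewrite big1 // => k _; rewrite /cf subrr mul0r.
  have mk : (m.1.2, m.2) \in ks by apply: sub; rewrite inE eqxx.
  rewrite lauE big_cons -lauE IH; last first.
    by move=> k kl; apply: sub; rewrite inE kl orbT.
  rewrite !(bigD1_seq (m.1.2, m.2)) //= addrA; congr (_ + _).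
    rewrite /mon -mulrDl; congr (_ * _); rewrite /cf /=.
    case: m {sub mk} => [[[] a] b] /=; rewrite !xpair_eqE !eqxx /= add1n add0n.
      by rewrite expr1 -[in RHS]addn1 natrD; ring.
    by rewrite expr0 -[in RHS]addn1 natrD; ring.
  apply: eq_bigr => k /negbTE ne; congr (_ * _); rewrite /cf /=.
  have ne' b : (m == (b, k.1, k.2)) = false.
    apply: contraFF ne => /eqP ->; exact/eqP/surjective_pairing.
  by rewrite !ne'.
move=> /allP h; rewrite (E _ _ (undup_uniq [seq (m.1.2, m.2) | m <- l])).
  rewrite big_seq big1 // => k; rewrite mem_undup => /mapP[m ml ->].
  by rewrite /cf /= (eqP (h _ ml)) subrr mul0r.
by move=> k; rewrite mem_undup.
Qed.

End Laurent.

Lemma idx_lt x : (idx_nat x < 4)%N. Proof. by case: x. Qed.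

Definition ord_of_idx (x : idx) : 'I_4 := Ordinal (idx_lt x).

Definition idx_of_ord (i : 'I_4) : idx := nth X0 idx_all i.

Lemma ord_of_idxK : cancel ord_of_idx idx_of_ord. Proof. by case. Qed.

Lemma idx_of_ordK : cancel idx_of_ord ord_of_idx.
Proof. by case=> [[|[|[|[|//]]]] p]; apply/val_inj. Qed.

Definition pos (z : idx * idx) : 'I_(4 * 4) :=
  mxtens_index (ord_of_idx z.1, ord_of_idx z.2).

Definition pos_inv (i : 'I_(4 * 4)) : idx * idx :=
  (idx_of_ord (mxtens_unindex i).1, idx_of_ord (mxtens_unindex i).2).

Lemma posK : cancel pos pos_inv.
Proof. by case=> x y; rewrite /pos_inv /pos mxtens_indexK /= !ord_of_idxK. Qed.

Lemma pos_invK : cancel pos_inv pos.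
Proof.
move=> i; case: (mxtens_indexP i) => a b.
by rewrite /pos /pos_inv mxtens_indexK /= !idx_of_ordK.
Qed.

(** * Sparse matrices with Laurent coefficients *)

Definition ent_opp (E : entries code) : entries code :=
  [seq (e.1, code_opp e.2) | e <- E].

Definition ent_comp (E E' : entries code) : entries code :=
  flatten [seq [seq ((e.1.1, e'.1.2), code_mul e.2 e'.2)
               | e' <- E' & e.1.2 == e'.1.1] | e <- E].

Definition ent_zero (E : entries code) : bool :=
  all (fun e => code_zero (flatten [seq e'.2 | e' <- E & e'.1 == e.1])) E.

Definition ent_tens (A B : seq (idx * idx * code)) : entries code :=
  [seq ((a.1.1, b.1.1), (a.1.2, b.1.2), code_mul a.2 b.2) | a <- A, b <- B].

Section Entries.

Variables (F : fieldType) (q s : F).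
Hypotheses (q0 : q != 0) (s0 : s != 0).
Notation lau := (lau q s).

Definition mat (E : entries code) : 'M[F]_(4 * 4) :=
  \matrix_(i, j) \sum_(e <- E | e.1 == (pos_inv i, pos_inv j)) lau e.2.

Definition mat1 (A : seq (idx * idx * code)) : 'M[F]_4 :=
  \matrix_(i, j) \sum_(e <- A | e.1 == (idx_of_ord i, idx_of_ord j)) lau e.2.

Lemma mat_cat E E' : mat (E ++ E') = mat E + mat E'.
Proof. by apply/matrixP => i j; rewrite !mxE big_cat. Qed.

Lemma mat_opp E : mat (ent_opp E) = - mat E.
Proof.
apply/matrixP => i j; rewrite !mxE big_map -sumrN; apply: eq_bigr => e _.
exact: lau_opp.
Qed.

Lemma mat_comp E E' : mat (ent_comp E E') = mat E *m mat E'.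
Proof.
apply/matrixP => i j; rewrite !mxE /ent_comp.
under [RHS]eq_bigr do rewrite !mxE.
rewrite big_flatten big_map /=.
under eq_bigr => e _ do rewrite big_map big_filter_cond /=.
transitivity (\sum_(e <- E) \sum_(e' <- E') \sum_(k < 4 * 4)
   (if e.1 == (pos_inv i, pos_inv k) then lau e.2 else 0) *
   (if e'.1 == (pos_inv k, pos_inv j) then lau e'.2 else 0)); last first.
  under [LHS]eq_bigr => e _ do rewrite exchange_big /=.
  rewrite exchange_big /=; apply: eq_bigr => k _.
  rewrite [in RHS]big_mkcond [X in _ = _ * X]big_mkcond mulr_suml.
  by apply: eq_bigr => e _; rewrite mulr_sumr.
apply: eq_bigr => -[[o z] c] _; rewrite big_mkcond /=.
apply: eq_bigr => -[[z' o'] c'] _ /=.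
rewrite (bigD1 (pos z)) //= big1 => [|k ne]; last first.
  rewrite xpair_eqE; case: (eqVneq z (pos_inv k)) => [e|_].
    by rewrite e pos_invK eqxx in ne.
  by rewrite andbF mul0r.
rewrite addr0 posK !xpair_eqE eqxx andbT [z' == z]eq_sym lau_mul //.
by case: (z == z'); case: (o == _); case: (o' == _); rewrite /= ?mulr0 ?mul0r.
Qed.

Lemma lau_flatten (T : Type) (r : seq T) (f : T -> code) :
  lau (flatten [seq f e | e <- r]) = \sum_(e <- r) lau (f e).
Proof.
elim: r => [|e r IH] /=; first by rewrite big_nil.
by rewrite lau_cat IH big_cons.
Qed.

Lemma mat_zero E : ent_zero E -> mat E = 0.
Proof.
move=> /allP h; apply/matrixP => i j; rewrite !mxE -big_filter.
case e: [seq _ <- E | _] => [|x r]; first by rewrite big_nil.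
have: x \in [seq x <- E | x.1 == (pos_inv i, pos_inv j)] by rewrite e inE eqxx.
rewrite mem_filter => /andP[/eqP ex xE]; rewrite -e -lau_flatten.
by apply: code_zeroP => //; rewrite -ex; exact: h.
Qed.

Lemma mat_eq E E' : ent_zero (E ++ ent_opp E') -> mat E = mat E'.
Proof.
by move=> /mat_zero; rewrite mat_cat mat_opp => /eqP; rewrite subr_eq0 => /eqP.
Qed.

Lemma mat_tens A B : mat (ent_tens A B) = mat1 A *t mat1 B.
Proof.
apply/matrixP => i j; rewrite !mxE /ent_tens big_mkcond big_allpairs_dep /=.
rewrite [X in _ = X * _]big_mkcond [X in _ = _ * X]big_mkcond mulr_suml.
apply: eq_bigr => -[[o z] c] _; rewrite mulr_sumr; apply: eq_bigr => -[[o' z'] c'] _.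
rewrite lau_mul // !xpair_eqE /=.
by case: (o == _); case: (z == _); case: (o' == _); case: (z' == _);
  rewrite /= ?mulr0 ?mul0r.
Qed.

Definition bv (z : idx * idx) : 'cV[F]_(4 * 4) := delta_mx (pos z) 0.

Lemma mat_bv E z :
  mat E *m bv z = \sum_(e <- E | e.1.2 == z) lau e.2 *: bv e.1.1.
Proof.
apply/matrixP => i j; rewrite summxE -colE !mxE posK big_mkcond [RHS]big_mkcond /=.
apply: eq_bigr => -[[o z'] c] _ /=; rewrite !mxE xpair_eqE.
rewrite ord1 eqxx andbT [o == _]eq_sym (can2_eq pos_invK posK).
by case: (z' == z); case: (i == _); rewrite ?mulr1 ?mulr0.
Qed.

Lemma mat_ext (M : 'M[F]_(4 * 4)) : (forall z, M *m bv z = 0) -> M = 0.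
Proof.
move=> h; apply/matrixP => i j; have := h (pos_inv j).
rewrite /bv pos_invK -colE => /matrixP/(_ i 0); by rewrite !mxE.
Qed.

End Entries.

(** * Tables for the action of U_q *)

Definition cone : code := [:: (false, 0, 0)].
Definition cid := [seq (x, x, cone) | x <- idx_all].
Definition cpar : seq (idx * idx * code) :=
  [:: (X0, X0, cone); (X1, X1, code_opp cone); (X2, X2, code_opp cone);
      (X3, X3, cone)].
Definition cE (n : node) : seq (idx * idx * code) :=
  match n with
  | node1 => [:: (X1, X2, cone)]
  | node2 => [:: (X0, X1, [:: (false, 0, 1); (true, 0, -1)]);
                 (X2, X3, [:: (false, 1, 1); (true, -1, -1)])]
  end.
Definition cF (n : node) : seq (idx * idx * code) :=
  match n with
  | node1 => [:: (X2, X1, cone)]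
  | node2 => [:: (X1, X0, cone); (X3, X2, cone)]
  end.
Definition cK (n : node) : seq (idx * idx * code) :=
  match n with
  | node1 => [:: (X0, X0, cone); (X1, X1, [:: (false, 1, 0)]);
                 (X2, X2, [:: (false, -1, 0)]); (X3, X3, cone)]
  | node2 => [:: (X0, X0, [:: (false, 0, 1)]); (X1, X1, [:: (false, 0, 1)]);
                 (X2, X2, [:: (false, 1, 1)]); (X3, X3, [:: (false, 1, 1)])]
  end.
Definition cKV (n : node) : seq (idx * idx * code) :=
  match n with
  | node1 => [:: (X0, X0, cone); (X1, X1, [:: (false, -1, 0)]);
                 (X2, X2, [:: (false, 1, 0)]); (X3, X3, cone)]
  | node2 => [:: (X0, X0, [:: (false, 0, -1)]); (X1, X1, [:: (false, 0, -1)]);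
                 (X2, X2, [:: (false, -1, -1)]); (X3, X3, [:: (false, -1, -1)])]
  end.
Definition cKVpar (n : node) : seq (idx * idx * code) :=
  match n with
  | node1 => cKV node1
  | node2 => [:: (X0, X0, [:: (false, 0, -1)]); (X1, X1, [:: (true, 0, -1)]);
                 (X2, X2, [:: (true, -1, -1)]); (X3, X3, [:: (false, -1, -1)])]
  end.
Definition cparn (n : node) := if odd_node n then cpar else cid.

(* The action of U_q on the tensor square of V, up to a factor q - 1/q for    *)
(* E_2, which makes all the coefficients Laurent polynomials.                 *)
Definition VVE (n : node) : entries code := Eval vm_compute in
  match n with
  | node1 => ent_tens (cE node1) (cK node1) ++ ent_tens (cparn node1) (cE node1)
  | node2 => ent_tens (cE node2) (cK node2) ++ ent_tens (cparn node2) (cE node2)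
  end.
Definition VVF (n : node) : entries code := Eval vm_compute in
  match n with
  | node1 => ent_tens (cF node1) cid ++ ent_tens (cKVpar node1) (cF node1)
  | node2 => ent_tens (cF node2) cid ++ ent_tens (cKVpar node2) (cF node2)
  end.
Definition VVK (n : node) : entries code := Eval vm_compute in
  match n with
  | node1 => ent_tens (cK node1) (cK node1)
  | node2 => ent_tens (cK node2) (cK node2)
  end.
Definition VVKV (n : node) : entries code := Eval vm_compute in
  match n with
  | node1 => ent_tens (cKV node1) (cKV node1)
  | node2 => ent_tens (cKV node2) (cKV node2)
  end.

Definition ent_commute (E E' : entries code) : bool :=
  ent_zero (ent_comp E E' ++ ent_opp (ent_comp E' E)).

Lemma sigma_commute n :
  [&& ent_commute (sigma_code true) (VVE n), ent_commute (sigma_code true) (VVF n),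
      ent_commute (sigma_code true) (VVK n) & ent_commute (sigma_code true) (VVKV n)].
Proof. by case: n; vm_compute. Qed.

Lemma sigma_code_inv : ent_zero (ent_comp (sigma_code true) (sigma_code false) ++
  ent_opp (ent_tens cid cid)).
Proof. by vm_compute. Qed.

Section Action.

Variables (F : fieldType) (q s : F).
Hypotheses (q0 : q != 0) (s0 : s != 0) (q2 : q - q^-1 != 0).
Notation mat := (mat q s).
Notation mat1 := (mat1 q s).
Notation VV := (VV q s).
Notation V := (V q s).

Ltac mat1_tac := apply/matrixP => -[[|[|[|[|//]]]] ?] [[|[|[|[|//]]]] ?];
  rewrite !mxE ?big_cons ?big_nil /= ?big_cons ?big_nil
    /lau /laurent /= ?mulr0n ?mulr1n;
  by [ring | field; rewrite ?q0 ?s0].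

Lemma mat1_id : mat1 cid = 1%:M. Proof. mat1_tac. Qed.

Lemma mat1_par : mat1 cpar = parity V. Proof. mat1_tac. Qed.

Lemma mat1_F n : mat1 (cF n) = actF V n.
Proof. by case: n; mat1_tac. Qed.

Lemma mat1_K n : mat1 (cK n) = actK V n.
Proof. by case: n; mat1_tac. Qed.

Lemma mat1_KV n : mat1 (cKV n) = actKV V n.
Proof. by case: n; mat1_tac. Qed.

Definition Escale (n : node) : F := if odd_node n then q - q^-1 else 1.

Lemma Escale_neq0 n : Escale n != 0.
Proof. by case: n => //=; exact: oner_neq0. Qed.

Lemma mat1_E n : mat1 (cE n) = Escale n *: actE V n.
Proof.
have qq : q ^+ 2 - 1 != 0.
  have e : q - q^-1 = (q ^+ 2 - 1) / q by field.
  by move: q2; rewrite e mulf_eq0 negb_or => /andP[].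
case: n; apply/matrixP => -[[|[|[|[|//]]]] ?] [[|[|[|[|//]]]] ?];
  rewrite !mxE ?big_cons ?big_nil /= ?big_cons ?big_nil
    /lau /laurent /Escale /= ?mulr0n ?mulr1n;
  by [ring | field; rewrite ?q0 ?s0 ?qq].
Qed.

Lemma mat1_KVpar n :
  mat1 (cKVpar n) = actKV V n *m (if odd_node n then parity V else 1%:M).
Proof.
case: n; rewrite /= ?mulmx1 ?mulmx_diag; mat1_tac.
Qed.

Lemma mat1_parn n : mat1 (cparn n) = if odd_node n then parity V else 1%:M.
Proof. by case: n; [exact: mat1_id | exact: mat1_par]. Qed.

Lemma mat_K n : mat (VVK n) = actK VV n.
Proof.
rewrite -[RHS]/(actK V n *t actK V n) -!mat1_K -mat_tens //.
by congr mat; case: n.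
Qed.

Lemma mat_KV n : mat (VVKV n) = actKV VV n.
Proof.
rewrite -[RHS]/(actKV V n *t actKV V n) -!mat1_KV -mat_tens //.
by congr mat; case: n.
Qed.

Lemma mat_F n : mat (VVF n) = actF VV n.
Proof.
rewrite -[RHS]/(actF V n *t 1%:M +
  (actKV V n *m (if odd_node n then parity V else 1%:M)) *t actF V n).
rewrite -mat1_KVpar -!mat1_F -mat1_id -!mat_tens // -mat_cat.
by congr mat; case: n.
Qed.

Lemma mat_E n : mat (VVE n) = Escale n *: actE VV n.
Proof.
transitivity (mat1 (cE n) *t mat1 (cK n) + mat1 (cparn n) *t mat1 (cE n)).
  by rewrite -!mat_tens // -mat_cat; congr mat; case: n.
rewrite mat1_E mat1_K mat1_parn; apply/matrixP => i j; rewrite !mxE.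
by rewrite mulrDr; congr (_ + _); [rewrite mulrA | rewrite mulrCA].
Qed.

Definition sigma_mx : 'M[F]_(4 * 4) := mat (sigma_code true).

Lemma mat_commute E E' : ent_commute E E' -> mat E *m mat E' = mat E' *m mat E.
Proof. by move=> h; rewrite -!mat_comp //; exact: mat_eq. Qed.

Lemma sigma_mx_endo : Uq_endo VV sigma_mx.
Proof.
move=> n; have /and4P[hE hF hK hKV] := sigma_commute n; split.
- apply: (scalerI (Escale_neq0 n)).
  by rewrite scalemxAr scalemxAl -mat_E; exact: mat_commute.
- by rewrite -mat_F; exact: mat_commute.
- by rewrite -mat_K; exact: mat_commute.
- by rewrite -mat_KV; exact: mat_commute.
Qed.

Lemma sigma_mxK : sigma_mx *m mat (sigma_code false) = 1%:M.
Proof.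
rewrite -mat_comp // (mat_eq _ _ sigma_code_inv) mat_tens // mat1_id.
by apply/matrixP => i j; case: (mxtens_indexP i) => a b; case: (mxtens_indexP j) => c d;
  rewrite tensmxE !mxE -natrM mulnb (can_eq (@mxtens_indexK 4 4)) xpair_eqE.
Qed.

Lemma Uq_span_endo S v w c : Uq_endo VV S -> S *m v = c *: v ->
  Uq_span VV v w -> S *m w = c *: w.
Proof.
move=> endo Sv; elim=> {w} //.
- by move=> a x y _ ex _ ey; rewrite mulmxDr -scalemxAr ex ey scalerDr !scalerA mulrC.
- by move=> i x _ e; case: (endo i) => h _ _ _; rewrite mulmxA h -mulmxA e scalemxAr.
- by move=> i x _ e; case: (endo i) => _ h _ _; rewrite mulmxA h -mulmxA e scalemxAr.
- by move=> i x _ e; case: (endo i) => _ _ h _; rewrite mulmxA h -mulmxA e scalemxAr.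
- by move=> i x _ e; case: (endo i) => _ _ _ h; rewrite mulmxA h -mulmxA e scalemxAr.
Qed.

Definition co (v : 'cV[F]_(4 * 4)) x y : F := v (pos (x, y)) 0.

Lemma co_mat E v x y : co (mat E *m v) x y =
  \sum_(e <- E | e.1.1 == (x, y)) lau q s e.2 * co v e.1.2.1 e.1.2.2.
Proof.
rewrite /co mxE [RHS]big_mkcond /=.
under [LHS]eq_bigr do rewrite mxE posK big_mkcond mulr_suml.
rewrite exchange_big /=; apply: eq_bigr => -[[z [a b]] c] _ /=.
rewrite (bigD1 (pos (a, b))) //= big1 ?addr0 => [|k ne].
  by rewrite posK xpair_eqE eqxx andbT; case: (z == _); rewrite ?mul0r.
rewrite xpair_eqE; case: (eqVneq (a, b) (pos_inv k)) => [e|_].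
  by rewrite e pos_invK eqxx in ne.
by rewrite andbF mul0r.
Qed.

Lemma co_matE E v x y : co (mat E *m v) x y =
  foldr (fun e r => if e.1.1 == (x, y) then
                      lau q s e.2 * co v e.1.2.1 e.1.2.2 + r else r) 0 E.
Proof.
rewrite co_mat; elim: E => [|e E IH]; first by rewrite big_nil.
by rewrite big_cons IH.
Qed.

Lemma co_eq (v w : 'cV[F]_(4 * 4)) : (forall x y, co v x y = co w x y) -> v = w.
Proof.
move=> h; apply/matrixP => i j; rewrite ord1 -[i]pos_invK.
by case: (pos_inv i) => x y; exact: h.
Qed.

Lemma coZ a v x y : co (a *: v) x y = a * co v x y.
Proof. by rewrite /co mxE. Qed.

Lemma co0 x y : co 0 x y = 0. Proof. by rewrite /co mxE. Qed.

Lemma co_bv z x y : co (bv F z) x y = (z == (x, y))%:R.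
Proof. by rewrite /co mxE eqxx andbT (can_eq posK) eq_sym. Qed.

End Action.

Arguments lau : simpl never.

(** * Existence and uniqueness of sigma *)

Section Sigma.

Variables (F : fieldType) (q s : F).
Hypotheses (q0 : q != 0) (s0 : s != 0) (hq : q ^+ 2 - 1 != 0)
  (hs : s ^+ 2 - 1 != 0) (hqs : (q * s) ^+ 2 - 1 != 0).
Notation mat := (mat q s).
Notation VV := (VV q s).
Notation S := (sigma_mx q s).

Lemma q_sub_qV : q - q^-1 != 0.
Proof.
have e : q ^+ 2 - 1 = q * (q - q^-1) by field.
by move: hq; rewrite e mulf_eq0 negb_or => /andP[].
Qed.

Definition kw (n : node) (x : idx) : F :=
  match n, x with
  | node1, X1 => q | node1, X2 => q^-1 | node1, _ => 1
  | node2, X0 | node2, X1 => s | node2, _ => q * s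
  end.

Lemma co_K n v x y : co (actK VV n *m v) x y = kw n x * kw n y * co v x y.
Proof.
rewrite -mat_K // co_matE.
by case: n; case: x; case: y; rewrite /= /lau /laurent /=; field; rewrite ?q0 ?s0.
Qed.

(* The weight of a basis vector is (q ^ a, s * q ^ b).                        *)
Definition wt (n : node) (x : idx) : int :=
  match n, x with
  | node1, X1 => 1 | node1, X2 => -1 | node1, _ => 0
  | node2, X0 | node2, X1 => 0 | node2, _ => 1
  end.

Lemma kwE n x : kw n x = (if odd_node n then s else 1) * q ^ wt n x.
Proof. by case: n; case: x; rewrite /= ?mulr1 ?mul1r ?expr1z // mulrC. Qed.

Lemma q_zpow (d : int) : d \in [:: -2; -1; 1; 2] -> q ^ d != 1.
Proof.
have h2 : q ^+ 2 != 1 by rewrite -subr_eq0.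
have h1 : q != 1 by apply: contraNneq h2 => ->; rewrite expr1n.
rewrite !inE => /or4P[] /eqP -> //=.
- by rewrite -[_ ^ _]/((q ^+ 2)^-1) invr_eq1.
- by rewrite -[_ ^ _]/(q^-1) invr_eq1.
Qed.

(** A weight vector has nonzero coordinates only at basis vectors of the same weight; the factors
    [s] cancel, leaving equalities between powers of [q]. *)
Lemma hw_exp (a b : int) v x y : highest_weight VV (q ^ a) (q ^ b * s ^+ 2) v ->
  co v x y != 0 ->
  q ^ (wt node1 x + wt node1 y - a) = 1 /\ q ^ (wt node2 x + wt node2 y - b) = 1.
Proof.
move=> [_ _ e1 e2] nz.
have := co_K node1 v x y; have := co_K node2 v x y; rewrite e1 e2 !coZ !kwE /=.
rewrite !mul1r [s * _ * _]mulrACA -expr2 [q ^ b * _]mulrC -!expfzDr //.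
move=> /(mulIf nz) /(mulfI (expf_neq0 2 s0)) h2 /(mulIf nz) h1.
by rewrite !(expfzDr _ (- _)) // -h1 -h2 -!expfzDr // !subrr expr0z.
Qed.

Definition co_zero (v : 'cV[F]_(4 * 4)) (supp : seq (idx * idx)) :=
  forall x y, (x, y) \notin supp -> co v x y = 0.

(** Only the powers of [q] with exponents -2, -1, 1, 2 are known to differ from 1. For the weight
    [(q, s^2)] the pair [(X2, X2)] has first difference -3, and it is excluded by its second
    difference, 2. *)
Definition supp (a b : int) : seq (idx * idx) :=
  [seq z <- [seq (x, y) | x <- idx_all, y <- idx_all] |
     (wt node1 z.1 + wt node1 z.2 - a \notin [:: -2; -1; 1; 2])
     && (wt node2 z.1 + wt node2 z.2 - b \notin [:: -2; -1; 1; 2])].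

Lemma hw_supp (a b : int) v : highest_weight VV (q ^ a) (q ^ b * s ^+ 2) v ->
  co_zero v (supp a b).
Proof.
move=> h x y; apply: contraNeq => /(hw_exp h)[e1 e2].
rewrite mem_filter /=; apply/andP; split; first (apply/andP; split).
- by apply: contraPN e1 => /q_zpow /eqP.
- by apply: contraPN e2 => /q_zpow /eqP.
- by clear; case: x; case: y.
Qed.

Lemma hw1_zero v : highest_weight VV 1 (s ^+ 2) v -> co_zero v [:: (X0, X0)].
Proof. by move=> h; apply: (@hw_supp 0 0); rewrite expr0z mul1r. Qed.

Lemma hw2_zero v : highest_weight VV q (s ^+ 2) v ->
  co_zero v [:: (X0, X1); (X1, X0)].
Proof. by move=> h; apply: (@hw_supp 1 0); rewrite expr1z expr0z mul1r. Qed.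

Lemma hw3_zero v : highest_weight VV 1 (q * s ^+ 2) v ->
  co_zero v [:: (X0, X3); (X1, X2); (X2, X1); (X3, X0)].
Proof. by move=> h; apply: (@hw_supp 0 1); rewrite expr1z expr0z. Qed.

Lemma hw_E a b v n x y : highest_weight VV a b v -> co (mat (VVE n) *m v) x y = 0.
Proof.
by case=> _ h _ _; rewrite mat_E ?q_sub_qV // -scalemxAl h scaler0 co0.
Qed.

Lemma sigma_hw1 v : highest_weight VV 1 (s ^+ 2) v -> S *m v = s ^+ 2 *: v.
Proof.
move=> /hw1_zero z; pose a := co v X0 X0.
have cE x y : co v x y = match x, y with X0, X0 => a | _, _ => 0 end.
  by case: x; case: y => //; exact: z.
apply: co_eq => x y; rewrite coZ co_matE.
case: x; case: y; rewrite /= !cE /= ?mulr0 ?addr0 //.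
by rewrite /lau /laurent /=; ring.
Qed.

Lemma sigma_hw2 v : highest_weight VV q (s ^+ 2) v -> S *m v = (-1) *: v.
Proof.
move=> h; have z := hw2_zero h; pose a := co v X0 X1; pose b := co v X1 X0.
have cE x y : co v x y =
    match x, y with X0, X1 => a | X1, X0 => b | _, _ => 0 end.
  by case: x; case: y => //; exact: z.
have := hw_E node2 X0 X0 h; rewrite co_matE /= !cE /= /lau /laurent /= => e.
have ea : a = - (s * b).
  apply: (mulfI hs); apply/eqP; rewrite -subr_eq0 -(inj_eq (mulfI (invr_neq0 s0))).
  by rewrite mulr0 -[X in _ == X]e; apply/eqP; field.
apply: co_eq => x y; rewrite coZ co_matE.
case: x; case: y; rewrite /= !cE /= ?mulr0 ?addr0 //;
  by rewrite /lau /laurent /= ?ea; ring.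
Qed.

(** In the four-dimensional weight space three of the equations [E v = 0] leave the coordinate [c]
    free; on this line the action of the explicit matrix is read off. *)
Lemma sigma_hw3 v : highest_weight VV 1 (q * s ^+ 2) v ->
  S *m v = (q ^- 2 * s ^- 2) *: v.
Proof.
move=> h; have z := hw3_zero h.
pose a := co v X0 X3; pose b := co v X1 X2; pose c := co v X2 X1.
pose d := co v X3 X0.
have cE x y : co v x y = match x, y with
    X0, X3 => a | X1, X2 => b | X2, X1 => c | X3, X0 => d | _, _ => 0 end.
  by case: x; case: y => //; exact: z.
have := hw_E node1 X1 X1 h; rewrite co_matE /= !cE /= /lau /laurent /= => e1.
have := hw_E node2 X0 X2 h; rewrite co_matE /= !cE /= /lau /laurent /= => e2.
have := hw_E node2 X2 X0 h; rewrite co_matE /= !cE /= /lau /laurent /= => e3.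
have eb : b = - (q * c).
  by apply/eqP; rewrite -subr_eq0 -[X in _ == X]e1; apply/eqP; ring.
have ed : d = q * (s ^+ 2 - 1) / (s * ((q * s) ^+ 2 - 1)) * c.
  apply: (mulfI hqs); apply/eqP; rewrite -subr_eq0.
  rewrite -(inj_eq (mulfI (invr_neq0 q0))) mulr0 -[X in _ == X]e3.
  by apply/eqP; field; rewrite q0 s0 hqs.
have ea : a = q ^+ 3 * s * (s ^+ 2 - 1) / ((q * s) ^+ 2 - 1) * c.
  apply: (mulfI hqs); apply/eqP; rewrite -subr_eq0.
  rewrite -(inj_eq (mulfI (invr_neq0 (mulf_neq0 q0 s0)))) mulr0 -[X in _ == X]e2.
  by rewrite eb; apply/eqP; field; rewrite q0 s0 hqs.
apply: co_eq => x y; rewrite coZ co_matE.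
case: x; case: y; rewrite /= !cE /= ?mulr0 ?addr0 //;
  by rewrite /lau /laurent /= ?ea ?ed ?eb; field; rewrite ?q0 ?s0 ?hqs.
Qed.

Lemma sigma_mx_is_sigma : is_sigma q s S.
Proof.
have endo := sigma_mx_endo q0 s0 q_sub_qV.
split=> // v w hv; apply: Uq_span_endo => //.
- exact: sigma_hw1.
- exact: sigma_hw2.
- exact: sigma_hw3.
Qed.

Lemma coD (v w : 'cV[F]_(4 * 4)) x y : co (v + w) x y = co v x y + co w x y.
Proof. by rewrite /co mxE. Qed.

Lemma highest_weightP a b v : v != 0 ->
  (forall n x y, co (mat (VVE n) *m v) x y = 0) ->
  (forall x y, kw node1 x * kw node1 y * co v x y = a * co v x y) ->
  (forall x y, kw node2 x * kw node2 y * co v x y = b * co v x y) ->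
  highest_weight VV a b v.
Proof.
move=> v0 hE h1 h2; split=> // [n||].
- apply: (scalerI (Escale_neq0 q_sub_qV n)); rewrite scaler0 scalemxAl -mat_E ?q_sub_qV //.
  by apply: co_eq => x y; rewrite hE co0.
- by apply: co_eq => x y; rewrite co_K h1 coZ.
- by apply: co_eq => x y; rewrite co_K h2 coZ.
Qed.

Notation bv := (bv F).

Definition hw_vec1 := bv (X0, X0).

Definition hw_vec2 := - s *: bv (X0, X1) + bv (X1, X0).

(** The solution of [sigma_hw3] with [c = ((q s)^2 - 1) / q], which clears the denominators
    containing [(q s)^2 - 1]. *)
Definition hw_vec3 := (q ^+ 2 * s * (s ^+ 2 - 1)) *: bv (X0, X3) +
  (1 - (q * s) ^+ 2) *: bv (X1, X2) + (q * s ^+ 2 - q^-1) *: bv (X2, X1) +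
  (s - s^-1) *: bv (X3, X0).

Lemma highest_weight1 : highest_weight VV 1 (s ^+ 2) hw_vec1.
Proof.
rewrite /hw_vec1; apply: highest_weightP => [|n x y|x y|x y].
- apply/eqP => /(congr1 (fun v => co v X0 X0)); rewrite co_bv co0 eqxx => /eqP.
  by rewrite oner_eq0.
- by rewrite co_matE; case: n; case: x; case: y; rewrite /= ?co_bv /= ?mulr0 ?addr0.
- by case: x; case: y; rewrite co_bv /= ?mulr0 //; ring.
- by case: x; case: y; rewrite co_bv /= ?mulr0 //; ring.
Qed.

Lemma highest_weight2 : highest_weight VV q (s ^+ 2) hw_vec2.
Proof.
have cE x y : co hw_vec2 x y =
    match x, y with X0, X1 => - s | X1, X0 => 1 | _, _ => 0 end.
  by case: x; case: y; rewrite coD coZ !co_bv /=; ring.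
apply: highest_weightP => [|n x y|x y|x y].
- apply/eqP => /(congr1 (fun v => co v X1 X0)); rewrite cE co0 => /eqP.
  by rewrite oner_eq0.
- rewrite co_matE; case: n; case: x; case: y; rewrite /= ?cE /= ?mulr0 ?addr0 //;
  by rewrite /lau /laurent /= ?cE /=; field.
- by rewrite cE; case: x; case: y; rewrite /=; ring.
- by rewrite cE; case: x; case: y; rewrite /=; ring.
Qed.

Lemma highest_weight3 : highest_weight VV 1 (q * s ^+ 2) hw_vec3.
Proof.
have cE x y : co hw_vec3 x y = match x, y with
    | X0, X3 => q ^+ 2 * s * (s ^+ 2 - 1) | X1, X2 => 1 - (q * s) ^+ 2
    | X2, X1 => q * s ^+ 2 - q^-1 | X3, X0 => s - s^-1 | _, _ => 0 end.
  by case: x; case: y; rewrite !coD !coZ !co_bv /=; ring.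
apply: highest_weightP => [|n x y|x y|x y].
- apply/eqP => /(congr1 (fun v => co v X1 X2)); rewrite cE co0 => /eqP.
  by rewrite -oppr_eq0 opprB (negbTE hqs).
- rewrite co_matE; case: n; case: x; case: y; rewrite /= ?cE /= ?mulr0 ?addr0 //;
  by rewrite /lau /laurent /= ?cE /=; field; rewrite ?q0 ?s0.
- by rewrite cE; case: x; case: y; rewrite /= ?mulr0 //; field.
- by rewrite cE; case: x; case: y; rewrite /= ?mulr0 //; field; rewrite ?q0 ?s0.
Qed.

Lemma lau_mon_neq0 m : lau q s [:: m] != 0.
Proof.
rewrite lauE big_seq1 /mon mulf_neq0 ?signr_eq0 // mulf_neq0 //; exact: expfz_neq0.
Qed.

Lemma scaler_eq0r (c : F) (A : 'cV[F]_(4 * 4)) : c *: A = 0 -> c != 0 -> A = 0.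
Proof. by move=> /eqP; rewrite scaler_eq0 => /orP[/eqP ->|/eqP //]; rewrite eqxx. Qed.

Lemma mat_bvE E z : mat E *m bv z =
  foldr (fun e r => if e.1.2 == z then lau q s e.2 *: bv e.1.1 + r else r) 0 E.
Proof.
rewrite mat_bv; elim: E => [|e E IH]; first by rewrite big_nil.
by rewrite big_cons IH.
Qed.

Hypotheses (hs2 : s ^+ 2 + 1 != 0) (hqs2 : (q * s) ^+ 2 + 1 != 0)
  (hqs4 : q ^+ 2 * s ^+ 4 - 1 != 0).

(** The difference [N] kills the three highest weight vectors and commutes with [F_1] and [F_2].
    Applying these repeatedly yields linear relations between the images [K x y] of the basis
    vectors, which force all of them to vanish: the three vectors generate V (x) V. *)
Lemma is_sigma_uniq S' : is_sigma q s S' -> S' = S.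
Proof.
move=> [endo' h1 h2 h3]; have [endo k1 k2 k3] := sigma_mx_is_sigma.
pose N := S' - S; pose K x y := N *m bv (x, y).
have F_step n x y : K x y = 0 ->
    foldr (fun e r => if e.1.2 == (x, y) then
      lau q s e.2 *: K e.1.1.1 e.1.1.2 + r else r) 0 (VVF n) = 0.
  move=> Kxy; transitivity (N *m (mat (VVF n) *m bv (x, y))).
    rewrite mat_bvE; elim: (VVF n) => [|[[[a b] z] c] E IH] /=; first by rewrite mulmx0.
    by case: ifP => _ //; rewrite mulmxDr -scalemxAr IH.
  rewrite mat_F // mulmxA mulmxBl.
  have [_ -> _ _] := endo' n; have [_ -> _ _] := endo n.
  by rewrite -mulmxBr -mulmxA -/(K x y) Kxy mulmx0.
have e1 : N *m hw_vec1 = 0.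
  by rewrite mulmxBl (h1 _ _ highest_weight1) ?(k1 _ _ highest_weight1) ?subrr //;
    exact: span_gen.
have e2 : N *m hw_vec2 = 0.
  by rewrite mulmxBl (h2 _ _ highest_weight2) ?(k2 _ _ highest_weight2) ?subrr //;
    exact: span_gen.
have e3 : N *m hw_vec3 = 0.
  by rewrite mulmxBl (h3 _ _ highest_weight3) ?(k3 _ _ highest_weight3) ?subrr //;
    exact: span_gen.
have K00 : K X0 X0 = 0 by [].
have step1 m A : lau q s [:: m] *: A + 0 = 0 -> A = 0 :> 'cV[F]_(4 * 4).
  by rewrite addr0 => /scaler_eq0r; apply; exact: lau_mon_neq0.
have f00 := F_step node2 _ _ K00.
rewrite mulmxDr -scalemxAr -!/(K _ _) in e2.
have K10' : K X1 X0 = s *: K X0 X1.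
  by apply/eqP; rewrite -subr_eq0 -e2 scaleNr addrC.
(* Two equations for [K X0 X1] and [K X1 X0], from [hw_vec2] and from [F_2] on [x_0 (x) x_0]; up to
   a unit their determinant is [s^2 + 1]. *)
have K01 : K X0 X1 = 0.
  apply: (scaler_eq0r (c := s ^+ 2 + 1) _ hs2); apply: co_eq => x y.
  have := congr1 (fun v => co v x y) f00.
  rewrite /= /lau /laurent /= K10' !coD !coZ co0 => f.
  by apply: (mulfI (invr_neq0 s0)); rewrite mulr0 -f; field.
have K10 : K X1 X0 = 0 by move: e2; rewrite K01 scaler0 add0r.
have K02 : K X0 X2 = 0 by have := F_step node1 _ _ K01; rewrite /= => /step1.
have K20 : K X2 X0 = 0 by have := F_step node1 _ _ K10; rewrite /= => /step1.
have K11 : K X1 X1 = 0 by have := F_step node2 _ _ K01; rewrite /= => /step1.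
have f02 := F_step node2 _ _ K02; have f20 := F_step node2 _ _ K20.
have f11 := F_step node1 _ _ K11.
have K03 : K X0 X3 = - s *: K X1 X2.
  apply: co_eq => x y; apply: (mulfI (invr_neq0 s0)); apply/eqP; rewrite coZ -subr_eq0.
  have := congr1 (fun v => co v x y) f02; rewrite /= /lau /laurent /= !coD !coZ co0 => f.
  by rewrite -[X in _ == X]f; apply/eqP; field.
have K21 : K X2 X1 = - q^-1 *: K X1 X2.
  apply: co_eq => x y; apply/eqP; rewrite coZ -subr_eq0.
  have := congr1 (fun v => co v x y) f11; rewrite /= /lau /laurent /= !coD !coZ co0 => f.
  by rewrite -[X in _ == X]f; apply/eqP; field.
have K30 : K X3 X0 = - (q ^- 2 * s^-1) *: K X1 X2.
  apply: co_eq => x y; apply/eqP; rewrite coZ -subr_eq0.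
  have := congr1 (fun v => co v x y) f20.
  rewrite /= /lau /laurent /= K21 !coD !coZ co0 => f.
  by rewrite -[X in _ == X]f; apply/eqP; field; rewrite q0 s0.
have K12 : K X1 X2 = 0.
  (* The coefficient, up to a unit, of [K X1 X2] in [e3] once the other three images are expressed
     through it. *)
  have nz : ((q * s) ^+ 2 + 1) * (q ^+ 2 * s ^+ 4 - 1) != 0 by exact: mulf_neq0.
  apply: (scaler_eq0r _ nz); apply: co_eq => x y.
  have := congr1 (fun v => co v x y) e3.
  rewrite !mulmxDr -!scalemxAr -!/(K _ _) K03 K21 K30 !coD !coZ co0 => f.
  apply: (mulfI (invr_neq0 (mulf_neq0 q0 s0))).
  apply: (mulfI (invr_neq0 (mulf_neq0 q0 s0))); rewrite !mulr0.
  apply: oppr_inj; rewrite oppr0 -f.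
  by field; rewrite q0 s0.
have {}K03 : K X0 X3 = 0 by rewrite K03 K12 scaler0.
have {}K21 : K X2 X1 = 0 by rewrite K21 K12 scaler0.
have {}K30 : K X3 X0 = 0 by rewrite K30 K12 scaler0.
have K22 : K X2 X2 = 0 by have := F_step node1 _ _ K12; rewrite /= => /step1.
have K13 : K X1 X3 = 0 by have := F_step node2 _ _ K12; rewrite /= => /step1.
have K31 : K X3 X1 = 0 by have := F_step node2 _ _ K21; rewrite /= => /step1.
have K23 : K X2 X3 = 0 by have := F_step node1 _ _ K13; rewrite /= => /step1.
have K32 : K X3 X2 = 0 by have := F_step node1 _ _ K31; rewrite /= => /step1.
have K33 : K X3 X3 = 0 by have := F_step node2 _ _ K32; rewrite /= => /step1.
apply/eqP; rewrite -subr_eq0; apply/eqP/mat_ext => -[x y].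
by case: x; case: y; rewrite -/(K _ _).
Qed.

End Sigma.

Definition generic_params (F : fieldType) (q s : F) : Prop :=
  [/\ q != 0, s != 0 & q ^+ 2 - 1 != 0] /\
  [/\ s ^+ 2 - 1 != 0, (q * s) ^+ 2 - 1 != 0, s ^+ 2 + 1 != 0,
      (q * s) ^+ 2 + 1 != 0 & q ^+ 2 * s ^+ 4 - 1 != 0].

Lemma sigmaE (F : fieldType) (q s : F) : generic_params q s ->
  sigma q s = sigma_mx q s.
Proof.
move=> [[q0 s0 hq] [hs hqs hs2 hqs2 hqs4]].
rewrite /sigma; case: xgetP => [S' -> | /(_ (sigma_mx q s))].
  exact: is_sigma_uniq.
by case; exact: sigma_mx_is_sigma.
Qed.

Lemma invmx_sigmaE (F : fieldType) (q s : F) : generic_params q s ->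
  invmx (sigma q s) = mat q s (sigma_code false).
Proof.
move=> h; rewrite (sigmaE h); move: h => [[q0 s0 _] _].
have e := sigma_mxK q0 s0; have [u _] := mulmx1_unit e.
transitivity (invmx (sigma_mx q s) *m (sigma_mx q s *m mat q s (sigma_code false))).
  by rewrite e mulmx1.
by rewrite mulmxA mulVmx // mul1mx.
Qed.

Lemma spec_nz x y : spec x y -> (if y is R0 then false else true) -> x != 0.
Proof. by move=> h nz; apply: (spec_neq0 h); case: y nz {h}. Qed.

(** * The partial trace and the cut value *)

Lemma Qqs_generic : generic_params q_ s_.
Proof.
have sq2 := specX 2 spec_q; have ss2 := specX 2 spec_s.
have sqs2 := specX 2 (specM spec_q spec_s).
split; split.
- exact: q_neq0.
- exact: s_neq0.
- exact: (spec_nz (specB sq2 spec1)).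
- exact: (spec_nz (specB ss2 spec1)).
- exact: (spec_nz (specB sqs2 spec1)).
- exact: (spec_nz (specD ss2 spec1)).
- exact: (spec_nz (specD sqs2 spec1)).
(* Reduction cannot show that this element is nonzero, as [q^2 s^4] takes the value 1 at [q = 4],
   [s = 5] modulo 11. Setting [s = 0] in the polynomial gives -1 instead. *)
pose a : {poly {poly int}} := ('X%:P) ^+ 2 * 'X ^+ 4 - 1.
have <- : Zqs_num a = q_ ^+ 2 * s_ ^+ 4 - 1.
  by rewrite rmorphB rmorphM !rmorphXn Zqs_numC Zqs_numX rmorph1.
apply/eqP => e; have : a = 0 by apply: Zqs_num_inj; rewrite e rmorph0.
move/(congr1 (fun p => p.[0])).
rewrite /a hornerD hornerN hornerM (horner_exp 'X) hornerX expr0n mulr0 hornerC.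
by rewrite add0r horner0 => /eqP; rewrite oppr_eq0 oner_eq0.
Qed.

(* Unification diverges when it unfolds the field of fractions. *)
Opaque Qqs.

Definition idx_tuple n (t : n.-tuple 'I_4) : seq idx := map idx_of_ord t.

Lemma idx_of_ord_inj : injective idx_of_ord.
Proof. exact: can_inj idx_of_ordK. Qed.

Lemma eq_idx_tuple n (t u : n.-tuple 'I_4) :
  (idx_tuple t == idx_tuple u) = (t == u).
Proof. by rewrite (inj_eq (inj_map idx_of_ord_inj)). Qed.

Lemma wordsS n : words idx_all n.+1 =
  flatten [seq [seq x :: t | t <- words idx_all n] | x <- idx_all].
Proof. by []. Qed.

Lemma uniq_words n : uniq (words idx_all n).
Proof.
elim: n => // n IH; have := @allpairs_uniq _ _ _ (fun x s => x :: s) idx_all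
  (words idx_all n); apply=> //.
by move=> [x s] [y t] _ _ [-> ->].
Qed.

Lemma size_words n s : s \in words idx_all n -> size s = n.
Proof.
elim: n s => [|n IH] s; first by rewrite inE => /eqP ->.
by rewrite wordsS => /flatten_mapP[y _ /mapP[t tw ->]]; rewrite /= IH.
Qed.

Lemma sum_words n (f : seq idx -> F11) :
  \sum_(t : n.-tuple 'I_4) f (idx_tuple t) = \sum_(s <- words idx_all n) f s.
Proof.
rewrite -big_enum -(big_map (@idx_tuple n) predT f); apply: perm_big.
apply: uniq_perm; rewrite ?uniq_words //.
  rewrite map_inj_in_uniq ?enum_uniq // => t u _ _ /eqP.
  by rewrite eq_idx_tuple => /eqP.
move=> s; apply/mapP/idP => [[t _ ->]|sw].
  by apply: mem_iwords; rewrite size_map size_tuple.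
have /eqP es := size_words sw.
exists [tuple of map ord_of_idx (Tuple es)]; rewrite ?mem_enum //.
by rewrite /idx_tuple /= -map_comp (eq_map ord_of_idxK) map_id.
Qed.

(** Expansion over basis vectors indexed by tuples, in the shape of the sum defining [psi]. *)
Lemma Zrun_expand D st st' w t : run D st = Some st' -> size t = size st' ->
  Zrun D st w t =
  \sum_(v : (size st).-tuple 'I_4) w (idx_tuple v) * Zrun D st (deltav (idx_tuple v)) t.
Proof.
move=> e et; transitivity (Zrun D st (fun r =>
  \sum_(v : (size st).-tuple 'I_4) w (idx_tuple v) * deltav (idx_tuple v) r) t).
  apply: (Zrun_ext e) et => r er.
  rewrite (sum_words _ (fun s => w s * deltav s r)).
  rewrite (bigD1_seq r) ?mem_iwords //=.
    rewrite /deltav eqxx mulr1 big1 ?addr0 // => s ne.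
    by rewrite eq_sym (negbTE ne) mulr0.
  exact: uniq_words.
rewrite (Zrun_sum _ _ e) //; apply: eq_bigr => v _.
exact: (Zrun_mul _ _ e).
Qed.

Lemma cross_entE o :
  cross_ent true true o = [seq (e.1, spec11 e.2) | e <- sigma_code o].
Proof. by case: o; vm_compute. Qed.

Lemma all_ordP m (i : 'I_m) (t u : m.+1.-tuple 'I_4) :
  [forall j, (j != widen_ord (leqnSn m) i) && (j != lift ord0 i)
     ==> (tnth t j == tnth u j)] =
  (take i t == take i u) && (drop i.+2 t == drop i.+2 u).
Proof.
have lt_i : (i < m.+1)%N by rewrite ltnW // ltnS.
apply/forallP/andP => [h|[/eqP h1 /eqP h2] j].
  have h' k (lt_k : (k < m.+1)%N) : k != i -> k != i.+1 ->
      nth ord0 t k = nth ord0 u k.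
    move=> n1 n2; have /implyP := h (Ordinal lt_k).
    rewrite -!val_eqE /= n1 n2 => /(_ isT) /eqP.
    by rewrite !(tnth_nth ord0) => e; exact: val_inj.
  split; apply/eqP/(@eq_from_nth _ ord0).
  - by rewrite !size_take !size_tuple.
  - move=> k; rewrite size_take size_tuple lt_i => lt_k; rewrite !nth_take //.
    apply: h'; [exact: ltn_trans lt_k lt_i | by rewrite ltn_eqF |].
    by rewrite ltn_eqF // ltnW.
  - by rewrite !size_drop !size_tuple.
  - move=> k; rewrite size_drop size_tuple => lt_k; rewrite !nth_drop.
    by apply: h'; rewrite ?gtn_eqF //; lia.
apply/implyP; rewrite -!val_eqE /= => /andP[n1 n2]; rewrite !(tnth_nth ord0).
case: (ltnP j i) => [lt|le].
  by rewrite -(nth_take ord0 lt t) -(nth_take ord0 lt u) h1.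
have le2 : (i.+2 <= j)%N by move: n1 n2; rewrite /bump /=; lia.
by rewrite -(subnKC le2) -!nth_drop h2.
Qed.

Lemma nseq_ord (T : Type) (x : T) m (i : 'I_m) :
  nseq m.+1 x = nseq i x ++ [:: x; x] ++ nseq (m.+1 - i.+2) x.
Proof.
by rewrite -[[:: x; x]]/(nseq 2 x) -!nseqD; congr nseq; have := ltn_ord i; lia.
Qed.

(** Both sides are the same sparse table [sigma_code o], with Laurent entries on the left and
    reduced ones on the right; the rest translates tuples of ordinals into words. *)
Lemma spec_act_at m (i : 'I_m) o (t u : m.+1.-tuple 'I_4) :
  spec (act_at (if o then sigma q_ s_ else invmx (sigma q_ s_)) i t u)
    (act (val i, Cross o) (nseq m.+1 true) (deltav (idx_tuple u)) (idx_tuple t)).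
Proof.
have -> : (if o then sigma q_ s_ else invmx (sigma q_ s_)) = mat q_ s_ (sigma_code o).
  by case: o; [exact: (sigmaE Qqs_generic) | exact: (invmx_sigmaE Qqs_generic)].
have dec (v : m.+1.-tuple 'I_4) : val v = take i v ++
    [:: tnth v (widen_ord (leqnSn m) i); tnth v (lift ord0 i)] ++ drop i.+2 v.
  rewrite !(tnth_nth ord0) /= -[LHS](cat_take_drop i v); congr (_ ++ _).
  have lt_i := ltn_ord i.
  rewrite (drop_nth ord0) ?size_tuple; last exact: leqW.
  by rewrite (drop_nth ord0) ?size_tuple.
rewrite /act_at all_ordP.
set a := tnth t _; set b := tnth t _; set c := tnth u _; set d := tnth u _.
have -> : idx_tuple t = map idx_of_ord (take i t) ++
    [:: idx_of_ord a; idx_of_ord b] ++ map idx_of_ord (drop i.+2 t).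
  by rewrite /idx_tuple [in LHS]dec !map_cat.
rewrite (nseq_ord _ i).
have est : size (map idx_of_ord (take i t)) = size (nseq i true).
  by rewrite size_map size_take size_tuple size_nseq ltnS ltnW.
rewrite -[X in act (X, _)](size_nseq i true) act_split //.
rewrite /evalf [src _ _ _]/(map _ _) cross_entE.
move: (sigma_code o) => cd; rewrite big_map big_filter big_map.
rewrite mxE /pos_inv !mxtens_indexK /=.
set P := (take i t == take i u) && _.
have spec_bool (x : bool) : spec x%:R x%:R by case: x; [exact: spec1 | exact: spec0].
rewrite (_ : \sum_(e <- _ | _) _ = (\sum_(e <- cd |
   e.1 == ((idx_of_ord a, idx_of_ord b), (idx_of_ord c, idx_of_ord d)))
   spec11 e.2) * P%:R).
  by apply: specM (spec_bool P); apply: spec_sum => e _; exact: spec_laurent.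
rewrite big_mkcond [in RHS]big_mkcond mulr_suml.
apply: eq_bigr => -[[z [x y]] k] _ /=; rewrite xpair_eqE.
case: (z == _); rewrite /= ?mul0r // /deltav.
have -> : idx_tuple u = map idx_of_ord (take i u) ++
    [:: idx_of_ord c; idx_of_ord d] ++ map idx_of_ord (drop i.+2 u).
  by rewrite /idx_tuple [in LHS]dec !map_cat.
rewrite eqseq_cat ?size_map ?size_take ?size_tuple //= !eqseq_cons.
rewrite !(inj_eq (inj_map idx_of_ord_inj)) xpair_eqE /P.
by case: (take i t == _); case: (drop i.+2 t == _); case: (x == _); case: (y == _);
  rewrite /= ?mulr0 ?mulr1.
Qed.

Lemma slice_braid m (i : 'I_m) o :
  apply_slice (nseq m.+1 true) (val i, Cross o) = Some (nseq m.+1 true).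
Proof.
rewrite (nseq_ord _ i).
by rewrite -[X in (X, _)](size_nseq i true) slice_frame0.
Qed.

Lemma run_braid m (b : braid_word m) :
  run (braid_diagram b) (nseq m.+1 true) = Some (nseq m.+1 true).
Proof. by elim: b => //= -[i o] b IH; rewrite slice_braid. Qed.

Lemma spec_psi m (b : braid_word m) (t u : m.+1.-tuple 'I_4) :
  spec (psi q_ s_ b t u)
    (Zrun (braid_diagram b) (nseq m.+1 true) (deltav (idx_tuple u)) (idx_tuple t)).
Proof.
elim: b u => [|[i o] b IH] u /=.
  rewrite /deltav eq_idx_tuple.
  by case: (t == u); [exact: spec1 | exact: spec0].
rewrite slice_braid [odflt _ _]/=.
have := @Zrun_expand (braid_diagram b) (nseq m.+1 true) (nseq m.+1 true).
rewrite size_nseq => -> ; [|exact: run_braid|by rewrite size_map size_tuple].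
apply: spec_sum => v _; rewrite mulrC; apply: specM; last exact: IH.
exact: spec_act_at.
Qed.

Definition levels m : seq bool := nseq m true ++ nseq m false.

Lemma nseqSr (T : Type) m (x : T) : nseq m.+1 x = nseq m x ++ [:: x].
Proof. by rewrite -[[:: x]]/(nseq 1 x) -nseqD addn1. Qed.

Lemma levelsS m : levels m.+1 = nseq m true ++ [:: true; false] ++ nseq m false.
Proof. by rewrite /levels nseqSr -catA. Qed.

Definition cups m : diagram := [seq (i, Cup true) | i <- iota 0 m].
Definition caps m : diagram := [seq (i, Cap) | i <- rev (iota 0 m)].

Lemma cupsS m : cups m.+1 = cups m ++ [:: (m, Cup true)].
Proof. by rewrite /cups -[m.+1]addn1 iotaD map_cat. Qed.

Lemma capsS m : caps m.+1 = (m, Cap) :: caps m.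
Proof. by rewrite /caps -[m.+1]addn1 iotaD rev_cat. Qed.

Lemma slice_cup m : apply_slice (levels m) (m, Cup true) = Some (levels m.+1).
Proof.
rewrite levelsS -[X in (X, _)](size_nseq m true).
exact: (@slice_frame0 (nseq m true) [::] (nseq m false) (Cup true)).
Qed.

Lemma slice_cap m : apply_slice (levels m.+1) (m, Cap) = Some (levels m).
Proof. by rewrite levelsS -[X in (X, _)](size_nseq m true) slice_frame0. Qed.

Lemma run_cups m : run (cups m) [::] = Some (levels m).
Proof.
by elim: m => // m IH; rewrite cupsS run_cat IH /= slice_cup.
Qed.

Lemma run_caps m : run (caps m) (levels m) = Some [::].
Proof. by elim: m => // m IH; rewrite capsS /= slice_cap. Qed.

(** The nested cups create each word followed by its mirror image, with coefficient 1 because every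
    cup is [Cup true]. *)
Lemma Zrun_cups m s s' : size s = m -> size s' = m ->
  Zrun (cups m) [::] vec0 (s ++ s') = if s' == rev s then 1 else 0.
Proof.
elim: m s s' => [|m IH] s s'; first by move=> /size0nil -> /size0nil ->.
case/lastP: s => // s x; rewrite size_rcons => -[es].
case: s' => // y s' [es']; rewrite cupsS (Zrun_cat _ _ (run_cups m)).
rewrite (Zrun_cons _ _ (slice_cup m)) /= -cats1 -catA.
rewrite -{1}(size_nseq m true) (@act_split _ _ [::] _ _ _ [:: x; y]) ?size_nseq //.
rewrite rev_cat /= eqseq_cons [y == x]eq_sym; case: eqP => _; last by rewrite evalf_nil.
by rewrite evalf_cons evalf_nil addr0 mul1r IH.
Qed.

Lemma sum_words_rcons n (f : seq idx -> F11) :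
  \sum_(s <- words idx_all n.+1) f s =
  \sum_(s <- words idx_all n) \sum_(x <- idx_all) f (rcons s x).
Proof.
have E k (g : seq idx -> F11) : \sum_(s <- words idx_all k.+1) g s =
    \sum_(x <- idx_all) \sum_(s <- words idx_all k) g (x :: s).
  by rewrite wordsS big_flatten big_map; apply: eq_bigr => x _; rewrite big_map.
elim: n f => [|n IH] f; first by rewrite E exchange_big /= !big_seq1; apply: eq_bigr.
rewrite E; under eq_bigr do rewrite IH.
by rewrite [RHS]E.
Qed.

Definition mu_prod (s : seq idx) : F11 := \prod_(x <- s) mu11 x.

Lemma Zrun_caps m w : Zrun (caps m) (levels m) w [::] =
  \sum_(s <- words idx_all m) mu_prod s * w (s ++ rev s).
Proof.
elim: m w => [|m IH] w; first by rewrite /= big_seq1 /mu_prod big_nil mul1r.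
rewrite capsS (Zrun_cons _ _ (slice_cap m)) IH sum_words_rcons.
rewrite big_seq [RHS]big_seq; apply: eq_bigr => s sw.
have es := size_words sw.
rewrite levelsS -{1}(size_nseq m true) -[s ++ rev s]/(s ++ [::] ++ rev s).
rewrite act_split ?size_nseq // /evalf /src big_map mulr_sumr.
apply: eq_bigr => x _; rewrite /mu_prod -cats1 big_cat big_seq1 rev_cat /=.
by rewrite -mulrA -!catA.
Qed.

Lemma hprod_nseq (w : idx -> F11) n s : size s = n ->
  hprod (nseq n w) s = \prod_(x <- s) w x.
Proof.
move=> <-; elim: s => [|x s IH] /=; first by rewrite big_nil.
by rewrite big_cons IH.
Qed.

(** The caps contribute [mu] for each strand of the braid, the cut weights [mu] for each upward
    strand but the first and [1/mu] for each downward strand. What remains is one factor [mu] for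
    each strand but the first, as in the partial trace. *)
Lemma LG11_closure m (b : braid_word m) : LG11 (braid_closure b) =
  \sum_(s <- words idx_all m) mu_prod s *
    Zrun (braid_diagram b) (nseq m.+1 true) (deltav (X0 :: s)) (X0 :: s).
Proof.
have eb : run (braid_diagram b) (levels m.+1) = Some (levels m.+1).
  have := run_frame [::] (nseq m.+1 false) (run_braid b).
  by rewrite shift0.
have er : run (braid_diagram b ++ caps m.+1) (levels m.+1) = Some [::].
  by rewrite run_cat eb; exact: run_caps.
rewrite /braid_closure -/(cups m.+1) -/(caps m.+1).
rewrite -(cut_eq (i := 0%N) (run_cups m.+1) er) // /cut (Zrun_cat _ _ eb) Zrun_caps.
set w := (fun t => _ * _).
have wE s r : size s = m.+1 -> size r = m.+1 ->
    w (r ++ rev s) = hprod (cut_weights (levels m.+1) 0) (s ++ rev s) * deltav s r.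
  move=> es er'; rewrite /w Zrun_cups ?size_rev // /deltav.
  rewrite (inj_eq (can_inj (@revK _))) [s == r]eq_sym.
  by case: eqP => [->|_] //; rewrite !mulr0.
have ZE s : size s = m.+1 -> Zrun (braid_diagram b) (levels m.+1) w (s ++ rev s) =
    hprod (cut_weights (levels m.+1) 0) (s ++ rev s) *
    Zrun (braid_diagram b) (nseq m.+1 true) (deltav s) s.
  move=> es; have := @Zrun_frame [::] (nseq m.+1 true) (nseq m.+1 false)
    (braid_diagram b) _ w [::] s (rev s) (run_braid b).
  rewrite shift0 size_nseq => -> //.
  rewrite -(Zrun_mul _ _ (run_braid b)) ?size_nseq //.
  apply: (Zrun_ext (run_braid b)); rewrite ?size_nseq // => r er'.
  exact: wE.
rewrite wordsS big_flatten big_map.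
rewrite (bigD1_seq X0) //= [X in _ + X]big1 ?addr0 => [|x x0]; last first.
  rewrite big_map big_seq big1 // => s /size_words es.
  rewrite ZE /= ?es // /cut_weights /= (_ : delta0 x = 0) ?mul0r ?mulr0 //.
  by case: x x0.
rewrite big_map big_seq [RHS]big_seq; apply: eq_bigr => s /size_words es.
rewrite ZE; last by rewrite /= es.
rewrite mulrA; congr (_ * _).
have -> : cut_weights (levels m.+1) 0 =
    [:: delta0] ++ nseq m (gw false) ++ nseq m.+1 (gw true).
  by rewrite /cut_weights [take _ _]/= [drop _ _]/= drop0 map_cat /= !map_nseq.
rewrite -[(X0 :: s) ++ _]/([:: X0] ++ s ++ rev (X0 :: s)).
rewrite !hprod_cat ?size_nseq ?es // hprod_nseq // hprod_nseq; last first.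
  by rewrite size_rev /= es.
have -> : \prod_(x <- rev (X0 :: s)) gw true x = \prod_(x <- X0 :: s) gw true x.
  by apply: perm_big; rewrite perm_rev.
rewrite /mu_prod !big_cons /=.
have : \prod_(x <- s) gw true x * \prod_(x <- s) mu11 x = 1.
  rewrite -big_split big1 // => x _; exact: mu11K.
set p := \prod_(x <- s) mu11 x; set p' := \prod_(x <- s) gw true x => e.
(* [R4] is the value of [mu] at [X0] and [R3] is its inverse. *)
transitivity (R3 * R4 * (p' * p) * p); first by ring.
by rewrite e (_ : R3 * R4 = 1) // !mul1r.
Qed.

Lemma spec_mu (x : 'I_4) : spec (mu q_ s_ x) (mu11 (idx_of_ord x)).
Proof.
have q2 := specX 2 spec_qV; have s2 := specX 2 spec_sV.
rewrite /mu; case: x => -[|[|[|[|//]]]] lt /=; rewrite -!exprVn.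
- exact: s2.
- exact: (specN s2).
- exact: (specN (specM q2 s2)).
- exact: (specM q2 s2).
Qed.

Lemma spec_partial_trace m (b : braid_word m) :
  spec (partial_trace q_ s_ b ord0 ord0) (LG11 (braid_closure b)).
Proof.
rewrite LG11_closure -sum_words mxE; apply: spec_sum => t _; apply: specM.
  rewrite /mu_prod big_map; apply: spec_prod => x _; exact: spec_mu.
have := spec_psi b (cons_tuple ord0 t) (cons_tuple ord0 t).
by rewrite -[X0]/(idx_of_ord ord0) /idx_tuple.
Qed.

Lemma spec_LG D p : (exists m (b : braid_word m),
    isotopic (braid_closure b) D /\ partial_trace q_ s_ b = p%:M) ->
  spec p (LG11 D).
Proof.
move=> [m [b [iso e]]]; have := spec_partial_trace b.
by rewrite e mxE eqxx (LG11_isotopic iso).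
Qed.

(** * The connected sum of two Hopf links *)

Definition sigma2_code : entries code := Eval vm_compute in
  ent_comp (sigma_code true) (sigma_code true).

(** The Links--Gould value of the positive Hopf link. *)
Definition hopf_code : code :=
  [:: (false, 0, 2); (false, -2, -2); (true, 0, 0); (true, -2, 0)].

Lemma check_hopf : all (fun x => all (fun x' => code_zero
   (flatten [seq code_mul (mu_code y)
      (flatten [seq e.2 | e <- sigma2_code & e.1 == ((x, y), (x', y))])
      | y <- idx_all] ++ code_opp (if x == x' then hopf_code else [::])))
  idx_all) idx_all.
Proof. by vm_compute. Qed.

Lemma sum_mxtens (R : nmodType) (G : 'I_(4 * 4) -> R) :
  \sum_k G k = \sum_x \sum_y G (mxtens_index (x, y)).
Proof.
rewrite pair_bigA /= (reindex (@mxtens_index 4 4)) /=.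
  by apply: eq_bigr => -[x y].
by exists (@mxtens_unindex 4 4) => k _; rewrite (mxtens_indexK, mxtens_unindexK).
Qed.

Lemma sum_tuple2 (R : nmodType) (G : 2.-tuple 'I_4 -> R) :
  \sum_t G t = \sum_x \sum_y G [tuple x; y].
Proof.
rewrite pair_bigA /= (reindex (fun p => [tuple p.1; p.2])) //=.
exists (fun t => (tnth t 0, tnth t 1)) => [[x y] _|t _] //.
by apply: eq_from_tnth => -[[|[|//]] ?]; rewrite !(tnth_nth ord0).
Qed.

Lemma sum_tuple3 (R : nmodType) (G : 3.-tuple 'I_4 -> R) :
  \sum_t G t = \sum_x \sum_y \sum_z G [tuple x; y; z].
Proof.
under [RHS]eq_bigr do rewrite pair_bigA /=.
rewrite pair_bigA /= (reindex (fun p => [tuple p.1; p.2.1; p.2.2])) //=.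
exists (fun t => (tnth t 0, (tnth t 1, tnth t 2%R))) => [[x [y z]] _|t _] //.
by apply: eq_from_tnth => -[[|[|[|//]]] ?]; rewrite !(tnth_nth ord0).
Qed.

Lemma sum_idx_all (R : nmodType) (f : idx -> R) :
  \sum_(y <- idx_all) f y = \sum_y f (idx_of_ord y).
Proof. by rewrite !big_ord_recl big_ord0 !big_cons big_nil. Qed.

Section HH.

Variables (F : fieldType) (q s : F).
Hypothesis generic : generic_params q s.
Notation S := (sigma q s).
Notation ix := mxtens_index.

Let q0 : q != 0. Proof. by case: generic => -[]. Qed.
Let s0 : s != 0. Proof. by case: generic => -[]. Qed.

Lemma mu_lau j : mu q s j = lau q s (mu_code (idx_of_ord j)).
Proof.
rewrite /mu /lau /laurent; case: j => -[|[|[|[|//]]]] lt /=; by field; rewrite ?q0 ?s0.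
Qed.

Lemma hopf_trace x x' : \sum_y mu q s y * (S *m S) (ix (x, y)) (ix (x', y)) =
  lau q s hopf_code * (x == x')%:R.
Proof.
have -> : S *m S = mat q s sigma2_code.
  by rewrite (sigmaE generic) /sigma_mx -mat_comp.
have /allP/(_ _ (mem_idx_all (idx_of_ord x)))/allP := check_hopf.
move=> /(_ _ (mem_idx_all (idx_of_ord x')))/(code_zeroP q s).
rewrite lau_cat lau_opp lau_flatten => /eqP; rewrite subr_eq0 => /eqP e.
transitivity (lau q s (if idx_of_ord x == idx_of_ord x' then hopf_code else [::])).
  rewrite -e sum_idx_all; apply: eq_bigr => y _.
  by rewrite lau_mul // mu_lau mxE lau_flatten big_filter /pos_inv !mxtens_indexK.
by rewrite (inj_eq idx_of_ord_inj); case: (x == x'); rewrite ?mulr1 ?mulr0.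
Qed.

Lemma act_at0 (x y z x' y' z' : 'I_4) :
  act_at S (ord0 : 'I_2) [tuple x; y; z] [tuple x'; y'; z'] =
  S (ix (x, y)) (ix (x', y')) * (z == z')%:R.
Proof.
by rewrite /act_at all_ordP /= !(tnth_nth ord0) /= eqseq_cons andbT.
Qed.

Lemma act_at1 (x y z x' y' z' : 'I_4) :
  act_at S (ord_max : 'I_2) [tuple x; y; z] [tuple x'; y'; z'] =
  S (ix (y, z)) (ix (y', z')) * (x == x')%:R.
Proof.
by rewrite /act_at all_ordP /= !(tnth_nth ord0) /= !eqseq_cons !andbT.
Qed.

Definition op_comp n (A B : tens_op F n) : tens_op F n :=
  fun t u => \sum_v A t v * B v u.

Lemma op_compA n (A B C : tens_op F n) t u :
  op_comp (op_comp A B) C t u = op_comp A (op_comp B C) t u.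
Proof.
rewrite /op_comp; under eq_bigr do rewrite mulr_suml.
rewrite exchange_big; apply: eq_bigr => v _; rewrite mulr_sumr.
by apply: eq_bigr => w _; rewrite mulrA.
Qed.

Lemma act_at0_sq (x y z x' y' z' : 'I_4) :
  op_comp (act_at S (ord0 : 'I_2)) (act_at S ord0) [tuple x; y; z] [tuple x'; y'; z'] =
  (S *m S) (ix (x, y)) (ix (x', y')) * (z == z')%:R.
Proof.
rewrite /op_comp sum_tuple3 mxE sum_mxtens mulr_suml; apply: eq_bigr => a _.
rewrite mulr_suml; apply: eq_bigr => b _.
under eq_bigr do rewrite !act_at0.
rewrite (bigD1 z) //= big1 ?addr0 => [|c /negbTE ne].
  by rewrite eqxx mulr1 mulrA.
by rewrite eq_sym ne mulr0 mul0r.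
Qed.

Lemma act_at1_sq (x y z x' y' z' : 'I_4) :
  op_comp (act_at S (ord_max : 'I_2)) (act_at S ord_max)
    [tuple x; y; z] [tuple x'; y'; z'] =
  (S *m S) (ix (y, z)) (ix (y', z')) * (x == x')%:R.
Proof.
rewrite /op_comp sum_tuple3 (bigD1 x) //= [X in _ + X]big1 ?addr0 => [|c /negbTE ne].
  rewrite mxE sum_mxtens mulr_suml; apply: eq_bigr => a _.
  rewrite mulr_suml; apply: eq_bigr => b _.
  by rewrite !act_at1 eqxx mulr1 mulrA.
by apply: big1 => a _; apply: big1 => b _; rewrite act_at1 eq_sym ne mulr0 mul0r.
Qed.

Definition HH_word : braid_word 2 :=
  [:: (ord0, true); (ord0, true); (ord_max, true); (ord_max, true)].

(** The outer strands each meet only one clasp, so the only free letter is [w], carried by the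
    middle strand between the two clasps. *)
Lemma psi_HH x y z x' y' z' :
  psi q s HH_word [tuple x; y; z] [tuple x'; y'; z'] =
  \sum_w (S *m S) (ix (y, z)) (ix (w, z')) * (S *m S) (ix (x, w)) (ix (x', y')).
Proof.
set A0 := act_at S (ord0 : 'I_2); set A1 := act_at S (ord_max : 'I_2).
have p1 t u : op_comp (fun t u => (t == u)%:R) A1 t u = A1 t u.
  rewrite /op_comp (bigD1 t) //= eqxx mul1r big1 ?addr0 // => v ne.
  by rewrite eq_sym (negbTE ne) mul0r.
transitivity (op_comp (op_comp (op_comp A1 A1) A0) A0 [tuple x; y; z] [tuple x'; y'; z']).
  rewrite /=; apply: eq_bigr => v1 _; congr (_ * _).
  apply: eq_bigr => v2 _; congr (_ * _).
  by apply: eq_bigr => v3 _; rewrite -p1.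
rewrite op_compA {1}/op_comp sum_tuple3 (bigD1 x) //= [X in _ + X]big1 ?addr0; last first.
  move=> a /negbTE ne; apply: big1 => b _; apply: big1 => c _.
  by rewrite act_at1_sq eq_sym ne mulr0 mul0r.
apply: eq_bigr => w _; rewrite (bigD1 z') //= [X in _ + X]big1 ?addr0; last first.
  by move=> c /negbTE ne; rewrite act_at0_sq ne !mulr0.
by rewrite act_at1_sq act_at0_sq !eqxx !mulr1.
Qed.

(** Closing the third strand turns the upper clasp into the Hopf scalar on the middle strand;
    closing the second strand then does the same to the lower clasp. *)
Lemma partial_trace_HH :
  partial_trace q s HH_word = (lau q s hopf_code ^+ 2)%:M.
Proof.
apply/matrixP => a c; rewrite !mxE sum_tuple2.
transitivity (\sum_x mu q s x * (lau q s hopf_code * (S *m S) (ix (a, x)) (ix (c, x)))).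
  apply: eq_bigr => x _.
  transitivity (\sum_w mu q s x * (S *m S) (ix (a, w)) (ix (c, x)) *
      (lau q s hopf_code * (x == w)%:R)).
    under [RHS]eq_bigr => w _ do rewrite -hopf_trace mulr_sumr.
    rewrite [RHS]exchange_big; apply: eq_bigr => y _.
    have -> : cons_tuple a [tuple x; y] = [tuple a; x; y] by exact: val_inj.
    have -> : cons_tuple c [tuple x; y] = [tuple c; x; y] by exact: val_inj.
    rewrite psi_HH !big_cons big_nil mulr1 mulr_sumr; apply: eq_bigr => w _.
    by ring.
  rewrite (bigD1 x) //= big1 ?addr0 => [|w /negbTE ne]; last first.
    by rewrite eq_sym ne !mulr0.
  by rewrite eqxx mulr1 -mulrA [_ * lau _ _ _]mulrC.
under eq_bigr do rewrite mulrCA.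
by rewrite -mulr_sumr hopf_trace mulrA -expr2 mulr_natr.
Qed.

End HH.

Lemma LG11_HH : LG11 HH = R5.
Proof.
have iso : isotopic (braid_closure HH_word) HH by exact: rst_refl.
apply/esym/spec_inj/spec_LG; last first.
  by exists 2%N, HH_word; split; [exact: iso | exact: (partial_trace_HH Qqs_generic)].
(* [hopf_code] reduces to 7, and 49 is 5 modulo 11. *)
exact: (specX 2 (spec_laurent hopf_code)).
Qed.

Lemma LG11_AS_neq n : (1 <= n)%N -> LG11 (AS n) != R5.
Proof. by case: n => [|[|n]] // _; rewrite (LG11_AS1, LG11_AS). Qed.

Theorem theorem1p3 (n : nat) (hn : (1 <= n)%N) : LG (AS n) <> LG HH.
Proof.
have specHH : spec (LG HH) R5.
  have ex : exists p m (b : braid_word m),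
      isotopic (braid_closure b) HH /\ partial_trace q_ s_ b = p%:M.
    exists (lau q_ s_ hopf_code ^+ 2), 2%N, HH_word.
    by split; [exact: rst_refl | exact: (partial_trace_HH Qqs_generic)].
  by rewrite -LG11_HH; exact: spec_LG (xgetPex 0 ex).
rewrite {1}/LG /LG_at; case: xgetP => [p _ /spec_LG specAS | _] e.
  by have /eqP := LG11_AS_neq hn; apply; apply: (spec_inj specAS); rewrite e.
(* Here [LG (AS n)] is the default value 0 of [xget], which reduces to 0 and not to 5. *)
by move: specHH; rewrite -e => /(spec_inj spec0).
Qed.
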